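(* Let $(W,S)_B$ be a Lorentzian Coxeter system with set of limit directions $E_V$ and set of limit roots $E_\Phi$. Let $\mathscr U_{\mathrm{hyp}}=\bigcup_{w\in W_{\mathrm{hyp}}}\widehat{U_w}\subset\mathbb{P}V$ be the union of the projective unimodular subspaces of the hyperbolic elements of $W$. Then $\mathscr U_{\mathrm{hyp}}$ and $E_\Phi$ are disjoint and $$\mathscr U_{\mathrm{hyp}}\sqcup E_\Phi\subseteq E_V\subseteq\overline{\mathscr U_{\mathrm{hyp}}},$$ where the bar denotes closure in $\mathbb{P}V$.
   Context: Let $(W,S)$ be a Coxeter system with $S$ finite, $|S|=n$ (the rank), with relations $(st)^{m_{st}}=e$, $m_{ss}=1$, $m_{st}=m_{ts}\ge 2$ or $=\infty$ for $s\ne t$. Associate to it a symmetric matrix $B$ with $B_{st}=-\cos(\pi/m_{st})$ if $m_{st}<\infty$ and $B_{st}=-c_{st}$ if $m_{st}=\infty$, where the $c_{st}=c_{ts}\ge 1$ are arbitrarily chosen. The pair is a geometric Coxeter system, denoted $(W,S)_B$. Let $V$ be a real vector space with basis $\Delta=\{\alpha_s\}_{s\in S}$ (simple roots) and bilinear form $\mathcal B(\alpha_s,\alpha_t)=B_{st}$. $W$ acts faithfully on $V$, with $s\in S$ acting as the reflection $\mathbf x\mapsto \mathbf x-2\frac{\mathcal B(\mathbf x,\alpha_s)}{\mathcal B(\alpha_s,\alpha_s)}\alpha_s$; write $w(\mathbf x)$ for the action. The system is Lorentzian if $\mathcal B$ has signature $(n-1,1)$. $\mathbb{P}V$ is the projective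 space of $1$-dimensional subspaces of $V$ with its usual topology; for $\mathbf x\in V\setminus\{0\}$, $\widehat{\mathbf x}\in\mathbb{P}V$ is the line spanned by $\mathbf x$; for $X\subset V$, $\widehat X=\{\widehat{\mathbf x}:\mathbf x\in X\setminus\{0\}\}$. $W$ acts on $\mathbb{P}V$ by $w\cdot\widehat{\mathbf x}=\widehat{w(\mathbf x)}$. A limit direction of $(W,S)_B$ is a point of $\mathbb{P}V$ of the form $\lim_{i\to\infty}w_i\cdot\widehat{\mathbf x}_0$ for some $\mathbf x_0\in V\setminus\{0\}$ and some sequence $(w_i)_{i\in\mathbb N}$ in $W$ such that the sequence of points $(w_i\cdot\widehat{\mathbf x}_0)_{i\in\mathbb N}$ is injective; $E_V$ is the set of all limit directions. The roots are $\Phi=W(\Delta)$; $E_\Phi$ (limit roots) is the set of $\widehat{\mathbf x}\in\mathbb{P}V$ for which there is an injective sequence $(\gamma_i)$ in $\Phi$ with $\widehat{\gamma_i}\to\widehat{\mathbf x}$. An element $w\in W$ is hyperbolic if its action on $V$ is diagonalizable over $\mathbb C$ and has exactly one pair of simple, real, non-unimodular eigenvalues $\lambda^{\pm1}$ with $|\lambda|>1$ (unimodular means of absolute value $1$). $W_{\mathrm{hyp}}$ is the set of hyperbolic elements. For $w\in W_{\mathrm{hyp}}$, the unimodular subspace $U_w\subset V$ is the $(n-2)$-dimensional real subspace spanned by the unimodular eigenvectors of $w$, i.e. the real span of the real and imaginary parts of the complex eigenvectors whose eigenvalue has absolute value $1$.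
   Formalization: The inclusion of E_V in the closure of U_hyp is proved only when no component of the Coxeter graph is a single edge with m_st = ∞; otherwise it is false (e.g. the infinite dihedral group of rank 2 with c_st > 1, where U_hyp is empty but E_V is not). *)

(* Defs.v *)
From HB Require Import structures.
From mathcomp Require Import all_boot all_order all_algebra.
From mathcomp Require Import all_classical all_reals all_analysis.
From mathcomp Require Import complex.
From mathcomp Require Import ring lra.

Set Implicit Arguments.
Unset Strict Implicit.
Unset Printing Implicit Defensive.

Import Order.TTheory GRing.Theory Num.Theory.
Import numFieldNormedType.Exports.

Local Open Scope classical_set_scope.
Local Open Scope ring_scope.
Local Open Scope quotient_scope.

(* The generators are indexed by 'I_n; [None] encodes m_st = oo. *)
Definition coxeter_matrix (n : nat) (m : 'I_n -> 'I_n -> option nat) : Prop :=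
  [/\ forall s, m s s = Some 1%N,
      forall s t, m s t = m t s &
      forall s t k, s != t -> m s t = Some k -> (2 <= k)%N].

Definition coxeter_relations (n : nat) (m : 'I_n -> 'I_n -> option nat)
    (G : groupType) (f : 'I_n -> G) : Prop :=
  forall s t k, m s t = Some k -> ((f s * f t) ^+ k)%g = 1%g.

(* W is presented by the generators and the relations (st)^m_st = e: it is
   generated by them, satisfies the relations, and maps to any group in which
   the relations hold. *)
Definition coxeter_system (n : nat) (m : 'I_n -> 'I_n -> option nat)
    (W : groupType) (gen : 'I_n -> W) : Prop :=
  [/\ coxeter_matrix m,
      coxeter_relations m gen,
      forall w : W, exists u : seq 'I_n, w = (\prod_(s <- u) gen s)%g &
      forall (G : groupType) (f : 'I_n -> G), coxeter_relations m f ->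
        exists phi : W -> G,
          {morph phi : x y / (x * y)%g} /\ forall s, phi (gen s) = f s].

(* [cox_weight s t] is c_st; it is only constrained, and only used, when
   m_st = oo. *)
Record geomCoxeterSystem (R : realType) (n : nat) := GeomCoxeterSystem {
  cox_group :> groupType;
  cox_gen : 'I_n -> cox_group;
  cox_m : 'I_n -> 'I_n -> option nat;
  cox_weight : 'I_n -> 'I_n -> R;
  coxeter_systemP : coxeter_system cox_m cox_gen;
  cox_weight_sym :
    forall s t, cox_m s t = None -> cox_weight s t = cox_weight t s;
  cox_weight_ge1 : forall s t, cox_m s t = None -> 1 <= cox_weight s t }.

Section Form.
Context {R : realType} {n : nat}.

Definition bform (B : 'M[R]_n) (x y : 'cV[R]_n) : R := (x^T *m B *m y) 0 0.

Definition simple_root (s : 'I_n) : 'cV[R]_n := delta_mx s 0.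

Definition reflection (B : 'M[R]_n) (s : 'I_n) (x : 'cV[R]_n) : 'cV[R]_n :=
  x - (2 * bform B x (simple_root s) /
        bform B (simple_root s) (simple_root s)) *: simple_root s.

(* Sylvester: the form is diagonal with p positive and q negative entries
   in a suitable basis. *)
Definition has_signature (B : 'M[R]_n) (p q : nat) : Prop :=
  exists (P : 'M[R]_n) (d : 'rV[R]_n),
    [/\ P \in unitmx, P^T *m B *m P = diag_mx d,
        #|[set i | (0 < d 0 i)%R]%SET| = p &
        #|[set i | (d 0 i < 0)%R]%SET| = q].

End Form.

Definition gram_mx (R : realType) (n : nat) (X : geomCoxeterSystem R n)
    : 'M[R]_n :=
  \matrix_(s, t) if cox_m X s t is Some k then - cos (pi / k%:R)
                 else - cox_weight X s t.

Definition lorentzian (R : realType) (n : nat) (X : geomCoxeterSystem R n) :=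
  has_signature (gram_mx X) n.-1 1.

(* GL(V), used to obtain the action from the universal property of W. *)
Record GLmx (R : realType) (n : nat) := GLMx {
  GLmx_val :> 'M[R]_n;
  GLmx_unit : GLmx_val \in unitmx }.

Section GL.
Context {R : realType} {n : nat}.
Local Notation GL := (GLmx R n).

HB.instance Definition _ := [isSub for @GLmx_val R n].
HB.instance Definition _ := [Choice of GL by <:].

Definition GLone : GL := GLMx (unitmx1 R n).
Lemma GLmul_unit (A B : GL) : val A *m val B \in unitmx.
Proof. by rewrite unitmx_mul (valP A) (valP B). Qed.
Definition GLmul (A B : GL) : GL := GLMx (GLmul_unit A B).
Lemma GLinv_unit (A : GL) : invmx (val A) \in unitmx.
Proof. by rewrite unitmx_inv (valP A). Qed.
Definition GLinv (A : GL) : GL := GLMx (GLinv_unit A).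

Lemma GLmulA : associative GLmul.
Proof. by move=> A B C; apply: val_inj; rewrite /= mulmxA. Qed.
Lemma GLmul1 : left_id GLone GLmul.
Proof. by move=> A; apply: val_inj; rewrite /= mul1mx. Qed.
Lemma GLmulr1 : right_id GLone GLmul.
Proof. by move=> A; apply: val_inj; rewrite /= mulmx1. Qed.
Lemma GLmulV : left_inverse GLone GLinv GLmul.
Proof. by move=> A; apply: val_inj; rewrite /= mulVmx// (valP A). Qed.
Lemma GLmulrV : right_inverse GLone GLinv GLmul.
Proof. by move=> A; apply: val_inj; rewrite /= mulmxV// (valP A). Qed.

HB.instance Definition _ :=
  isGroup.Build GL GLmulA GLmul1 GLmulr1 GLmulV GLmulrV.

End GL.

Section Dihedral.
Context {R : realType} {V : lmodType R}.
Variables (f g : V -> R) (a b : V) (theta : R).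
Hypotheses (fD : {morph f : x y / x + y}) (gD : {morph g : x y / x + y}).
Hypotheses (fZ : forall c x, f (c *: x) = c * f x).
Hypotheses (gZ : forall c x, g (c *: x) = c * g x).
Hypotheses (fa : f a = 1) (gb : g b = 1).
Hypotheses (fb : f b = - cos theta) (ga : g a = - cos theta).

Let T (x : V) : V := x - (2 * g x) *: b - (2 * f (x - (2 * g x) *: b)) *: a.

Let TE (y : V) (p q : R) : f y = 0 -> g y = 0 ->
  T (y + p *: a + q *: b) =
  y + ((4 * cos theta ^+ 2 - 1) * p - 2 * cos theta * q) *: a
    + (2 * cos theta * p - q) *: b.
Proof.
move=> fy gy; rewrite /T.
have gE : g (y + p *: a + q *: b) = - p * cos theta + q.
  by rewrite !gD !gZ gy ga gb; ring.
rewrite gE.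
have -> : y + p *: a + q *: b - (2 * (- p * cos theta + q)) *: b =
          y + p *: a + (2 * cos theta * p - q) *: b.
  by rewrite -addrA -scalerBl; congr (_ + _ *: _); ring.
have -> : f (y + p *: a + (2 * cos theta * p - q) *: b) =
          p - (2 * cos theta * p - q) * cos theta.
  by rewrite !fD !fZ fy fa fb; ring.
rewrite addrAC; congr (_ + _); rewrite -addrA -scalerBl.
by congr (_ + _ *: _); ring.
Qed.

Lemma iter_dihedral (y : V) (u v : R) (j : nat) :
    sin theta != 0 -> f y = 0 -> g y = 0 ->
  let phi := theta *+ j.*2 in
  iter j T (y + u *: a + v *: b) =
  y + ((u * sin (phi + theta) - v * sin phi) / sin theta) *: a
    + ((u * sin phi - v * sin (phi - theta)) / sin theta) *: b.
Proof.
move=> s0 fy gy; elim: j => [|j IH] /=.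
  rewrite double0 mulr0n add0r sub0r sin0 sinN.
  by congr (_ + _ *: _ + _ *: _); field.
rewrite IH TE//.
have -> : theta *+ j.+1.*2 = theta *+ j.*2 + theta + theta.
  by rewrite doubleS !mulrSr.
set phi := theta *+ j.*2.
have E x : sin (x + theta + theta) = 2 * cos theta * sin (x + theta) - sin x.
  rewrite !sinD cosD.
  transitivity (sin x * (cos theta ^+ 2 - sin theta ^+ 2)
                + 2 * (cos x * sin theta * cos theta)); first by ring.
  by rewrite sin2cos2; ring.
have E0 : sin (phi - theta) = 2 * cos theta * sin phi - sin (phi + theta).
  by have := E (phi - theta); rewrite subrK => ->; ring.
rewrite addrK !E E0.
by congr (_ + _ *: _ + _ *: _); field.
Qed.

End Dihedral.

Section Representation.
Context {R : realType} {n : nat}.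
Implicit Types (B : 'M[R]_n) (x y z : 'cV[R]_n).

Lemma bformDl B z : {morph (fun x => bform B x z) : x y / x + y}.
Proof. by move=> x y; rewrite /bform linearD /= !mulmxDl mxE. Qed.

Lemma bformZl B z c x : bform B (c *: x) z = c * bform B x z.
Proof. by rewrite /bform linearZ /= -!scalemxAl mxE. Qed.

Lemma bform_simple B s t : bform B (simple_root s) (simple_root t) = B s t.
Proof.
by rewrite /bform /simple_root trmx_delta -rowE -colE !mxE.
Qed.

Definition reflection_mx B (s : 'I_n) : 'M[R]_n :=
  1%:M - (2 / B s s) *: (simple_root s *m (B *m simple_root s)^T).

Lemma reflection_mxE B s x : reflection_mx B s *m x = reflection B s x.
Proof.
rewrite /reflection_mx /reflection mulmxBl mul1mx -scalemxAl -mulmxA.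
have -> : (B *m simple_root s)^T *m x = (bform B x (simple_root s))%:M.
  rewrite [LHS]mx11_scalar; congr (_%:M); rewrite /bform -mulmxA.
  by rewrite -[x in LHS]trmxK -trmx_mul mxE.
by rewrite mul_mx_scalar scalerA bform_simple mulrAC.
Qed.

Lemma reflection_mxK B s : B s s != 0 ->
  reflection_mx B s *m reflection_mx B s = 1%:M.
Proof.
move=> Bs; apply/matrixP => i j.
suff H x : reflection_mx B s *m (reflection_mx B s *m x) = x.
  have /matrixP/(_ i 0) := H (delta_mx j 0).
  by rewrite mulmxA -colE !mxE => ->; rewrite eqxx andbT.
rewrite !reflection_mxE /reflection !bform_simple.
rewrite -scaleNr bformDl bformZl bform_simple -addrA -scalerBl.
by rewrite (_ : _ - _ = 0) ?scale0r ?addr0//; field.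
Qed.

End Representation.

Section Action.
Context {R : realType} {n : nat} (X : geomCoxeterSystem R n).
Local Notation B := (gram_mx X).

Lemma gram_mx_diag s : B s s = 1.
Proof.
by rewrite mxE; have [[-> _ _] _ _ _] := coxeter_systemP X;
  rewrite divr1 cospi opprK.
Qed.

Lemma gram_mx_sym s t : B s t = B t s.
Proof.
have [[_ m_sym _] _ _ _] := coxeter_systemP X.
rewrite !mxE m_sym; case E : cox_m => //.
by rewrite cox_weight_sym// m_sym.
Qed.

Lemma reflection_unit s : reflection_mx B s \in unitmx.
Proof.
have := @reflection_mxK R n B s; rewrite gram_mx_diag => /(_ (oner_neq0 _)).
by case/mulmx1_unit.
Qed.

Lemma reflection_relations :
  coxeter_relations (@cox_m _ _ X) (fun s => GLMx (reflection_unit s)).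
Proof.
have [[m_diag m_sym m_ge2] _ _ _] := coxeter_systemP X.
have iterE (A : GLmx R n) k (x : 'cV[R]_n) :
    val (A ^+ k)%g *m x = iter k (fun y => val A *m y) x.
  by elim: k => [|k IH]; rewrite ?mul1mx// expgS /= -mulmxA IH.
have ext (A : GLmx R n) : (forall x : 'cV[R]_n, val A *m x = x) -> A = 1%g.
  move=> H; apply: val_inj; apply/matrixP => i j.
  have /matrixP/(_ i 0) := H (delta_mx j 0).
  by rewrite -colE !mxE => ->; rewrite eqxx andbT.
move=> s t k m_st; apply: ext => x; rewrite iterE /=.
have [est|nst] := eqVneq s t.
  move: m_st; rewrite -est m_diag => -[<-] /=.
  by rewrite reflection_mxK ?mul1mx// gram_mx_diag oner_neq0.
have k_ge2 := m_ge2 _ _ _ nst m_st.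
have k0 : (k%:R : R) != 0 by rewrite pnatr_eq0 -lt0n ltnW.
pose a : 'cV[R]_n := simple_root s; pose b : 'cV[R]_n := simple_root t.
pose th : R := pi / k%:R.
have Bst : B s t = - cos th by rewrite mxE m_st.
have s0 : sin th != 0.
  rewrite gt_eqF// sin_gt0_pi// divr_gt0 ?pi_gt0 ?ltr0n ?(ltnW k_ge2)//=.
  by rewrite ltr_pdivrMr ?ltr0n ?(ltnW k_ge2)// ltr_pMr ?pi_gt0// ltr1n.
pose f (y : 'cV[R]_n) := bform B y a; pose g (y : 'cV[R]_n) := bform B y b.
have fD : {morph f : x y / x + y} by exact: bformDl.
have gD : {morph g : x y / x + y} by exact: bformDl.
have fZ c y : f (c *: y) = c * f y by exact: bformZl.
have gZ c y : g (c *: y) = c * g y by exact: bformZl.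
have fa : f a = 1 by rewrite /f bform_simple gram_mx_diag.
have gb : g b = 1 by rewrite /g bform_simple gram_mx_diag.
have fb : f b = - cos th by rewrite /f bform_simple gram_mx_sym.
have ga : g a = - cos th by rewrite /g bform_simple.
have TE : (fun y : 'cV[R]_n => reflection_mx B s *m reflection_mx B t *m y) =
    fun y => y - (2 * g y) *: b - (2 * f (y - (2 * g y) *: b)) *: a.
  apply/funext => y; rewrite -mulmxA !reflection_mxE /reflection.
  by rewrite -/a -/b -!/(f _) -!/(g _) fa gb !divr1.
pose D := sin th ^+ 2; have D0 : D != 0 by exact: expf_neq0.
have DE : D - 1 + cos th ^+ 2 = 0 by rewrite /D sin2cos2; ring.
have fE p q : f (x - p *: a - q *: b) = f x - p + q * cos th.
  by rewrite -!scaleNr !fD !fZ fa fb; ring.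
have gE p q : g (x - p *: a - q *: b) = g x + p * cos th - q.
  by rewrite -!scaleNr !gD !gZ ga gb; ring.
pose u := (f x + cos th * g x) / D.
pose v := (g x + cos th * f x) / D.
pose y := x - u *: a - v *: b.
have fy : f y = 0.
  transitivity (f x * (D - 1 + cos th ^+ 2) / D); last by rewrite DE mulr0 mul0r.
  by rewrite /y fE /u /v; field.
have gy : g y = 0.
  transitivity (g x * (D - 1 + cos th ^+ 2) / D); last by rewrite DE mulr0 mul0r.
  by rewrite /y gE /u /v; field.
have -> : x = y + u *: a + v *: b by rewrite /y addrAC !subrK.
rewrite TE (iter_dihedral fD gD fZ gZ fa gb fb ga _ _ _ s0 fy gy).
have -> : th *+ k.*2 = pi *+ 2.
  by rewrite -mul2n mulnC mulrnA /th -[_ *+ k]mulr_natr divfK.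
have -> : sin (pi *+ 2 + th) = sin th.
  by rewrite sinD cos2pi sin2pi mul0r mul1r add0r.
have -> : sin (pi *+ 2 - th) = - sin th.
  by rewrite sinB cos2pi sin2pi mul0r mul1r sub0r.
by rewrite sin2pi !mulr0 subr0 sub0r mulrN opprK !mulfK.
Qed.

Lemma geom_rep_exists : exists rho : X -> 'M[R]_n,
  [/\ rho 1%g = 1%:M,
      forall w1 w2, rho (w1 * w2)%g = rho w1 *m rho w2 &
      forall s x, rho (cox_gen X s) *m x = reflection B s x].
Proof.
have [_ _ _ univ] := coxeter_systemP X.
have [phi [phiM phi_gen]] := univ _ _ reflection_relations.
exists (fun w => val (phi w)); split=> [|w1 w2|s x].
- have /(congr1 (fun z => (phi 1%g)^-1 * z)%g) := phiM 1%g 1%g.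
  by rewrite mulg1 mulKg mulVg => <-.
- by rewrite phiM.
- by rewrite phi_gen reflection_mxE.
Qed.

End Action.

Section GeometricRepresentation.
Context {R : realType} {n : nat} (X : geomCoxeterSystem R n).

Definition geom_rep : X -> 'M[R]_n := sval (cid (geom_rep_exists X)).

Lemma geom_rep1 : geom_rep 1%g = 1%:M.
Proof. by rewrite /geom_rep; case: cid => rho []. Qed.

Lemma geom_repM w1 w2 : geom_rep (w1 * w2)%g = geom_rep w1 *m geom_rep w2.
Proof. by rewrite /geom_rep; case: cid => rho []. Qed.

Lemma geom_rep_gen s x :
  geom_rep (cox_gen X s) *m x = reflection (gram_mx X) s x.
Proof. by rewrite /geom_rep; case: cid => rho []. Qed.

Lemma geom_rep_unique (rho : X -> 'M[R]_n) :
    rho 1%g = 1%:M ->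
    (forall w1 w2, rho (w1 * w2)%g = rho w1 *m rho w2) ->
    (forall s x, rho (cox_gen X s) *m x = reflection (gram_mx X) s x) ->
  rho = geom_rep.
Proof.
move=> rho1 rhoM rho_gen; apply/funext => w.
have [_ _ /(_ w)[u ->] _] := coxeter_systemP X.
elim: u => [|s u IH]; first by rewrite big_nil rho1 geom_rep1.
rewrite big_cons rhoM geom_repM IH; congr (_ *m _).
apply/matrixP => i j; rewrite -[LHS]mulr1.
have /matrixP/(_ i 0) := geom_rep_gen s (delta_mx j 0).
by rewrite -rho_gen -!colE !mxE mulr1 => ->.
Qed.

Definition act (w : X) (x : 'cV[R]_n) : 'cV[R]_n := geom_rep w *m x.

Lemma act_neq0 (w : X) (x : 'cV[R]_n) : x != 0 -> act w x != 0.
Proof.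
apply: contraNneq => wx0.
by rewrite -[x]mul1mx -geom_rep1 -(mulVg w) geom_repM -mulmxA -/(act w x) wx0
  mulmx0.
Qed.

Definition roots : set 'cV[R]_n :=
  [set x | exists (w : X) (s : 'I_n), x = act w (simple_root s)].

End GeometricRepresentation.

Section Projective.
Variables (R : realType) (n : nat).

(* V \ {0}, with the subspace topology *)
Definition nzvec := set_type [set x : 'cV[R]_n | x != 0].

Definition same_line (x y : nzvec) : bool :=
  (<[\val x]> == <[\val y]>)%VS.

Lemma same_line_equiv : equiv_class_of same_line.
Proof.
split; first by move=> x; exact: eqxx.
  by move=> x y; exact: eq_sym.
by move=> y x z /eqP xy; rewrite /same_line xy.
Qed.

Canonical same_line_equivRel := EquivRelPack same_line_equiv.

Definition projSpace := {eq_quot same_line_equivRel}.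

HB.instance Definition _ := Quotient.on projSpace.
HB.instance Definition _ :=
  Topological.copy projSpace (quotient_topology projSpace).

Definition proj_pt (x : nzvec) : projSpace := \pi_projSpace x.

Lemma proj_pt_eq (x y : nzvec) :
  proj_pt x = proj_pt y <-> (<[\val x]> = <[\val y]>)%VS.
Proof.
split; first by move=> /eqmodP/eqP.
by move=> xy; apply/eqmodP; exact/eqP.
Qed.

Definition proj_set (A : set 'cV[R]_n) : set projSpace :=
  [set p | exists2 x : nzvec, A (\val x) & p = proj_pt x].

End Projective.

Section LimitDirections.
Context {R : realType} {n : nat} (X : geomCoxeterSystem R n).
Local Notation nzvec := (nzvec R n).
Local Notation projSpace := (projSpace R n).

Definition nz_act (w : X) (x : nzvec) : nzvec :=
  exist _ (act w (\val x)) (mem_set (act_neq0 w (set_mem (valP x)))).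

Definition proj_act (w : X) (p : projSpace) : projSpace :=
  proj_pt (nz_act w (repr p)).

Lemma proj_act_pt (w : X) (x : nzvec) :
  proj_act w (proj_pt x) = proj_pt (nz_act w x).
Proof.
apply/proj_pt_eq => /=; set y := repr _.
have /proj_pt_eq yx : proj_pt y = proj_pt x by exact: reprK.
have act_sub u v : (<[u]> <= <[v]>)%VS -> (<[act w u]> <= <[act w v]>)%VS.
  move=> /vlineP[c ->]; apply/vlineP; exists c.
  by rewrite /act -scalemxAr.
by apply/eqP; rewrite eqEsubv !act_sub ?yx ?subvv.
Qed.

Definition limit_directions : set projSpace :=
  [set p | exists (x0 : nzvec) (w : nat -> X),
    injective (fun i => proj_act (w i) (proj_pt x0)) /\
    (fun i => proj_act (w i) (proj_pt x0)) @ \oo --> p].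

Definition limit_roots : set projSpace :=
  [set p | exists gamma : nat -> nzvec,
    [/\ injective gamma,
        forall i, roots X (\val (gamma i)) &
        (fun i => proj_pt (gamma i)) @ \oo --> p]].

End LimitDirections.

Section Hyperbolic.
Context {R : realType} {n : nat} (X : geomCoxeterSystem R n).

Definition geom_repC (w : X) : 'M[R[i]]_n :=
  map_mx (real_complex R) (geom_rep w).

(* The last clause makes lambda^{+-1} the only non-unimodular eigenvalues, real
   or not; this is what gives the unimodular subspace dimension n - 2. *)
Definition hyperbolic (w : X) : Prop :=
  diagonalizable (geom_repC w) /\
  exists lambda : R,
    [/\ 1 < `|lambda|,
        mup (real_complex R lambda) (char_poly (geom_repC w)) = 1%N,
        mup (real_complex R lambda^-1) (char_poly (geom_repC w)) = 1%N &
        forall mu : R[i], eigenvalue (geom_repC w) mu ->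
          mu != real_complex R lambda -> mu != real_complex R lambda^-1 ->
          `|mu| = 1].

Definition unimodular_eigenvector (w : X) (z : 'cV[R[i]]_n) : Prop :=
  z != 0 /\ exists mu : R[i], `|mu| = 1 /\ geom_repC w *m z = mu *: z.

Definition real_span (A : set 'cV[R]_n) : set 'cV[R]_n :=
  [set v | exists (k : nat) (a : 'I_k -> R) (u : 'I_k -> 'cV[R]_n),
    (forall i, A (u i)) /\ v = \sum_(i < k) a i *: u i].

Definition unimodular_subspace (w : X) : set 'cV[R]_n :=
  real_span
    [set v | exists2 z, unimodular_eigenvector w z &
       v = map_mx (@complex.Re R) z \/ v = map_mx (@complex.Im R) z].

Definition hyperbolic_unimodular_set : set (projSpace R n) :=
  \bigcup_(w in [set w : X | hyperbolic w]) proj_set (unimodular_subspace w).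

End Hyperbolic.

(* Some component of the Coxeter graph is a single edge labelled oo. In a
   Lorentzian system W is then infinite dihedral times finite: there are just
   two limit roots, and they are not in the closure of the union of the
   projective unimodular subspaces (in rank 2 every unimodular subspace is 0,
   so this union is empty). *)
Definition has_infinite_dihedral_component (R : realType) (n : nat)
    (X : geomCoxeterSystem R n) : Prop :=
  exists s t : 'I_n, cox_m X s t = None /\
    forall u, u != s -> u != t ->
      cox_m X u s = Some 2%N /\ cox_m X u t = Some 2%N.

(* Main.v *)
Require Import Defs.
From mathcomp Require Import all_boot all_order all_algebra.
From mathcomp Require Import all_classical all_reals all_analysis.
From mathcomp Require Import complex.
From mathcomp Require Import ring lra.
Import Order.TTheory GRing.Theory Num.Theory.
Import numFieldNormedType.Exports.
Local Open Scope classical_set_scope.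
Local Open Scope ring_scope.

Set Implicit Arguments.
Unset Strict Implicit.
Unset Printing Implicit Defensive.

(** Write b for the bilinear form and fix a unit time-like vector o, so that b
    is positive definite on the orthogonal of o (lorentz_form). Everything
    rests on the dynamics of the group on light-like lines.

    Discreteness. By Tits' theorem (root_nonneg) the action is free on
    chambers, so a sequence of group elements whose matrices converge is
    eventually constant (converging_constant), and along any injective sequence
    w_k the number N_k = b (w_k o) o tends to infinity in absolute value. Limits
    are taken along an ultrafilter on nat, along which every bounded sequence
    converges. Then w_k / N_k has a limit, which multiplies b by zero; its
    image is a light-like line and it has the form x |-> b m x *: p with p and m
    light-like (rank_one_limit). Such vectors p and m, the limits of rescaled
    orbits of o, are called limit vectors here.

    Hyperbolic elements. A complex eigenvector of an isometry with a
    non-unimodular eigenvalue has isotropic real and imaginary parts, hence is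
    real up to a factor. So the hyperbolic elements are exactly the loxodromic
    ones, which have two real eigenvectors a and c with eigenvalues l and l^-1,
    where l is not unimodular, and their unimodular subspace is the orthogonal
    of a and c, on which b is positive definite (hyperbolic_loxodromic,
    loxodromic_hyperbolic, loxodromic_perp_unimodular). An element whose
    trace exceeds n in absolute value is loxodromic (large_trace_loxodromic); composing sequences
    with prescribed attracting and repelling vectors one finds that the
    orthogonal of any two independent limit vectors lies in the closure K of
    the union of the unimodular subspaces (limit_vectors_perp).

    The theorem. Roots have norm 1 and reflections in roots belong to the
    discrete group, so limit roots are not space-like
    (limit_root_not_spacelike), whereas unimodular subspaces are. A vector x of
    the unimodular subspace of w is recurrent under w, so that its direction is
    the limit of those of w^m (x + c) for suitable m. A limit root is a limit
    of images of one simple root. Finally let p be the limit of c_k w_k x, with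
    attracting vector a and repelling vector m (limit_direction_K). If b x m is
    not zero, p is proportional to a. Otherwise x is proportional to m or
    space-like. Limit vectors are in K, as they attract the points of some
    unimodular subspace; this fails only if m lies on both fixed lines of all
    loxodromic elements, that is, for an infinite dihedral component. When p
    is space-like, either w_k m tends to another line than that of a, and p is
    orthogonal to both, or x itself can be approximated by vectors orthogonal
    to m and to w_k^-1 u, for a third limit vector u; as K is closed and
    invariant, p is in K in both cases (spacelike_limit_K). *)

(** * Limits of matrices along filters and ultrafilters *)

Lemma near_eq_lim (T : Type) (F : set_system T) (FF : Filter F)
    (V : topologicalType) (u v : T -> V) (l : V) :
  v @ F --> l -> (\forall k \near F, v k = u k) -> u @ F --> l.
Proof. by move=> vl uv; apply: cvg_trans vl; exact: near_eq_cvg. Qed.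

Section MatrixLimits.
Context {R : realType} {T : Type} {F : set_system T} {FF : ProperFilter F}.

Lemma mx_cvgP p q (u : T -> 'M[R]_(p, q)) (l : 'M[R]_(p, q)) :
  u @ F --> l <-> forall i j, (fun k => u k i j) @ F --> l i j.
Proof.
split=> [ul i j|ul].
  exact: (@cvg_comp _ _ _ u (fun M : 'M[R]_(p, q) => M i j) _ _ _ ul
    (@coord_continuous R p q i j l)).
apply/cvg_ballP => e e0.
have H : \forall k \near F, forall i j, ball (l i j) e (u k i j).
  by do 2 apply: filter_forall => ?; exact: (cvg_ball (ul _ _) e0).
by apply: filterS H => k H; split.
Qed.

Lemma cvg_sumr (I : finType) (f : I -> T -> R) (a : I -> R) :
  (forall i, f i @ F --> a i) -> (fun k => \sum_i f i k) @ F --> \sum_i a i.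
Proof.
move=> fa; apply: (@cvg_big _ _ +%R 0 xpredT) => [x|i _]; last exact: fa.
exact: (@add_continuous R x).
Qed.

Lemma cvg_mulmx p q r (u : T -> 'M[R]_(p, q)) (v : T -> 'M[R]_(q, r))
    (a : 'M[R]_(p, q)) (b : 'M[R]_(q, r)) :
  u @ F --> a -> v @ F --> b -> (fun k => u k *m v k) @ F --> a *m b.
Proof.
move=> /mx_cvgP ua /mx_cvgP vb; apply/mx_cvgP => i j.
under eq_cvg do rewrite mxE.
rewrite mxE; apply: cvg_sumr => h; exact: cvgM.
Qed.

Lemma cvg_trmx p q (u : T -> 'M[R]_(p, q)) (a : 'M[R]_(p, q)) :
  u @ F --> a -> (fun k => (u k)^T) @ F --> a^T.
Proof.
move=> /mx_cvgP ua; apply/mx_cvgP => i j.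
by under eq_cvg do rewrite mxE; rewrite mxE; exact: ua.
Qed.

Lemma cvg_bform n (B : 'M[R]_n) (u v : T -> 'cV[R]_n) (a b : 'cV[R]_n) :
  u @ F --> a -> v @ F --> b ->
  (fun k => bform B (u k) (v k)) @ F --> bform B a b.
Proof.
move=> ua vb; have : (fun k => (u k)^T *m B *m v k) @ F --> a^T *m B *m b.
  by apply: cvg_mulmx => //; apply: cvg_mulmx; [exact: cvg_trmx|exact: cvg_cst].
by move=> /mx_cvgP; exact.
Qed.

Lemma cvg_mxtrace n (u : T -> 'M[R]_n) (a : 'M[R]_n) :
  u @ F --> a -> (fun k => \tr (u k)) @ F --> \tr a.
Proof. by move=> /mx_cvgP ua; apply: cvg_sumr => i; exact: ua. Qed.

Lemma cvg_scalemx p q (c : T -> R) (u : T -> 'M[R]_(p, q)) (k : R)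
    (a : 'M[R]_(p, q)) :
  c @ F --> k -> u @ F --> a -> (fun i => c i *: u i) @ F --> k *: a.
Proof.
move=> ck /mx_cvgP ua; apply/mx_cvgP => i j.
by under eq_cvg do rewrite mxE; rewrite mxE; exact: cvgM.
Qed.

Lemma real_lim_unique (u : T -> R) (a b : R) : u @ F --> a -> u @ F --> b -> a = b.
Proof. by move=> ua ub; apply: (cvg_unique _ ua ub). Qed.

Lemma mx_lim_unique p q (u : T -> 'M[R]_(p, q)) (a b : 'M[R]_(p, q)) :
  u @ F --> a -> u @ F --> b -> a = b.
Proof.
move=> /mx_cvgP ua /mx_cvgP ub; apply/matrixP => i j.
exact: real_lim_unique (ua i j) (ub i j).
Qed.

End MatrixLimits.

Section Ultrafilters.
Context {R : realType} {F : set_system nat} {FU : UltraFilter F}.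

(** The image of an ultrafilter is an ultrafilter, and this one contains a
    compact segment. Throughout, this replaces the extraction of subsequences. *)
Lemma ultra_bounded_cvg (u : nat -> R) C :
  (\forall k \near F, `|u k| <= C) -> exists l : R, u @ F --> l.
Proof.
move=> uC; have := @segment_compact R (- C) C; rewrite compact_ultra => cpt.
have FU' : UltraFilter (u @ F).
  split=> [|G GF FG]; first exact: fmap_proper_filter.
  rewrite predeqE => A; split; last exact: FG.
  move=> GA; have [//|FnA] := in_ultra_setVsetC (u @^-1` A) FU.
  have /FG GnA : (u @ F) (~` A) by [].
  by have /filter_ex [? []] : G (A `&` ~` A) by exact: filterI.
have [|l [_ ul]] := cpt (u @ F) _ _; last by exists l.
  by apply: filterS uC => k; rewrite /= in_itv /= ler_norml.
Qed.

Lemma ultra_bounded_mx_cvg p q (u : nat -> 'M[R]_(p, q)) C :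
  (\forall k \near F, forall i j, `|u k i j| <= C) -> exists l : 'M[R]_(p, q), u @ F --> l.
Proof.
move=> uC; have H i j : exists l : R, (fun k => u k i j) @ F --> l.
  by apply: (@ultra_bounded_cvg _ C); apply: filterS uC => k.
exists (\matrix_(i, j) sval (cid (H i j))); apply/mx_cvgP => i j.
by rewrite mxE; case: cid.
Qed.

(** A set or its complement belongs to an ultrafilter. *)
Lemma ultra_bounded_or_infty (u : nat -> R) :
  (exists C, \forall k \near F, `|u k| <= C) \/
  (forall C, \forall k \near F, C < `|u k|).
Proof.
have [?|unb] := pselect (exists C, \forall k \near F, `|u k| <= C).
  by left.
right=> C; have [FC|] := in_ultra_setVsetC [set k | `|u k| <= C] FU.
  by case: unb; exists C.
by apply: filterS => k /= /negP; rewrite -ltNge.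
Qed.

Lemma infty_inv_cvg0 (u : nat -> R) :
  (forall C, \forall k \near F, C < `|u k|) -> (fun k => (u k)^-1) @ F --> 0.
Proof.
move=> uC; apply/cvgr0Pnorm_le => e e0; near=> k.
have uk : e^-1 < `|u k| by near: k; exact: uC.
by rewrite normfV -[leRHS]invrK lef_pV2 ?posrE ?invr_gt0 ?ltW// (lt_trans _ uk)
  ?invr_gt0.
Unshelve. all: by end_near. Qed.

End Ultrafilters.

Lemma free_ultrafilter : exists F : set_system nat, UltraFilter F /\ \oo `<=` F.
Proof. exact: ultraFilterLemma. Qed.

Lemma free_ultra_neq (F : set_system nat) : \oo `<=` F -> Filter F ->
  forall j : nat, \forall k \near F, k != j.
Proof.
by move=> ooF FF j; apply: ooF; exists j.+1 => // k /=; rewrite neq_ltn orbC => ->.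
Qed.

(** * Lorentz forms *)

Section BilinearForm.
Context {R : realType} {n : nat}.
Implicit Types (B G : 'M[R]_n) (x y z : 'cV[R]_n).

Lemma bform_addl B x y z : bform B (x + y) z = bform B x z + bform B y z.
Proof. exact: bformDl. Qed.

Lemma bform_addr B x y z : bform B z (x + y) = bform B z x + bform B z y.
Proof. by rewrite /bform mulmxDr mxE. Qed.

Lemma bform_scalel B (c : R) x y : bform B (c *: x) y = c * bform B x y.
Proof. exact: bformZl. Qed.

Lemma bform_scaler B (c : R) x y : bform B x (c *: y) = c * bform B x y.
Proof. by rewrite /bform -scalemxAr mxE. Qed.

Lemma bform_oppl B x y : bform B (- x) y = - bform B x y.
Proof. by rewrite -scaleN1r bform_scalel mulN1r. Qed.

Lemma bform_oppr B x y : bform B x (- y) = - bform B x y.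
Proof. by rewrite -scaleN1r bform_scaler mulN1r. Qed.

Lemma bform0l B y : bform B 0 y = 0.
Proof. by rewrite -[0 in LHS](scale0r 0) bform_scalel mul0r. Qed.

Lemma bform0r B y : bform B y 0 = 0.
Proof. by rewrite -[0 in LHS](scale0r 0) bform_scaler mul0r. Qed.

Definition bformE :=
  (bform_addl, bform_addr, bform_scalel, bform_scaler, bform_oppl, bform_oppr).

Lemma bform_suml B (I : finType) (P : pred I) (f : I -> 'cV[R]_n) y :
  bform B (\sum_(i | P i) f i) y = \sum_(i | P i) bform B (f i) y.
Proof.
by elim/big_rec2: _ => [|i a b _ <-]; rewrite ?bform0l // bform_addl.
Qed.

Lemma bform_symC B : B^T = B -> forall x y, bform B x y = bform B y x.
Proof.
move=> Bs x y; rewrite /bform.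
have -> : x^T *m B *m y = (y^T *m B *m x)^T by rewrite !trmx_mul trmxK Bs mulmxA.
by rewrite mxE.
Qed.

Lemma injective_unitmx G : (forall x, G *m x = 0 -> x = 0) -> G \in unitmx.
Proof.
move=> Gi; rewrite -unitmx_tr unitmxE unitfE; apply/det0P => -[v v0 vG].
case/eqP: v0; apply: trmx_inj; rewrite trmx0; apply: Gi.
by apply: trmx_inj; rewrite trmx_mul trmxK vG trmx0.
Qed.

Section PositiveDefinite.
Variable G : 'M[R]_n.
Hypothesis Gsym : G^T = G.
Hypothesis Gpos : forall x, x != 0 -> 0 < bform G x x.

Let GC := bform_symC Gsym.

Lemma posdef_ge0 x : 0 <= bform G x x.
Proof. by have [->|/Gpos/ltW//] := eqVneq x 0; rewrite bform0l. Qed.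

Lemma posdef_CS x y : bform G x y ^+ 2 <= bform G x x * bform G y y.
Proof.
have [->|y0] := eqVneq y 0; first by rewrite !bform0r expr0n mulr0.
have yp := Gpos y0.
have := posdef_ge0 (bform G y y *: x - bform G x y *: y).
rewrite !bformE (GC y x).
set a := bform G x x; set b := bform G x y; set c := bform G y y => H.
have : 0 <= c * (a * c - b ^+ 2) by apply: le_trans H _; nra.
by rewrite pmulr_rge0 // subr_ge0.
Qed.

Lemma posdef_unit : G \in unitmx.
Proof.
apply: injective_unitmx => x Gx; apply/eqP; apply: contraT => /Gpos.
by rewrite /bform -mulmxA Gx mulmx0 mxE ltxx.
Qed.

(** A coordinate is the pairing with a fixed vector, so this is the
    Cauchy-Schwarz inequality. It turns bounds on the form into bounds on the
    coordinates, where convergence is defined. *)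
Lemma posdef_coord : exists C : R, forall x i, x i 0 ^+ 2 <= C * bform G x x.
Proof.
pose z i : 'cV[R]_n := invmx G *m delta_mx i 0.
have xz x i : x i 0 = bform G x (z i).
  rewrite /bform /z mulmxA mulmxK ?posdef_unit //.
  by rewrite -colE !mxE.
exists (\sum_i bform G (z i) (z i)) => x i; rewrite xz.
apply: le_trans (posdef_CS _ _) _; rewrite mulrC ler_wpM2r ?posdef_ge0 //.
by rewrite (bigD1 i) //= lerDl sumr_ge0 // => j _; exact: posdef_ge0.
Qed.

End PositiveDefinite.
End BilinearForm.

Section LorentzForm.
Context {R : realType} {n : nat}.
Implicit Types (x y z u v : 'cV[R]_n).

(** Signature (n-1,1), witnessed by a unit time-like vector o. *)
Definition lorentz_form (B : 'M[R]_n) (o : 'cV[R]_n) : Prop :=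
  [/\ B^T = B, bform B o o = - 1 &
      forall x, bform B x o = 0 -> x != 0 -> 0 < bform B x x].

Lemma signature_lorentz_form (B : 'M[R]_n) :
  B^T = B -> has_signature B n.-1 1 -> exists o, lorentz_form B o.
Proof.
move=> Bs [P [d [Pu PBP dpos dneg]]].
have /cards1P[i0 i0E] : #|[set i | (d 0 i < 0)%R]%SET| == 1%N by rewrite dneg.
have di0 : d 0 i0 < 0 by have : i0 \in [set i0]%SET := set11 _; rewrite -i0E inE.
have dp i : i != i0 -> 0 < d 0 i.
  have dposE : [set i | (0 < d 0 i)%R]%SET = (~: [set i0])%SET.
    apply/eqP; rewrite eqEcard; apply/andP; split.
      apply/fintype.subsetP => j; rewrite !inE; apply: contraTneq => ->.
      by rewrite -leNgt ltW.
    by rewrite cardsC1 card_ord dpos.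
  move=> ii0; have : i \in (~: [set i0])%SET by rewrite !inE.
  by rewrite -dposE inE.
have bE x y : bform B (P *m x) (P *m y) = \sum_i d 0 i * x i 0 * y i 0.
  rewrite /bform trmx_mul -!mulmxA (mulmxA P^T) (mulmxA _ P) PBP mxE.
  by apply: eq_bigr => i _; rewrite mul_diag_mx !mxE mulrCA mulrA.
have sum0 x : \sum_i d 0 i * x i 0 * (delta_mx i0 0 : 'cV[R]_n) i 0 =
    d 0 i0 * x i0 0.
  rewrite (bigD1 i0) //= big1 ?addr0 => [|i ii0]; rewrite mxE ?eqxx ?mulr1 //.
  by rewrite (negPf ii0) mulr0.
pose c := (Num.sqrt (- d 0 i0))^-1.
have c0 : c != 0 by rewrite invr_eq0 sqrtr_eq0 -ltNge oppr_gt0.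
exists (c *: (P *m delta_mx i0 0)); split=> //.
  rewrite bform_scalel bform_scaler bE sum0 mxE !eqxx mulr1 mulrA -expr2.
  by rewrite exprVn sqr_sqrtr ?oppr_ge0 ?ltW // invrN mulNr mulVf // lt_eqF.
move=> x; rewrite -[x](mulKVmx Pu); set y := invmx P *m x.
rewrite bform_scaler bE sum0 => /eqP; rewrite !mulf_eq0 (negPf c0) lt_eqF //=.
move=> /eqP y0 Py; rewrite bE.
have [i yi] : exists i, y i 0 != 0.
  apply/existsP; apply: contraNT Py => /existsPn yN; rewrite -[y](_ : 0 = y) ?mulmx0 //.
  by apply/colP => j; rewrite mxE; apply/esym/eqP; have := yN j; rewrite negbK.
have ii0 : i != i0 by apply: contraNneq yi => ->; rewrite y0.
have sq j : 0 <= d 0 j * y j 0 * y j 0.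
  have [->|/dp/ltW dj] := eqVneq j i0; first by rewrite y0 mulr0.
  by rewrite -mulrA mulr_ge0 // -expr2 sqr_ge0.
rewrite (bigD1 i) //= ltr_wpDr ?sumr_ge0 // -mulrA mulr_gt0 ?dp // -expr2.
by rewrite exprn_even_gt0.
Qed.

Variables (B : 'M[R]_n) (o : 'cV[R]_n).
Hypothesis BL : lorentz_form B o.
Local Notation b := (bform B).

Lemma lorentz_sym : B^T = B. Proof. by case: BL. Qed.
Lemma lorentzC x y : b x y = b y x. Proof. exact: bform_symC lorentz_sym _ _. Qed.
Lemma lorentz_oo : b o o = - 1. Proof. by case: BL. Qed.
Lemma lorentz_pos x : b x o = 0 -> x != 0 -> 0 < b x x. Proof. by case: BL => _ _; exact. Qed.

Lemma lorentz_pos_le x : b x o = 0 -> 0 <= b x x.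
Proof. by have [->|x0] := eqVneq x 0; rewrite ?bform0l // => /lorentz_pos/(_ x0)/ltW. Qed.

Lemma lorentz_pos_eq0 x : b x o = 0 -> b x x <= 0 -> x = 0.
Proof.
move=> xo xx; apply/eqP; apply: contraT => /(lorentz_pos xo).
by rewrite ltNge xx.
Qed.

Lemma lorentz_unit : B \in unitmx.
Proof.
apply: injective_unitmx => x Bx.
have xy y : b x y = 0 by rewrite lorentzC /bform -mulmxA Bx mulmx0 mxE.
by apply: lorentz_pos_eq0; rewrite xy.
Qed.

Lemma lorentz_nondeg x : (forall y, b x y = 0) -> x = 0.
Proof. by move=> xy; apply: lorentz_pos_eq0; rewrite xy. Qed.

Lemma light_o_neq0 v : v != 0 -> b v v = 0 -> b v o != 0.
Proof.
by move=> v0 vv; apply: contra_neq v0 => vo; apply: lorentz_pos_eq0; rewrite ?vv.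
Qed.

(** Subtracting from x a suitable multiple of v brings it into the orthogonal of
    o, where the form is definite, and does not change b x x. *)
Lemma light_perp v x : v != 0 -> b v v = 0 -> b x v = 0 ->
  0 <= b x x /\ (b x x = 0 -> exists t, x = t *: v).
Proof.
move=> v0 vv xv; have vo := light_o_neq0 v0 vv.
pose t := b x o / b v o.
have yo : b (x - t *: v) o = 0 by rewrite !bformE /t divfK ?subrr.
have yy : b (x - t *: v) (x - t *: v) = b x x.
  by rewrite !bformE (lorentzC v x) xv vv; ring.
split=> [|xx]; first by rewrite -yy; exact: lorentz_pos_le.
by exists t; apply: subr0_eq; apply: lorentz_pos_eq0; rewrite ?yy ?xx.
Qed.

Lemma light_perp_light u v : v != 0 -> b v v = 0 -> b u u = 0 -> b u v = 0 ->
  exists t, u = t *: v.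
Proof. by move=> v0 vv uu uv; have [_] := light_perp v0 vv uv; exact. Qed.

(** The normalisation b v o = 1 selects one vector on each light-like line. *)
Lemma light_normalized_eq u v : b u u = 0 -> b v v = 0 -> b u v = 0 ->
  b u o = 1 -> b v o = 1 -> u = v.
Proof.
move=> uu vv uv uo vo.
have v0 : v != 0 by apply/eqP => v0; move: vo; rewrite v0 bform0l; lra.
have [t ut] := light_perp_light v0 vv uu uv.
by move: uo; rewrite ut bform_scalel vo mulr1 => ->; rewrite scale1r.
Qed.

(** Two independent light-like vectors span a Lorentzian plane. *)
Lemma two_light_perp_pos u v x : u != 0 -> v != 0 -> b u u = 0 -> b v v = 0 ->
  b u v != 0 -> b x u = 0 -> b x v = 0 -> x != 0 -> 0 < b x x.
Proof.
move=> u0 v0 uu vv uv xu xv x0.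
have [xx0 xx] := light_perp u0 uu xu.
rewrite lt_neqAle xx0 andbT; apply/eqP => xxE.
have [t xt] := xx (esym xxE).
move: xv x0; rewrite xt bform_scalel => /eqP; rewrite mulf_eq0 (negPf uv) orbF.
by move=> /eqP ->; rewrite scale0r eqxx.
Qed.

(** Changing the sign of the form on the line of o turns it into a scalar
    product. *)
Definition euclid_mx : 'M[R]_n := B + 2 *: (B *m o *m o^T *m B).

Lemma euclidE x y : bform euclid_mx x y = b x y + 2 * b x o * b y o.
Proof.
rewrite /bform /euclid_mx mulmxDr mulmxDl mxE; congr (_ + _).
rewrite -scalemxAr -scalemxAl mxE -mulrA; congr (_ * _).
have -> : x^T *m (B *m o *m o^T *m B) *m y = (x^T *m B *m o) *m (o^T *m B *m y).
  by rewrite !mulmxA.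
by rewrite mxE big_ord1 -/(bform B x o) -/(bform B o y) (lorentzC o y).
Qed.

Lemma euclid_sym : euclid_mx^T = euclid_mx.
Proof.
rewrite /euclid_mx linearD linearZ /= !trmx_mul trmxK lorentz_sym.
by rewrite !mulmxA.
Qed.

(** Apply positivity to the projection of x on the orthogonal of o. *)
Lemma lorentz_split_ge0 x : 0 <= b x x + b x o ^+ 2.
Proof.
have := @lorentz_pos_le (x + b x o *: o).
rewrite !bformE (lorentzC o x) lorentz_oo => /(_ _); nra.
Qed.

Lemma euclid_pos x : x != 0 -> 0 < bform euclid_mx x x.
Proof.
move=> x0; rewrite euclidE; have := lorentz_split_ge0 x.
have [xo|xo] := eqVneq (b x o) 0.
  by move=> _; rewrite xo; have := lorentz_pos xo x0; lra.
have : 0 < b x o ^+ 2 by rewrite exprn_even_gt0.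
by nra.
Qed.

Definition euclid_CS := posdef_CS euclid_sym euclid_pos.
Definition euclid_ge0 := posdef_ge0 euclid_pos.

Lemma lorentz_CS x y :
  b x y ^+ 2 <= 10 * (bform euclid_mx x x * bform euclid_mx y y).
Proof.
have xo z : bform euclid_mx z o = - b z o.
  by rewrite euclidE lorentz_oo; ring.
have h z : b z o ^+ 2 <= bform euclid_mx z z.
  have := euclid_CS z o; rewrite xo (euclidE o o) lorentz_oo; nra.
have aux (p q r E : R) : p ^+ 2 * q ^+ 2 <= E -> (r + 2 * p * q) ^+ 2 <= E ->
    r ^+ 2 <= 10 * E.
  move=> H1 H2.
  have : 0 <= (r + 2 * p * q + 2 * p * q) ^+ 2 by exact: sqr_ge0.
  nra.
apply: (@aux (b x o) (b y o)); last by rewrite -(euclidE x y); exact: euclid_CS.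
by apply: ler_pM; rewrite ?sqr_ge0.
Qed.

Lemma lorentz_coord :
  exists C : R, forall x i, x i 0 ^+ 2 <= C * (b x x + 2 * b x o ^+ 2).
Proof.
have [C HC] := posdef_coord euclid_sym euclid_pos.
by exists C => x i; have := HC x i; rewrite euclidE -mulrA -expr2.
Qed.

Definition isometry (T : 'M[R]_n) : Prop :=
  forall x y, b (T *m x) (T *m y) = b x y.

(** Both o and T o lie on the same two-sheeted hyperboloid. *)
Lemma isometry_o_ge1 T : isometry T -> 1 <= b (T *m o) o ^+ 2.
Proof.
move=> Ti; have := lorentz_split_ge0 (T *m o); rewrite Ti lorentz_oo; lra.
Qed.

(** The coordinates of T x are controlled by b (T x) (T x) = b x x and by
    b (T x) o = b x (T^-1 o), and the Euclidean size of T^-1 o is determined by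
    b (T^-1 o) o = b (T o) o. *)
Lemma isometry_bound : exists C : R, forall T T' : 'M[R]_n,
  isometry T -> T *m T' = 1%:M ->
  forall i j, T i j ^+ 2 <= C * b (T *m o) o ^+ 2.
Proof.
have [C HC] := lorentz_coord.
pose E x := bform euclid_mx x x.
exists (C * 41 * \sum_j E (delta_mx j 0)) => T T' Ti TT' i j.
have C0 : 0 <= C.
  have := HC o i; rewrite lorentz_oo; have := sqr_ge0 (o i 0); lra.
have N1 := isometry_o_ge1 Ti.
have adj x y : b (T *m x) y = b x (T' *m y).
  by rewrite -[y in LHS]mul1mx -TT' -mulmxA Ti.
have -> : T i j = (T *m (delta_mx j 0 : 'cV_n)) i 0 by rewrite -colE mxE.
apply: le_trans (HC _ _) _; rewrite -!mulrA ler_wpM2l //.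
set x := delta_mx j 0; set N := b (T *m o) o.
have T'o : b (T' *m o) o = N by rewrite lorentzC -adj.
have T'oo : b (T' *m o) (T' *m o) = - 1.
  by rewrite -adj mulmxA TT' mul1mx lorentz_oo.
have ET'o : E (T' *m o) = - 1 + 2 * N ^+ 2.
  by rewrite /E euclidE T'o T'oo; ring.
have Ex : b x x <= E x.
  by rewrite /E euclidE -mulrA -expr2; have := sqr_ge0 (b x o); lra.
have E0 : 0 <= E x by exact: euclid_ge0.
have : E x <= \sum_j E (delta_mx j 0).
  by rewrite (bigD1 j) //= lerDl sumr_ge0 // => k _; exact: euclid_ge0.
set S := (X in _ <= X) => ES.
have := lorentz_CS x (T' *m o); rewrite -!/(E _) ET'o.
rewrite Ti adj => H.
apply: le_trans (_ : 41 * (E x * N ^+ 2) <= _); first by nra.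
by rewrite ler_wpM2l // ler_wpM2r ?sqr_ge0.
Qed.

End LorentzForm.

(** * Tits' theorem on the signs of roots *)

Section Chebyshev.
Context {R : realType}.

(** U_{k-1}(c), with U the Chebyshev polynomials of the second kind; these are
    the coefficients of the roots of a dihedral group. *)
Fixpoint cheb (c : R) (k : nat) : R :=
  match k with
  | 0 => 0
  | p.+1 => match p with 0 => 1 | q.+1 => 2 * c * cheb c p - cheb c q end
  end.

Lemma chebSS c k : cheb c k.+2 = 2 * c * cheb c k.+1 - cheb c k.
Proof. by []. Qed.

Lemma cheb_ge0 c k : 1 <= c -> 0 <= cheb c k.
Proof.
move=> c1; suff /andP[] : 0 <= cheb c k <= cheb c k.+1 by [].
elim: k => [|k /andP[k0 kS]]; first by rewrite /= lexx ler01.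
have u0 := le_trans k0 kS; rewrite u0 andTb chebSS.
set u := cheb c k in k0 kS *; set v := cheb c k.+1 in kS u0 *.
have : 0 <= (c - 1) * v by rewrite mulr_ge0 ?subr_ge0.
lra.
Qed.

Lemma cheb_cos (theta : R) k : cheb (cos theta) k * sin theta = sin (theta *+ k).
Proof.
suff : cheb (cos theta) k * sin theta = sin (theta *+ k) /\
       cheb (cos theta) k.+1 * sin theta = sin (theta *+ k.+1) by case.
elim: k => [|k [IH1 IH2]]; first by rewrite /= mulr0n sin0 mul0r mul1r.
split=> //; rewrite chebSS mulrBl IH1 -(mulrA (2 * cos theta)) IH2.
have -> : theta *+ k = theta *+ k.+1 - theta by rewrite mulrSr addrK.
by rewrite [theta *+ k.+2]mulrSr sinB sinD; ring.
Qed.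

Lemma cheb_cos_ge0 m k : (1 < m)%N -> (k <= m)%N -> 0 <= cheb (cos (pi / m%:R)) k.
Proof.
move=> m1 km; have m0 : 0 < m%:R :> R by rewrite ltr0n ltnW.
have s0 : 0 < sin (pi / m%:R : R).
  by rewrite sin_gt0_pi // divr_gt0 ?pi_gt0 //= ltr_pdivrMr // ltr_pMr ?pi_gt0 // ltr1n.
rewrite -(pmulr_lge0 _ s0) cheb_cos sin_ge0_pi //.
have -> : pi / m%:R *+ k = pi / m%:R * k%:R :> R by rewrite mulr_natr.
rewrite mulr_ge0 ?divr_ge0 ?pi_ge0 ?ler0n //=.
by rewrite mulrAC ler_pdivrMr // ler_wpM2l ?pi_ge0 // ler_nat.
Qed.

End Chebyshev.

Section Length.
Context {R : realType} {n : nat} (X : geomCoxeterSystem R n).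
Local Notation g := (cox_gen X).
Local Notation B := (gram_mx X).

Lemma cox_gen_invol s : (g s * g s = 1)%g.
Proof.
have [[md _ _] rel _ _] := coxeter_systemP X.
by have := rel s s 1%N (md s); rewrite expg1.
Qed.

Lemma cox_genV s : ((g s)^-1 = g s)%g.
Proof. by rewrite -[LHS]mulg1 -(cox_gen_invol s) mulKg. Qed.

Lemma mulg_genK s : cancel (fun w : X => w * g s)%g (fun w => w * g s)%g.
Proof. by move=> w; rewrite -mulgA cox_gen_invol mulg1. Qed.

Definition cox_word (u : seq 'I_n) : X := (\prod_(s <- u) g s)%g.

Lemma cox_word_ex (w : X) :
  exists k, `[< exists2 u, size u = k & cox_word u = w >].
Proof.
have [_ _ gen _] := coxeter_systemP X; have [u wu] := gen w.
by exists (size u); apply/asboolP; exists u.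
Qed.

Definition clen (w : X) : nat := ex_minn (cox_word_ex w).

Lemma clenP w : exists2 u, size u = clen w & cox_word u = w.
Proof. by rewrite /clen; case: ex_minnP => k /asboolP. Qed.

Lemma clen_word u : (clen (cox_word u) <= size u)%N.
Proof.
by rewrite /clen; case: ex_minnP => k _; apply; apply/asboolP; exists u.
Qed.

Lemma clenM w1 w2 : (clen (w1 * w2)%g <= clen w1 + clen w2)%N.
Proof.
have [u1 <- w1E] := clenP w1; have [u2 <- w2E] := clenP w2.
by rewrite -w1E -w2E /cox_word -big_cat /= -size_cat clen_word.
Qed.

Lemma clen1 : clen 1%g = 0%N.
Proof. by have := clen_word [::]; rewrite /cox_word big_nil leqn0 => /eqP. Qed.

Lemma clen_gen s : (clen (g s) <= 1)%N.
Proof.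
have -> : g s = cox_word [:: s] by rewrite /cox_word big_seq1.
exact: clen_word.
Qed.

Lemma clen_pred w : w <> 1%g ->
  exists w' s, w = (w' * g s)%g /\ (clen w').+1 = clen w.
Proof.
move=> w1; have [u su uw] := clenP w.
case/lastP: u su uw => [|u s] su uw; first by case: w1; rewrite -uw /cox_word big_nil.
have wE : w = (cox_word u * g s)%g by rewrite -uw /cox_word big_rcons.
exists (cox_word u), s; split=> //; apply/eqP; rewrite eqn_leq.
rewrite -{1}su size_rcons ltnS clen_word /=.
by rewrite wE -addn1 (leq_trans (clenM _ _)) // leq_add2l clen_gen.
Qed.

(** Letters are added on the left, so that the last one is t for both parities
    of k. *)
Fixpoint alt (s t : 'I_n) (k : nat) : X :=
  if k is p.+1 then (g (if odd p then s else t) * alt s t p)%g else 1%g.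

Lemma altSr s t k : alt s t k.+1 = (alt t s k * g t)%g.
Proof.
elim: k => [|k IH]; first by rewrite /= mulg1 mul1g.
by rewrite [LHS]/= -/(alt s t k.+1) IH mulgA /=; case: (odd k).
Qed.

Lemma clen_alt s t k : (clen (alt s t k) <= k)%N.
Proof.
elim: k => [|k IH]; first by rewrite clen1.
by rewrite -add1n (leq_trans (clenM _ _)) // leq_add ?clen_gen.
Qed.

Lemma alt_addn s t j k : exists2 x, (clen x <= j)%N & alt s t (j + k) = (x * alt s t k)%g.
Proof.
elim: j => [|j [x xj IH]]; first by exists 1%g; rewrite ?clen1 // mul1g.
exists (g (if odd (j + k) then s else t) * x)%g; last by rewrite addSn /= IH mulgA.
by rewrite -add1n (leq_trans (clenM _ _)) // leq_add ?clen_gen.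
Qed.

(** The quotient of the two alternating words is a power of s t. *)
Lemma alt_braid s t m : cox_m X s t = Some m -> alt s t m = alt t s m.
Proof.
move=> mst; have [_ rel _ _] := coxeter_systemP X; have {rel} := rel _ _ _ mst.
suff H k : ((alt t s k)^-1 * alt s t k = (g s * g t) ^+ k)%g.
  by rewrite -H => E; rewrite -[LHS](mulVKg (alt t s m)) E mulg1.
elim: k => [|k IH]; first by rewrite /= invg1 mul1g.
have IH' : ((alt s t k)^-1 * alt t s k = (g t * g s) ^+ k)%g.
  by rewrite -[LHS]invgK invgM invgK IH -expVgn invgM !cox_genV.
rewrite !altSr invgM cox_genV -mulgA (mulgA (alt s t k)^-1%g) IH'.
rewrite expgSr mulgA; suff -> : (g s * (g t * g s) ^+ k = (g s * g t) ^+ k * g s)%g.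
  by rewrite mulgA.
elim: k {IH IH'} => [|k IH]; first by rewrite mulg1 mul1g.
by rewrite !expgS -[RHS]mulgA -IH !mulgA.
Qed.

Lemma actM (w1 w2 : X) x : act (w1 * w2)%g x = act w1 (act w2 x).
Proof. by rewrite /act geom_repM mulmxA. Qed.

Lemma act1 x : act (1%g : X) x = x.
Proof. by rewrite /act geom_rep1 mul1mx. Qed.

Lemma act_add (w : X) x y : act w (x + y) = act w x + act w y.
Proof. by rewrite /act mulmxDr. Qed.

Lemma act_scale (w : X) (c : R) x : act w (c *: x) = c *: act w x.
Proof. by rewrite /act -scalemxAr. Qed.

Lemma act_sub (w : X) x y : act w (x - y) = act w x - act w y.
Proof. by rewrite /act mulmxBr. Qed.

Lemma act_gen s x :
  act (g s) x = x - (2 * bform B x (simple_root s)) *: simple_root s.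
Proof.
by rewrite /act geom_rep_gen /reflection bform_simple gram_mx_diag divr1.
Qed.

Lemma act_gen_simple s t :
  act (g s) (simple_root t) = simple_root t - (2 * B s t) *: simple_root s.
Proof. by rewrite act_gen bform_simple gram_mx_sym. Qed.

Lemma act_gen_self s : act (g s) (simple_root s) = - simple_root s :> 'cV[R]_n.
Proof.
by rewrite act_gen_simple gram_mx_diag mulr1 scaler_nat mulr2n opprD addrA subrr add0r.
Qed.

Lemma act_alt s t k :
  act (alt s t k) (simple_root s) =
  cheb (- B s t) k.+1 *: simple_root (if odd k then t else s) +
  cheb (- B s t) k *: simple_root (if odd k then s else t).
Proof.
elim: k => [|k IH]; first by rewrite /= act1 scale1r scale0r addr0.
rewrite [alt _ _ _]/= actM IH act_add !act_scale chebSS [odd k.+1]/= if_neg.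
have -> : (if ~~ odd k then s else t) = (if odd k then t else s) by case: (odd k).
rewrite act_gen_self act_gen_simple.
have -> : B (if odd k then s else t) (if odd k then t else s) = B s t.
  by case: (odd k) => //; rewrite gram_mx_sym.
rewrite scalerBr scalerA scalerN -addrA -opprD -scalerDl addrC -scaleNr.
by congr (_ *: _ + _); ring.
Qed.

(** Tits' theorem, by induction on the length: write w = v x with
    lengths adding up and x a longest possible alternating word in s and some t,
    ending with t. By maximality neither s nor t shortens v, so v alpha_s and
    v alpha_t are nonnegative, and x alpha_s is a nonnegative combination of
    alpha_s and alpha_t as x is shorter than the longest element of the
    dihedral group of s and t. *)
Lemma root_nonneg (w : X) s : (clen w <= clen (w * g s)%g)%N ->
  forall i, 0 <= (act w (simple_root s) : 'cV[R]_n) i 0.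
Proof.
have [N] := ubnP (clen w); elim: N w s => // N IH w s; rewrite ltnS => wN ws.
have [->|w1] := pselect (w = 1%g).
  by move=> i; rewrite act1 mxE ler0n.
have [w' [t [wE lw']]] := clen_pred w1.
have st : s != t.
  apply: contraTneq ws => ->; rewrite -ltnNge {1}wE mulg_genK -lw' //.
pose P k := `[< exists2 v, w = (v * alt s t k)%g & (clen v + k)%N = clen w >].
have P1 : P 1%N by apply/asboolP; exists w'; rewrite ?addn1 //= mulg1.
have Pb k : P k -> (k <= clen w)%N by move=> /asboolP[v _ <-]; exact: leq_addl.
have [k /asboolP[v wv lv] kmax] := ex_maxnP (ex_intro P _ P1) Pb.
have k0 : (0 < k)%N by exact: kmax.
have vS : (clen v <= clen (v * g (if odd k then s else t))%g)%N.
  rewrite leqNgt; apply/negP => lvg.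
  suff /kmax : P k.+1 by rewrite ltnn.
  apply/asboolP; exists (v * g (if odd k then s else t))%g.
    by rewrite /= mulgA mulg_genK.
  apply/eqP; rewrite eqn_leq -{1}lv addnS -addSn leq_add2r lvg /=.
  have {1}-> : w = (v * g (if odd k then s else t) * alt s t k.+1)%g.
    by rewrite /= mulgA mulg_genK.
  by rewrite addSnnS (leq_trans (clenM _ _)) // leq_add2l clen_alt.
have vP : (clen v <= clen (v * g (if odd k then t else s))%g)%N.
  rewrite leqNgt; apply/negP => lvg.
  suff : (clen w < clen v + k)%N by rewrite lv ltnn.
  have kE : k = k.-1.+1 by rewrite prednK.
  have {1}-> : w = (v * g (if odd k then t else s) * alt s t k.-1)%g.
    by rewrite wv -mulgA [in LHS]kE /= [in RHS]kE /=; case: (odd k.-1).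
  rewrite (leq_ltn_trans (clenM _ _)) // -addSn leq_add //.
  by rewrite (leq_trans (clen_alt _ _ _)) // leq_pred.
have lvN : (clen v < N)%N by apply: leq_trans wN; rewrite -lv -[X in (X < _)%N]addn0 ltn_add2l.
have [c0 c1] : 0 <= cheb (- B s t) k /\ 0 <= cheb (- B s t) k.+1.
  rewrite mxE; case mst: (cox_m X s t) => [m|]; last first.
    by rewrite opprK; split; apply: cheb_ge0; exact: cox_weight_ge1.
  have [[_ _ m2] _ _ _] := coxeter_systemP X.
  have m1 := m2 _ _ _ st mst.
  suff km : (k < m)%N by rewrite opprK; split; apply: cheb_cos_ge0 => //; exact: ltnW.
  rewrite ltnNge; apply/negP => mk.
  suff : (clen (w * g s)%g < clen w)%N by rewrite ltnNge ws.
  have [x xl] := alt_addn s t (k - m) m; rewrite subnK // => kx.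
  have mE : m = m.-1.+1 by rewrite prednK // ltnW.
  have -> : (w * g s = v * x * alt s t m.-1)%g.
    by rewrite wv kx (alt_braid mst) mE altSr -!mulgA cox_gen_invol mulg1.
  rewrite (leq_ltn_trans (clenM _ _)) // (leq_ltn_trans (leq_add (clenM _ _) (clen_alt _ _ _))) //.
  rewrite -lv -addnA ltn_add2l -(subnK mk) -addnS leq_add //.
  by rewrite prednK // ltnW.
move=> i; rewrite wv actM act_alt act_add !act_scale mxE [X in X + _]mxE [X in _ + X]mxE.
by rewrite addr_ge0 // mulr_ge0 //; apply: IH.
Qed.

Lemma bform_coord (f x : 'cV[R]_n) :
  bform B f x = \sum_i x i 0 * bform B f (simple_root i).
Proof.
rewrite {1}[x]matrix_sum_delta.
under eq_bigr do rewrite big_ord1.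
elim/big_rec2: _ => [|i a c _ <-]; first by rewrite bform0r.
by rewrite bform_addr bform_scaler.
Qed.

(** If s is the last letter of a shortest word of w, then w alpha_s has
    nonpositive coordinates, and its pairing with a vector f of the open
    fundamental chamber is not positive. *)
Lemma chamber_trivial (w : X) (f : 'cV[R]_n) :
  (forall s, 0 < bform B f (simple_root s)) ->
  (forall s, 0 < bform B f (act w (simple_root s))) -> w = 1%g.
Proof.
move=> f0 wf0; apply: contrapT => w1; have [w' [s [wE lw]]] := clen_pred w1.
have : 0 <= bform B f (act w' (simple_root s)).
  rewrite bform_coord; apply: sumr_ge0 => i _; apply: mulr_ge0; last exact/ltW.
  by apply: root_nonneg; rewrite -wE -lw.
have := wf0 s; rewrite wE actM act_gen_self -scaleN1r act_scale bform_scaler.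
lra.
Qed.

End Length.

(** * Limits in projective space *)

Section ProjectiveLimits.
Context {R : realType} {n : nat}.
Local Notation nzvec := (nzvec R n).
Local Notation projSpace := (projSpace R n).
Local Notation dot := (bform (1%:M : 'M[R]_n)).

Lemma nz_val_neq0 (x : nzvec) : \val x != 0.
Proof. by case: x => x /= /set_mem. Qed.

Definition nz (x : 'cV[R]_n) (x0 : x != 0) : nzvec := exist _ x (mem_set x0).

(** The topology of the projective space is the quotient of a subspace topology;
    its neighbourhoods are only used through this lemma. *)
Lemma proj_nbhs (x : nzvec) (A : set projSpace) : nbhs (proj_pt x) A ->
  exists2 C : set 'cV[R]_n, nbhs (\val x) C &
    forall y : nzvec, C (\val y) -> A (proj_pt y).
Proof.
rewrite nbhsE => -[U [oU Ux] UA]; case: oU => C oC CE; exists C.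
  apply: open_nbhs_nbhs; split=> //.
  have : (set_val @^-1` C) x by rewrite CE.
  by rewrite /= set_valE.
move=> y Cy; apply: UA; suff : ((@proj_pt R n) @^-1` U) y by [].
by rewrite -CE /= set_valE.
Qed.

Lemma proj_cvg (T : Type) (F : set_system T) {FF : ProperFilter F}
    (f : T -> nzvec) (x : nzvec) :
  (fun t => \val (f t)) @ F --> \val x ->
  (fun t => proj_pt (f t)) @ F --> proj_pt x.
Proof.
move=> fx A /proj_nbhs[C xC CA].
apply: (@filterS _ F _ (fun t => C (\val (f t)))); last exact: fx.
by move=> t; exact: CA.
Qed.

Lemma proj_closure (A : set 'cV[R]_n) (x : nzvec) :
  closure A (\val x) -> closure (proj_set A) (proj_pt x).
Proof.
move=> clx U /proj_nbhs[C xC CU].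
have x0 : nbhs (\val x) [set y : 'cV[R]_n | y != 0].
  apply: open_nbhs_nbhs; split; last exact: nz_val_neq0.
  rewrite (_ : mkset _ = ~` [set 0]); last first.
    by apply/seteqP; split=> y /= /eqP.
  by apply: closed_openC; apply: accessible_closed_set1; exact: hausdorff_accessible.
have [y [Ay [Cy y0]]] := clx _ (filterI xC x0).
by exists (proj_pt (nz y0)); split; [exists (nz y0)|exact: CU].
Qed.

Lemma dot_pos (x : 'cV[R]_n) : x != 0 -> 0 < dot x x.
Proof.
move=> x0; have [i xi] : exists i, x i 0 != 0.
  apply/existsP; apply: contraNT x0 => /existsPn xN; apply/eqP/colP => j.
  by rewrite mxE; apply/eqP; have := xN j; rewrite negbK.
rewrite /bform mulmx1 mxE (bigD1 i) //= mxE ltr_wpDr //.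
  by apply: sumr_ge0 => j _; rewrite mxE -expr2 sqr_ge0.
by rewrite -expr2 exprn_even_gt0.
Qed.

(** The orthogonal projection of x onto the line of y; as a function of the
    line it is continuous, and so it supplies the scalars that turn a limit of
    lines into a limit of vectors. *)
Definition line_proj (x y : 'cV[R]_n) : 'cV[R]_n := (dot y x / dot y y) *: y.

Lemma line_proj_scale (x y : 'cV[R]_n) (c : R) : c != 0 -> y != 0 ->
  line_proj x (c *: y) = line_proj x y.
Proof.
move=> c0 y0; rewrite /line_proj !bformE scalerA; congr (_ *: _).
by field; rewrite c0 gt_eqF // dot_pos.
Qed.

Lemma line_proj_id (x : 'cV[R]_n) : x != 0 -> line_proj x x = x.
Proof. by move=> x0; rewrite /line_proj divff ?scale1r // gt_eqF // dot_pos. Qed.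

Lemma proj_pt_scale (x y : nzvec) :
  proj_pt x = proj_pt y <-> exists2 c : R, c != 0 & \val y = c *: \val x.
Proof.
split=> [/proj_pt_eq xy|[c c0 yE]].
  have /vlineP[c yE] : \val y \in <[\val x]>%VS by rewrite xy memv_line.
  exists c => //; apply: contraTneq (nz_val_neq0 y) => c0.
  by rewrite yE c0 scale0r eqxx.
apply/proj_pt_eq; rewrite yE; apply/eqP; rewrite eqEsubv; apply/andP; split.
  by apply/vlineP; exists c^-1; rewrite scalerA mulVf // scale1r.
by apply/vlineP; exists c.
Qed.

Lemma proj_cvg_vector (F : set_system nat) {FF : ProperFilter F}
    (f : nat -> nzvec) (x : nzvec) :
  (fun t => proj_pt (f t)) @ F --> proj_pt x ->
  exists c : nat -> R, (fun t => c t *: \val (f t)) @ F --> \val x.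
Proof.
move=> fx; exists (fun t => dot (\val (f t)) (\val x) / dot (\val (f t)) (\val (f t))).
pose g (y : set_type [set x : 'cV[R]_n | x != 0]) := line_proj (\val x) (\val y).
have g_cont : continuous g.
  move=> y; have vc : (fun z : set_type [set x : 'cV[R]_n | x != 0] => \val z) @ y --> \val y.
    exact: (@initial_continuous _ _ (set_val : set_type [set x : 'cV[R]_n | x != 0] -> _)).
  have yy0 : dot (\val y) (\val y) != 0.
    by rewrite gt_eqF // dot_pos // nz_val_neq0.
  exact: (cvg_scalemx (cvgM (cvg_bform (B := 1%:M) vc (cvg_cst (\val x)))
    (cvgV yy0 (cvg_bform (B := 1%:M) vc vc))) vc).
have gE (y z : nzvec) : proj_pt y = proj_pt z -> g y = g z.
  by move=> /proj_pt_scale[c c0 zE]; rewrite /g zE line_proj_scale ?nz_val_neq0.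
have gr : continuous (g \o repr : projSpace -> _).
  apply: (@repr_comp_continuous _ _ _ g) => // a b /eqP ab.
  by apply/eqP; exact: gE.
have reprE y : g (repr (proj_pt y)) = g y by apply: gE; exact: reprK.
have H : (fun t => g (repr (proj_pt (f t)))) @ F --> g x.
  by rewrite -(reprE x); exact: (cvg_comp _ _ fx (gr _)).
have gx : g x = \val x by rewrite /g line_proj_id ?nz_val_neq0.
rewrite gx in H; apply: cvg_trans H; apply: near_eq_cvg.
by apply: nearW => t; rewrite reprE.
Qed.

End ProjectiveLimits.

(** * Discreteness and limits of rank one *)

Section Isometries.
Context {R : realType} {n : nat} (X : geomCoxeterSystem R n).
Local Notation B := (gram_mx X).
Local Notation b := (bform B).

Lemma gram_sym : B^T = B.
Proof. by apply/matrixP => s t; rewrite mxE gram_mx_sym. Qed.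

Let bC := bform_symC gram_sym.

Lemma cox_ind (P : X -> Prop) : P 1%g ->
  (forall s w, P w -> P (cox_gen X s * w)%g) -> forall w, P w.
Proof.
move=> P1 Ps w; have [_ _ /(_ w)[u ->] _] := coxeter_systemP X.
by elim: u => [|s u IH]; [rewrite big_nil|rewrite big_cons; exact: Ps].
Qed.

Lemma act_iso (w : X) x y : b (act w x) (act w y) = b x y.
Proof.
elim/cox_ind: w x y => [|s w IH] x y; first by rewrite !act1.
rewrite !actM !act_gen !bformE !IH bform_simple gram_mx_diag.
by rewrite (bC (simple_root s)); ring.
Qed.

Lemma act_adj (w : X) x y : b (act w x) y = b x (act w^-1 y).
Proof. by rewrite -[RHS](act_iso w) -actM mulgV act1. Qed.

Lemma actK (w : X) : cancel (@act R n X w) (act w^-1).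
Proof. by move=> x; rewrite -actM mulVg act1. Qed.

Lemma actVK (w : X) : cancel (@act R n X w^-1) (act w).
Proof. by move=> x; rewrite -actM mulgV act1. Qed.

Lemma root_norm (x : 'cV[R]_n) : Defs.roots X x -> b x x = 1.
Proof. by move=> [w [s ->]]; rewrite act_iso bform_simple gram_mx_diag. Qed.

End Isometries.

Section Discreteness.
Context {R : realType} {n : nat} (X : geomCoxeterSystem R n) (o : 'cV[R]_n).
Local Notation B := (gram_mx X).
Local Notation b := (bform B).
Hypothesis oL : lorentz_form B o.
Context {F : set_system nat} {FF : ProperFilter F}.

(** The group is discrete: if w_j and w_i are close, then w_j moves a point of
    the fundamental chamber into the open chamber of w_i. *)
Lemma converging_constant (w : nat -> X) (A : 'M[R]_n) :
  (fun k => geom_rep (w k)) @ F --> A ->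
  exists i, \forall j \near F, w j = w i.
Proof.
move=> wA; have bC := lorentzC oL.
pose f : 'cV[R]_n := invmx B *m const_mx 1.
have f1 s : b f (simple_root s) = 1.
  rewrite bC /bform /f -mulmxA mulKVmx ?(lorentz_unit oL) //.
  by rewrite /simple_root trmx_delta -rowE !mxE.
have wx x : (fun k => act (w k) x) @ F --> A *m x.
  by apply: cvg_mulmx => //; exact: cvg_cst.
have A_iso x y : b (A *m x) (A *m y) = b x y.
  apply: (real_lim_unique (cvg_bform (wx x) (wx y))).
  by under eq_cvg do rewrite act_iso; exact: cvg_cst.
have : \forall i \near F, forall s, 0 < b (A *m f) (act (w i) (simple_root s)).
  apply: filter_forall => s.
  apply: (cvgr_gt _ (cvg_bform (cvg_cst (A *m f)) (wx (simple_root s)))).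
  by rewrite A_iso f1.
move=> /filter_ex[i wi]; exists i.
have : \forall j \near F, forall s, 0 < b (act (w j) f) (act (w i) (simple_root s)).
  apply: filter_forall => s.
  exact: (cvgr_gt _ (cvg_bform (wx f) (cvg_cst (act (w i) (simple_root s))))).
apply: filterS => j wij; suff wji : ((w j)^-1 * w i = 1)%g.
  by rewrite -[LHS]mulg1 -wji mulVKg.
apply: (@chamber_trivial _ _ X _ f) => s; first by rewrite f1.
by rewrite actM -{1}[f](actK (w j)) act_iso.
Qed.

End Discreteness.

Lemma sqr_le_norm_le (R : realType) (a C : R) : a ^+ 2 <= C -> `|a| <= C + 1.
Proof. by move=> aC; rewrite ler_norml; apply/andP; split; nra. Qed.

Section RankOneLimits.
Context {R : realType} {n : nat} (X : geomCoxeterSystem R n) (o : 'cV[R]_n).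
Local Notation B := (gram_mx X).
Local Notation b := (bform B).
Hypothesis oL : lorentz_form B o.
Context {F : set_system nat} {FU : UltraFilter F}.
Local Notation N w := (b (act w o) o).

Lemma geom_rep_bound : exists C : R, forall (w : X) i j,
  geom_rep w i j ^+ 2 <= C * N w ^+ 2.
Proof.
have [C HC] := isometry_bound oL; exists C => w.
apply: (HC _ (geom_rep w^-1)); first by move=> x y; exact: act_iso.
by rewrite -geom_repM mulgV geom_rep1.
Qed.

Lemma norm_bounded_cvg (w : nat -> X) (C : R) :
  (\forall k \near F, `|N (w k)| <= C) ->
  exists A : 'M[R]_n, (fun k => geom_rep (w k)) @ F --> A.
Proof.
move=> NC; have [D HD] := geom_rep_bound.
have D0 (w0 : X) (i : 'I_n) : 0 <= D.
  have := HD w0 i i; have := isometry_o_ge1 oL (act_iso w0) => N1 H.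
  by rewrite -(pmulr_lge0 _ (lt_le_trans ltr01 N1)) (le_trans _ H) // sqr_ge0.
apply: (@ultra_bounded_mx_cvg _ _ _ _ _ _ (D * C ^+ 2 + 1)).
apply: filterS NC => k NC i j; apply: sqr_le_norm_le.
apply: le_trans (HD _ _ _) _; rewrite ler_wpM2l ?(D0 (w k) i) //.
by rewrite -[N _ ^+ 2]real_normK ?num_real // lerXn2r // nnegrE (le_trans _ NC).
Qed.

Lemma norm_infty (w : nat -> X) : \oo `<=` F -> injective w ->
  forall C, \forall k \near F, C < `|N (w k)|.
Proof.
move=> ooF w_inj; case: (@ultra_bounded_or_infty R F _ (fun k => N (w k))) => // -[C NC].
have [A wA] := norm_bounded_cvg NC.
have [i wi] := converging_constant oL wA.
have ne : \forall k \near F, k != i by exact: free_ultra_neq.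
by have [j [/w_inj ->]] := filter_ex (filterI wi ne); rewrite eqxx.
Qed.

Lemma norm_inv (w : X) : N w^-1 = N w.
Proof. by rewrite act_adj invgK (lorentzC oL). Qed.

Definition rank_one (p m : 'cV[R]_n) : 'M[R]_n := p *m (m^T *m B).

Lemma rank_oneE p m x : rank_one p m *m x = b m x *: p.
Proof.
by rewrite /rank_one -mulmxA [m^T *m B *m x]mx11_scalar mul_mx_scalar.
Qed.

Lemma rank_one_trace p m : \tr (rank_one p m) = b m p.
Proof. by rewrite /rank_one mxtrace_mulC trace_mx11. Qed.

(** Rescaled by their size, group elements of size tending to infinity
    converge to a map of rank one: the limit multiplies the form by zero, so
    its image is totally isotropic, hence a light-like line. The line of p
    attracts and the line of m repels. *)
Lemma rank_one_limit (w : nat -> X) :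
  (forall C, \forall k \near F, C < `|N (w k)|) ->
  exists p m, [/\ (fun k => (N (w k))^-1 *: geom_rep (w k)) @ F --> rank_one p m,
    (fun k => (N (w k))^-1 *: act (w k)^-1 o) @ F --> m,
    b p p = 0 /\ b m m = 0 & b p o = 1 /\ b m o = 1].
Proof.
move=> Noo; have bC := lorentzC oL.
have Ninv0 : (fun k => (N (w k))^-1) @ F --> 0 by exact: infty_inv_cvg0.
have Nnz : \forall k \near F, N (w k) != 0.
  by apply: filterS (Noo 0) => k; rewrite normr_gt0.
have [C HC] := geom_rep_bound.
have lim (u : nat -> X) : (forall k, N (u k) = N (w k)) ->
    exists A : 'M[R]_n, (fun k => (N (w k))^-1 *: geom_rep (u k)) @ F --> A.
  move=> uw; apply: (@ultra_bounded_mx_cvg _ _ _ _ _ _ (C + 1)).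
  apply: filterS Nnz => k Nk i j; rewrite mxE.
  have := HC (u k) i j; rewrite uw => H; apply: sqr_le_norm_le.
  by rewrite exprMn exprVn mulrC ler_pdivrMr ?exprn_even_gt0.
have [A wA] := lim w (fun=> erefl).
have [A' wA'] := lim (fun k => (w k)^-1)%g (fun k => norm_inv (w k)).
have wx x : (fun k => (N (w k))^-1 *: act (w k) x) @ F --> A *m x.
  by under eq_cvg do rewrite /act scalemxAl; apply: cvg_mulmx => //; exact: cvg_cst.
have wx' x : (fun k => (N (w k))^-1 *: act (w k)^-1 x) @ F --> A' *m x.
  by under eq_cvg do rewrite /act scalemxAl; apply: cvg_mulmx => //; exact: cvg_cst.
have Aiso (u : nat -> X) (T : 'M[R]_n) :
    (forall x, (fun k => (N (w k))^-1 *: act (u k) x) @ F --> T *m x) ->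
    forall x y, b (T *m x) (T *m y) = 0.
  move=> uT x y; apply: (real_lim_unique (cvg_bform (uT x) (uT y))).
  under eq_cvg do rewrite bform_scalel bform_scaler act_iso mulrA.
  have H := cvgM (cvgM Ninv0 Ninv0) (cvg_cst (b x y)).
  by rewrite !mul0r in H; exact: H.
have Ao1 (u : nat -> X) (T : 'M[R]_n) : (forall k, N (u k) = N (w k)) ->
    (forall x, (fun k => (N (w k))^-1 *: act (u k) x) @ F --> T *m x) ->
    b (T *m o) o = 1.
  move=> uw uT; apply: (real_lim_unique (cvg_bform (uT o) (cvg_cst o))).
  have H : (fun _ : nat => 1 : R) @ F --> (1 : R) by exact: cvg_cst.
  apply: cvg_trans H; apply: near_eq_cvg.
  by apply: filterS Nnz => k Nk; rewrite bform_scalel uw mulVf.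
exists (A *m o), (A' *m o).
have AA' x y : b (A *m x) y = b x (A' *m y).
  apply: (real_lim_unique (cvg_bform (wx x) (cvg_cst y))).
  rewrite (_ : (fun k => _) = fun k => b x ((N (w k))^-1 *: act (w k)^-1 y)).
    exact: (cvg_bform (cvg_cst x) (wx' y)).
  by apply/funext => k; rewrite bform_scalel bform_scaler (act_adj _ x).
have po := Ao1 _ _ (fun=> erefl) wx.
have mo := Ao1 _ _ (fun k => norm_inv (w k)) wx'.
split=> //; last by rewrite !(Aiso _ _ wx, Aiso _ _ wx').
have p0 : A *m o != 0.
  by apply/eqP => p0; move: po; rewrite p0 bform0l => /esym/eqP; rewrite oner_eq0.
rewrite (_ : rank_one _ _ = A) //.
suff AE (x : 'cV_n) : A *m x = rank_one (A *m o) (A' *m o) *m x.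
  by apply/matrixP => i j; have := congr1 (fun M : 'cV[R]_n => M i 0) (AE (delta_mx j 0));
    rewrite -!colE !mxE.
have [t At] := light_perp_light oL p0 (Aiso _ _ wx o o) (Aiso _ _ wx x x) (Aiso _ _ wx x o).
rewrite rank_oneE At; congr (_ *: _).
by rewrite bC -AA' At bform_scalel po mulr1.
Qed.

End RankOneLimits.

(** * Eigenvectors over a closed field *)

Section ClosedFieldMatrices.
Variables (C : numClosedFieldType) (n : nat).
Implicit Types (A : 'M[C]_n) (y : 'cV[C]_n).

Lemma root_eigenvector A (mu : C) : root (char_poly A) mu ->
  exists2 z : 'cV[C]_n, z != 0 & A *m z = mu *: z.
Proof.
have -> : char_poly A = char_poly A^T.
  rewrite /char_poly -det_tr; congr (\det _); apply/matrixP => i j.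
  by rewrite !mxE eq_sym.
rewrite -eigenvalue_root_char => /eigenvalueP[v vA v0].
exists v^T; last by rewrite -[A]trmxK -trmx_mul vA linearZ.
by apply: contra_neq v0 => v0; rewrite -[v]trmxK v0 trmx0.
Qed.

Lemma eigenvector_root A (mu : C) (z : 'cV[C]_n) : z != 0 -> A *m z = mu *: z ->
  root (char_poly A) mu.
Proof.
move=> z0 Az; have -> : char_poly A = char_poly A^T.
  rewrite /char_poly -det_tr; congr (\det _); apply/matrixP => i j.
  by rewrite !mxE eq_sym.
rewrite -eigenvalue_root_char; apply/eigenvalueP; exists z^T.
  by rewrite -trmx_mul Az linearZ.
by apply: contra_neq z0 => z0; rewrite -[z]trmxK z0 trmx0.
Qed.

(** The trace is the sum of the n eigenvalues. *)
Lemma trace_eigenvalue A : (0 < n)%N ->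
  exists2 mu, root (char_poly A) mu & `|\tr A| <= n%:R * `|mu|.
Proof.
move=> n0; have [rs] := closed_field_poly_normal (char_poly A).
rewrite (monicP (char_poly_monic A)) scale1r => cE.
have srs : size rs = n.
  by have := size_char_poly A; rewrite cE size_prod_XsubC => -[].
have trE : \tr A = \sum_(r <- rs) r.
  have := char_poly_trace A n0; rewrite cE.
  have -> : n.-1 = (size rs).-1 by rewrite srs.
  rewrite coefPn_prod_XsubC ?srs -?lt0n //.
  by move/oppr_inj.
have [/hasP[mu mu_rs mu_le]|] := boolP (has (fun mu => `|\tr A| <= n%:R * `|mu|) rs).
  by exists mu => //; rewrite cE root_prod_XsubC.
move=> /hasPn small; exfalso.
have : n%:R * `|\tr A| < n%:R * `|\tr A|; last by rewrite ltxx.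
apply: le_lt_trans (_ : \sum_(r <- rs) n%:R * `|r| < _).
  by rewrite -mulr_sumr ler_wpM2l // trE ler_norm_sum.
have -> : n%:R * `|\tr A| = \sum_(r <- rs) `|\tr A|.
  by rewrite big_const_seq count_predT iter_addr_0 srs mulr_natl.
rewrite big_seq [ltRHS]big_seq; apply: ltr_sum.
  case: (rs) srs => [|r s] srs; first by move: n0; rewrite -srs.
  by rewrite /= mem_head.
move=> r /small; rewrite -real_ltNge //.
Qed.

(** Repeated factors can be removed one by one from a product of factors X - r
    that annihilates A, so that the minimal polynomial has simple roots. *)
Lemma semisimple_diagonalizable A :
  (forall r y, (A - r%:M) *m ((A - r%:M) *m y) = 0 -> (A - r%:M) *m y = 0) ->
  diagonalizable A.
Proof.
move=> ss; case: n A ss => [|m] A ss; first by rewrite [A]flatmx0; exact: diagonalizable0.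
apply/diagonalizableP; have [rs] := closed_field_poly_normal (mxminpoly A).
rewrite (monicP (mxminpoly_monic A)) scale1r => pE.
exists (undup rs); first exact: undup_uniq.
apply/mxminpoly_minP.
pose h (s : seq C) : 'M[C]_m.+1 := horner_mx A (\prod_(r <- s) ('X - r%:P)).
have hX r : horner_mx A ('X - r%:P) = A - r%:M.
  by rewrite rmorphB /= horner_mx_X horner_mx_C.
have hcons r s (y : 'cV[C]_m.+1) : h (r :: s) *m y = h s *m ((A - r%:M) *m y).
  by rewrite /h big_cons mulrC rmorphM /= hX -mulmxE mulmxA.
have hcons' r s (y : 'cV[C]_m.+1) : h (r :: s) *m y = (A - r%:M) *m (h s *m y).
  by rewrite /h big_cons rmorphM /= hX -mulmxE mulmxA.
have hu s : forall y : 'cV[C]_m.+1, h s *m y = 0 -> h (undup s) *m y = 0.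
  elim: s => // r s IH y.
    rewrite /= ; case: ifPn => rs' hy; last first.
    by move: hy; rewrite !hcons; exact: IH.
  apply: IH; have hs (z : 'cV[C]_m.+1) : h s *m z = (A - r%:M) *m (h (rem r s) *m z).
    by rewrite -hcons' /h; congr (horner_mx A _ *m _); rewrite (perm_big _ (perm_to_rem rs')).
  by rewrite hs; apply: ss; rewrite -hs -hcons'.
apply/matrixP => i j; have h0 : h rs *m (delta_mx j 0 : 'cV_m.+1) = 0.
  have -> : h rs = 0 by rewrite /h -pE; exact: mx_root_minpoly.
  by rewrite mul0mx.
have := congr1 (fun M : 'cV[C]_m.+1 => M i 0) (hu rs _ h0).
by rewrite -colE !mxE.
Qed.

Lemma diagonalizable_eigenbasis A : diagonalizable A ->
  exists (Q : 'M[C]_n) (d : 'I_n -> C),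
    [/\ Q \in unitmx, forall i, A *m col i Q = d i *: col i Q &
        char_poly A = \prod_i ('X - (d i)%:P)].
Proof.
move=> [P Pu /similar_diagPex[D /(similarRL Pu) DE]].
have AE : A *m invmx P = invmx P *m diag_mx D.
  by rewrite DE !mulmxA mulVmx // mul1mx.
exists (invmx P), (fun i => D 0 i); split; first by rewrite unitmx_inv.
  move=> i; rewrite colE mulmxA AE -mulmxA scalemxAr; congr (_ *m _).
  apply/matrixP => j k; rewrite mul_diag_mx !mxE.
  by have [->|] := eqVneq j i; rewrite ?mulr0.
have -> : char_poly A = char_poly (diag_mx D).
  rewrite DE /char_poly /char_poly_mx !map_mxM /=.
  have -> : 'X%:M = map_mx polyC P *m 'X%:M *m map_mx polyC (invmx P) :> 'M[{poly C}]_n.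
    by rewrite scalar_mxC -mulmxA -map_mxM mulmxV // map_mx1 mulmx1.
  rewrite -mulmxBl -mulmxBr !det_mulmx mulrC mulrA -det_mulmx -map_mxM mulVmx //.
  by rewrite map_mx1 det1 mul1r scalar_mxC -mulmxA -map_mxM mulmxV // map_mx1 mulmx1.
rewrite char_poly_trig ?diag_mx_is_trig //.
by apply: eq_bigr => i _; rewrite mxE eqxx.
Qed.

End ClosedFieldMatrices.

(** * Loxodromic elements *)

Section Complexification.
Context {R : realType}.
Local Notation rc := (real_complex R).
Local Notation mxC M := (map_mx rc M).
Local Notation Rev z := (map_mx (@complex.Re R) z).
Local Notation Imv z := (map_mx (@complex.Im R) z).

Lemma Re_add (a c : R[i]) : complex.Re (a + c) = complex.Re a + complex.Re c.
Proof. by case: a c => [? ?] [? ?]. Qed.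

Lemma Im_add (a c : R[i]) : complex.Im (a + c) = complex.Im a + complex.Im c.
Proof. by case: a c => [? ?] [? ?]. Qed.

Lemma Re_mul (a c : R[i]) : complex.Re (a * c) =
  complex.Re a * complex.Re c - complex.Im a * complex.Im c.
Proof. by case: a c => [? ?] [? ?]. Qed.

Lemma Im_mul (a c : R[i]) : complex.Im (a * c) =
  complex.Re a * complex.Im c + complex.Im a * complex.Re c.
Proof. by case: a c => [? ?] [? ?]. Qed.

Lemma Re_sum (I : finType) (f : I -> R[i]) :
  complex.Re (\sum_i f i) = \sum_i complex.Re (f i).
Proof. by elim/big_rec2: _ => // i a c _ <-; rewrite Re_add. Qed.

Lemma Im_sum (I : finType) (f : I -> R[i]) :
  complex.Im (\sum_i f i) = \sum_i complex.Im (f i).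
Proof. by elim/big_rec2: _ => // i a c _ <-; rewrite Im_add. Qed.

Lemma Re_mxC_mul p q r (M : 'M[R]_(p, q)) (z : 'M[R[i]]_(q, r)) :
  Rev (mxC M *m z) = M *m Rev z.
Proof.
apply/matrixP => i j; rewrite !mxE Re_sum; apply: eq_bigr => k _.
by rewrite !mxE Re_mul /= mul0r subr0.
Qed.

Lemma Im_mxC_mul p q r (M : 'M[R]_(p, q)) (z : 'M[R[i]]_(q, r)) :
  Imv (mxC M *m z) = M *m Imv z.
Proof.
apply/matrixP => i j; rewrite !mxE Im_sum; apply: eq_bigr => k _.
by rewrite !mxE Im_mul /= mul0r addr0.
Qed.

Lemma Re_scale p q (c : R[i]) (z : 'M[R[i]]_(p, q)) :
  Rev (c *: z) = complex.Re c *: Rev z - complex.Im c *: Imv z.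
Proof. by apply/matrixP => i j; rewrite !mxE Re_mul. Qed.

Lemma Im_scale p q (c : R[i]) (z : 'M[R[i]]_(p, q)) :
  Imv (c *: z) = complex.Re c *: Imv z + complex.Im c *: Rev z.
Proof. by apply/matrixP => i j; rewrite !mxE Im_mul. Qed.

Lemma Re_addmx p q (z z' : 'M[R[i]]_(p, q)) : Rev (z + z') = Rev z + Rev z'.
Proof. by apply/matrixP => i j; rewrite !mxE Re_add. Qed.

Lemma Re_mxC p q (M : 'M[R]_(p, q)) : Rev (mxC M) = M.
Proof. by apply/matrixP => i j; rewrite !mxE. Qed.

Lemma complex_mxE p q (z z' : 'M[R[i]]_(p, q)) :
  Rev z = Rev z' -> Imv z = Imv z' -> z = z'.
Proof.
move=> /matrixP zr /matrixP zi; apply/matrixP => i j.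
by apply/eqP; rewrite eq_complex; have := zr i j; have := zi i j;
  rewrite !mxE => -> ->; rewrite !eqxx.
Qed.

Lemma Re_rc (x : R) : complex.Re (rc x) = x. Proof. by []. Qed.
Lemma Im_rc (x : R) : complex.Im (rc x) = 0. Proof. by []. Qed.

Lemma mxC_scale p q (c : R) (M : 'M[R]_(p, q)) : mxC (c *: M) = rc c *: mxC M.
Proof. by apply/matrixP => i j; rewrite !mxE rmorphM. Qed.

Lemma complex_norm_eq1 (mu : R[i]) :
  (`|mu| == 1) = (complex.Re mu ^+ 2 + complex.Im mu ^+ 2 == 1).
Proof.
rewrite -(@eqrXn2 _ 2) ?ler01 // expr1n -add_Re2_Im2.
by rewrite -[1 in LHS]/(rc 1) (inj_eq (@complexI R)).
Qed.

Lemma real_complex_norm (x : R) : `|rc x| = rc `|x|.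
Proof. by rewrite normc_def /= expr0n addr0 sqrtr_sqr. Qed.

End Complexification.

Section Loxodromic.
Context {R : realType} {n : nat} (X : geomCoxeterSystem R n) (o : 'cV[R]_n).
Local Notation B := (gram_mx X).
Local Notation b := (bform B).
Local Notation rc := (real_complex R).
Local Notation mxC M := (map_mx rc M).
Local Notation Rev z := (map_mx (@complex.Re R) z).
Local Notation Imv z := (map_mx (@complex.Im R) z).
Hypothesis oL : lorentz_form B o.

Let bC := lorentzC oL.

Lemma sq_add_eq0 (x y : R) : x ^+ 2 + y ^+ 2 = 0 -> x = 0 /\ y = 0.
Proof.
move=> /eqP; rewrite paddr_eq0 ?sqr_ge0 // !sqrf_eq0 => /andP[/eqP -> /eqP ->].
by [].
Qed.

(** The line of a attracts and the line of c repels. That the other eigenvalues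
    are unimodular and that w is diagonalizable follows from the signature. *)
Definition loxodromic (w : X) (a c : 'cV[R]_n) (l : R) : Prop :=
  [/\ 1 < `|l|, act w a = l *: a, act w c = l^-1 *: c, a != 0 & c != 0].

Lemma norm_gt1_sq (l : R) : 1 < `|l| -> 1 < l ^+ 2.
Proof. by move=> l1; rewrite -real_normK ?num_real // exprn_egt1. Qed.

(** w multiplies b a a by l^2, and preserves it. If a and c were orthogonal they
    would be proportional, which their eigenvalues exclude. *)
Lemma loxodromic_light w a c l : loxodromic w a c l ->
  [/\ b a a = 0, b c c = 0 & b a c != 0].
Proof.
move=> [l1 wa wc a0 c0]; have l2 := norm_gt1_sq l1.
have ln0 : l != 0 by apply: contraTneq l1 => ->; rewrite normr0 ltr10.
have aa : b a a = 0.
  have := act_iso w a a; rewrite wa !bformE => H.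
  have : (l ^+ 2 - 1) * b a a = 0 by rewrite mulrBl mul1r expr2 -mulrA H subrr.
  by move=> /eqP; rewrite mulf_eq0 gt_eqF ?subr_gt0 //= => /eqP.
have cc : b c c = 0.
  have := act_iso w c c; rewrite wc !bformE => H.
  have : (l ^+ 2 - 1) * b c c = 0 by rewrite mulrBl mul1r -{1}H; field.
  by move=> /eqP; rewrite mulf_eq0 gt_eqF ?subr_gt0 //= => /eqP.
split=> //; apply/eqP => ac; have ca : b c a = 0 by rewrite bC.
have [t ct] := light_perp_light oL a0 aa cc ca.
have : (l ^+ 2 - 1) *: c = 0.
  have : act w c = l *: c by rewrite {1}ct act_scale wa scalerA mulrC -scalerA -ct.
  rewrite wc => /(congr1 (fun v => l *: v)); rewrite !scalerA mulfV // -expr2 scale1r.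
  by move=> E; rewrite scalerBl scale1r -E subrr.
by move=> /eqP; rewrite scaler_eq0 (negPf c0) orbF gt_eqF ?subr_gt0.
Qed.

Lemma loxodromic_conj w a c l (f : X) : loxodromic w a c l ->
  loxodromic (f * w * f^-1)%g (act f a) (act f c) l.
Proof.
move=> [l1 wa wc a0 c0]; split; rewrite ?act_neq0 //.
  by rewrite !actM actK wa act_scale.
by rewrite !actM actK wc act_scale.
Qed.

(** A complex eigenvector z = x + i y of eigenvalue p + i q, in real terms. *)
Definition eigenpair (w : X) (p q : R) (x y : 'cV[R]_n) : Prop :=
  act w x = p *: x - q *: y /\ act w y = q *: x + p *: y.

Lemma complex_eigenpair w (mu : R[i]) (z : 'cV[R[i]]_n) :
  geom_repC w *m z = mu *: z ->
  eigenpair w (complex.Re mu) (complex.Im mu) (Rev z) (Imv z).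
Proof.
move=> wz; split; rewrite /act.
  by rewrite -Re_mxC_mul -/(geom_repC w) wz Re_scale.
by rewrite -Im_mxC_mul -/(geom_repC w) wz Im_scale addrC.
Qed.

(** The isometry w multiplies the pairing of x + i y with a by the product of the
    two eigenvalues, and preserves it. *)
Lemma eigenpair_perp w p q x y a l : eigenpair w p q x y -> act w a = l *: a ->
  l ^+ 2 * (p ^+ 2 + q ^+ 2) != 1 -> b x a = 0 /\ b y a = 0.
Proof.
move=> [wx wy] wa l1; apply: sq_add_eq0.
have := act_iso w x a; have := act_iso w y a; rewrite wx wy wa !bformE.
set u := b x a; set v := b y a => Hv Hu.
have : (l ^+ 2 * (p ^+ 2 + q ^+ 2) - 1) * (u ^+ 2 + v ^+ 2) = 0.
  have E := f_equal2 (fun r s => r ^+ 2 + s ^+ 2) Hu Hv.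
  by rewrite mulrBl mul1r -{2}E; ring.
by move=> /eqP; rewrite mulf_eq0 subr_eq0 (negPf l1) => /eqP.
Qed.

(** The real and imaginary parts of an eigenvector of non-unimodular
    eigenvalue span a totally isotropic space, hence at most a line: the
    eigenvalue is real, and so is the eigenvector up to a complex factor. *)
Lemma eigenpair_nonunimodular w p q x y : eigenpair w p q x y ->
  p ^+ 2 + q ^+ 2 != 1 -> x != 0 \/ y != 0 ->
  exists (a : 'cV[R]_n) (s t : R),
    [/\ a != 0, b a a = 0, act w a = p *: a, q = 0 & x = s *: a /\ y = t *: a].
Proof.
move=> [wx wy] pq1 xy0.
have := act_iso w x x; have := act_iso w y y; have := act_iso w x y.
rewrite wx wy !bformE (bC y x).
set xx := b x x; set yy := b y y; set xy := b x y => Hxy Hyy Hxx.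
have S0 : xx + yy = 0.
  have : (p ^+ 2 + q ^+ 2 - 1) * (xx + yy) = 0.
    by rewrite mulrBl mul1r -{2}(f_equal2 +%R Hxx Hyy); ring.
  by move=> /eqP; rewrite mulf_eq0 subr_eq0 (negPf pq1) => /eqP.
have pq2 : (p ^+ 2 + q ^+ 2) ^+ 2 != 1.
  rewrite -subr_eq0 subr_sqr_1 mulf_neq0 ?subr_eq0 //.
  by rewrite gt_eqF // ltr_wpDl // addr_ge0 ?sqr_ge0.
have [D0 xy00] : xx - yy = 0 /\ 2 * xy = 0.
  apply: sq_add_eq0.
  have : ((p ^+ 2 + q ^+ 2) ^+ 2 - 1) * ((xx - yy) ^+ 2 + (2 * xy) ^+ 2) = 0.
    have E := f_equal2 (fun r s => (r - s) ^+ 2 + (2 * xy) ^+ 2) Hxx Hyy.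
    by rewrite mulrBl mul1r -{2}E -[in X in _ - (_ + X)]Hxy; ring.
  by move=> /eqP; rewrite mulf_eq0 subr_eq0 (negPf pq2) => /eqP.
have xx0 : xx = 0 by lra.
have yy0 : yy = 0 by lra.
have xy0' : xy = 0 by lra.
have [x0|x0] := eqVneq x 0.
  have y0 : y != 0 by case: xy0; rewrite // x0 eqxx.
  have q0 : q = 0.
    have := wx; rewrite x0 scaler0 sub0r /act mulmx0 => /esym/eqP.
    by rewrite oppr_eq0 scaler_eq0 (negPf y0) orbF => /eqP.
  exists y, 0, 1; rewrite scale0r scale1r; split=> //.
  by rewrite wy x0 scaler0 add0r.
have [t yt] := light_perp_light oL x0 xx0 yy0 (etrans (bC y x) xy0').
have wxE : act w x = (p - q * t) *: x by rewrite wx yt scalerA -scalerBl.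
have q0 : q = 0.
  have := wy; rewrite yt act_scale wxE !scalerA -scalerDl => /eqP.
  rewrite -subr_eq0 -scalerBl scaler_eq0 (negPf x0) orbF => /eqP E.
  have : q * (1 + t ^+ 2) = 0 by move: E; move=> E; rewrite -oppr0 -E; ring.
  move=> /eqP; rewrite mulf_eq0 [1 + _ == 0]gt_eqF ?orbF => [/eqP //|].
  by rewrite ltr_pwDl // sqr_ge0.
exists x, 1, t; rewrite scale1r; split=> //.
by rewrite wxE q0 mul0r subr0.
Qed.

Lemma neq0_parts (z : 'cV[R[i]]_n) : z != 0 -> Rev z != 0 \/ Imv z != 0.
Proof.
move=> z0; have [x0|] := eqVneq (Rev z) 0; last by left.
right; apply: contra_neq z0 => y0; apply: complex_mxE.
  by rewrite x0; apply/matrixP => i j; rewrite !mxE.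
by rewrite y0; apply/matrixP => i j; rewrite !mxE.
Qed.

Lemma real_eigenvector (w : X) (l : R) : 1 < `|l| \/ `|l| < 1 ->
  root (char_poly (geom_repC w)) (rc l) ->
  exists2 a : 'cV[R]_n, a != 0 & act w a = l *: a.
Proof.
move=> l1 /root_eigenvector[z z0 /complex_eigenpair wz].
have [|a [s [t [a0 _ wa _ _]]]] := eigenpair_nonunimodular wz _ (neq0_parts z0).
  rewrite Re_rc Im_rc expr0n addr0 -real_normK ?num_real // pexpr_eq1 ?normr_ge0 //.
  by case: l1 => [/gt_eqF ->|/lt_eqF ->].
by exists a.
Qed.

(** The form conjugates the inverse of an isometry to its transpose. *)
Lemma geom_rep_inv_trace (w : X) : \tr (geom_rep w^-1%g) = \tr (geom_rep w).
Proof.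
have Bu := lorentz_unit oL.
have E : (geom_rep w)^T *m B = B *m geom_rep w^-1%g.
  have H : (geom_rep w)^T *m B *m geom_rep w = B.
    apply/matrixP => i j; have := act_iso w (simple_root i) (simple_root j).
    rewrite /act /bform trmx_mul !mulmxA -(mulmxA _ _ B) -[X in X = _]/(_) => H.
    have D (M : 'M[R]_n) : M i j = ((simple_root i)^T *m M *m simple_root j) 0 0.
      by rewrite /simple_root trmx_delta -rowE -colE !mxE.
    by rewrite D [RHS]D -H !mulmxA.
  by rewrite -{2}H -mulmxA -geom_repM mulgV geom_rep1 mulmx1.
have -> : geom_rep w^-1%g = invmx B *m ((geom_rep w)^T *m B) by rewrite E mulKmx.
by rewrite mxtrace_mulC -mulmxA mulmxV // mulmx1 mxtrace_tr.
Qed.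

(** An isometry of large trace has an eigenvalue of large modulus; so has its
    inverse, and the two eigenvalues are l and l^-1 since the eigenvectors are
    not orthogonal. *)
Lemma large_trace_loxodromic (w : X) : n%:R < `|\tr (geom_rep w)| ->
  exists a c l, loxodromic w a c l /\ `|\tr (geom_rep w)| <= n%:R * `|l|.
Proof.
have [n0|n0] := posnP n.
  rewrite [\tr _]big1 => [|i _]; first by rewrite normr0 ltNge ler0n.
  by have := ltn_ord i; rewrite [X in (_ < X)%N]n0.
have half (w' : X) : n%:R < `|\tr (geom_rep w')| ->
    exists a l, [/\ a != 0, b a a = 0, act w' a = l *: a, 1 < `|l| &
                 `|\tr (geom_rep w')| <= n%:R * `|l|].
  move=> trn; have [mu /root_eigenvector[z z0 /complex_eigenpair wz]] :=
    trace_eigenvalue (geom_repC w') n0.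
  have -> : \tr (geom_repC w') = rc (\tr (geom_rep w')).
    by rewrite /mxtrace rmorph_sum; apply: eq_bigr => i _; rewrite mxE.
  rewrite real_complex_norm => tr_le.
  have nC : (n%:R : R[i]) = rc n%:R by rewrite rmorph_nat.
  have mu1 : 1 < `|mu|.
    have : (n%:R : R[i]) < n%:R * `|mu|.
      by apply: lt_le_trans tr_le; rewrite nC ltcR.
    by rewrite -{1}[n%:R]mulr1 ltr_pM2l // ltr0n.
  have [|a [s [t [a0 aa wa q0 _]]]] := eigenpair_nonunimodular wz _ (neq0_parts z0).
    by rewrite -complex_norm_eq1 gt_eqF.
  have muE : mu = rc (complex.Re mu) by rewrite [LHS]complexE q0 mulr0 addr0.
  exists a, (complex.Re mu); split=> //.
    by move: mu1; rewrite muE real_complex_norm /= -[1]/(rc 1) ltcR.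
  by move: tr_le; rewrite {1}muE real_complex_norm nC -rmorphM lecR.
move=> trn; have [a [l [a0 aa wa l1 trl]]] := half _ trn.
have [|c [l' [c0 cc wc l1' _]]] := half w^-1%g; first by rewrite geom_rep_inv_trace.
have l'0 : l' != 0 by apply: contraTneq l1' => ->; rewrite normr0 ltr10.
have {}wc : act w c = l'^-1 *: c.
  by rewrite -{1}[c](scalerK l'0) -wc act_scale actVK.
exists a, c, l; split=> //; split=> //.
have [ac|ac] := eqVneq (b c a) 0.
  have [t ct] := light_perp_light oL a0 aa cc ac.
  have : (l - l'^-1) *: c = 0.
    by rewrite scalerBl -wc {2}ct act_scale wa scalerA mulrC -scalerA -ct subrr.
  move=> /eqP; rewrite scaler_eq0 (negPf c0) orbF subr_eq0 => /eqP lE.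
  by move: l1; rewrite lE normfV invf_gt1 ?normr_gt0 // ltNge ltW.
have := act_iso w c a; rewrite wa wc !bformE mulrA => /eqP.
rewrite -{2}[b c a]mul1r -subr_eq0 -mulrBl mulf_eq0 (negPf ac) orbF subr_eq0 => /eqP ll.
by rewrite -[l](divfK l'0) ll mul1r.
Qed.

End Loxodromic.

(** * Loxodromic and hyperbolic elements agree *)

Section RealSpan.
Context {R : realType} {n : nat} (A : set 'cV[R]_n).

Lemma real_span_gen v : A v -> real_span A v.
Proof.
move=> Av; exists 1%N, (fun=> 1), (fun=> v); split=> //.
by rewrite big_ord1 scale1r.
Qed.

Lemma real_span_scale (c : R) v : real_span A v -> real_span A (c *: v).
Proof.
move=> [k [a [u [Au ->]]]]; exists k, (fun i => c * a i), u; split=> //.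
by rewrite scaler_sumr; apply: eq_bigr => i _; rewrite scalerA.
Qed.

Lemma real_span0 : real_span A 0.
Proof. by exists 0%N, (fun=> 0), (fun=> 0); split=> [[]//|]; rewrite big_ord0. Qed.

Lemma real_span_add v v' : real_span A v -> real_span A v' -> real_span A (v + v').
Proof.
move=> [k [a [u [Au ->]]]] [k' [a' [u' [Au' ->]]]].
exists (k + k')%N.
exists (fun i => match fintype.split i with inl j => a j | inr j => a' j end).
exists (fun i => match fintype.split i with inl j => u j | inr j => u' j end).
split=> [i|]; first by case: fintype.split.
rewrite big_split_ord /=; congr (_ + _); apply: eq_bigr => i _.
  by rewrite (unsplitK (inl i)).
by rewrite (unsplitK (inr i)).
Qed.

Lemma real_span_perp (B : 'M[R]_n) (a : 'cV[R]_n) :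
  (forall v, A v -> bform B v a = 0) -> forall v, real_span A v -> bform B v a = 0.
Proof.
move=> Aa v [k [f [u [Au ->]]]]; rewrite bform_suml big1 // => i _.
by rewrite bform_scalel Aa ?mulr0.
Qed.

End RealSpan.

Section HyperbolicElements.
Context {R : realType} {n : nat} (X : geomCoxeterSystem R n) (o : 'cV[R]_n).
Local Notation B := (gram_mx X).
Local Notation b := (bform B).
Local Notation rc := (real_complex R).
Local Notation mxC M := (map_mx rc M).
Local Notation Rev z := (map_mx (@complex.Re R) z).
Local Notation Imv z := (map_mx (@complex.Im R) z).
Hypothesis oL : lorentz_form B o.

Let bC := lorentzC oL.

Lemma loxodromic_sq (w : X) a c l : loxodromic w a c l ->
  [/\ l != 0, l ^+ 2 != 1 & l^-1 ^+ 2 != 1].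
Proof.
move=> [l1 _ _ _ _]; have l2 := norm_gt1_sq l1.
split; first by apply: contraTneq l1 => ->; rewrite normr0 ltr10.
  by rewrite gt_eqF.
by rewrite exprVn invr_eq1 gt_eqF.
Qed.

Lemma unimodular_subspace_perp (w : X) a l : act w a = l *: a -> l ^+ 2 != 1 ->
  forall x, unimodular_subspace w x -> b x a = 0.
Proof.
move=> wa l1; apply: real_span_perp => v [z [z0 [mu [mu1 /complex_eigenpair wz]]] vz].
have /eqP : `|mu| == 1 by rewrite mu1.
move=> /eqP; rewrite complex_norm_eq1 => /eqP mu2.
have [|xa ya] := eigenpair_perp wz wa; first by rewrite mu2 mulr1.
by case: vz => ->.
Qed.

Lemma hyperbolic_loxodromic (w : X) : hyperbolic w ->
  exists a c l, loxodromic w a c l /\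
    forall x, unimodular_subspace w x -> b x a = 0 /\ b x c = 0.
Proof.
move=> [_ [l [l1 ml ml' _]]].
have mroot (m : R[i]) : mup m (char_poly (geom_repC w)) = 1%N ->
    root (char_poly (geom_repC w)) m.
  by move=> m1; apply: contraPT m1 => /mupNroot ->.
have [a a0 wa] := real_eigenvector oL (or_introl l1) (mroot _ ml).
have [|c c0 wc] := real_eigenvector oL _ (mroot _ ml').
  by right; rewrite normfV invf_lt1 // (lt_trans ltr01).
have L : loxodromic w a c l by [].
have [l0 l2 l2'] := loxodromic_sq L.
exists a, c, l; split=> // x xU.
by split; [apply: (unimodular_subspace_perp wa)|apply: (unimodular_subspace_perp wc)].
Qed.

Section Loxodromic.
Variables (w : X) (a c : 'cV[R]_n) (l : R).
Hypothesis L : loxodromic w a c l.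

Let wa : act w a = l *: a. Proof. by case: L. Qed.
Let wc : act w c = l^-1 *: c. Proof. by case: L. Qed.
Let a0 : a != 0. Proof. by case: L. Qed.
Let c0 : c != 0. Proof. by case: L. Qed.
Let l0 : l != 0. Proof. by case: (loxodromic_sq L). Qed.
Let l2 : l ^+ 2 != 1. Proof. by case: (loxodromic_sq L). Qed.
Let l2' : l^-1 ^+ 2 != 1. Proof. by case: (loxodromic_sq L). Qed.
Let aa : b a a = 0. Proof. by case: (loxodromic_light oL L). Qed.
Let cc : b c c = 0. Proof. by case: (loxodromic_light oL L). Qed.
Let ac : b a c != 0. Proof. by case: (loxodromic_light oL L). Qed.

(** An eigenvector with real non-unimodular eigenvalue is light-like, so it is
    proportional to c or not orthogonal to it; in the second case its eigenvalue
    is l, and it is orthogonal to a. *)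
Lemma loxodromic_eigenpair p q x y : eigenpair w p q x y ->
  p ^+ 2 + q ^+ 2 != 1 -> x != 0 \/ y != 0 ->
  q = 0 /\ ((p = l /\ exists s t, x = s *: a /\ y = t *: a) \/
            (p = l^-1 /\ exists s t, x = s *: c /\ y = t *: c)).
Proof.
move=> wxy pq xy0.
have [a1 [s [t [a10 aa1 wa1 q0 [xE yE]]]]] := eigenpair_nonunimodular oL wxy pq xy0.
split=> //; have [a1c|a1c] := eqVneq (b a1 c) 0.
  right; have [r a1E] := light_perp_light oL c0 cc aa1 a1c.
  split; last by exists (s * r), (t * r); rewrite xE yE a1E !scalerA.
  apply/eqP; rewrite -subr_eq0; have : (p - l^-1) *: a1 == 0.
    by rewrite scalerBl -wa1 {1}a1E act_scale wc scalerA mulrC -scalerA -a1E subrr.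
  by rewrite scaler_eq0 (negPf a10) orbF.
left; have pl : p = l.
  have := act_iso w a1 c; rewrite wa1 wc !bformE mulrCA mulrA => /eqP.
  rewrite -{2}[b a1 c]mul1r -subr_eq0 -mulrBl mulf_eq0 (negPf a1c) orbF subr_eq0 => /eqP E.
  by rewrite -[l]mulr1 -E mulVKf.
split=> //.
have a1a : b a1 a = 0.
  have := act_iso w a1 a; rewrite wa1 wa !bformE pl mulrA -expr2 => /eqP.
  rewrite -{2}[b a1 a]mul1r -subr_eq0 -mulrBl mulf_eq0 subr_eq0 (negPf l2) /=.
  by move=> /eqP.
have [r a1E] := light_perp_light oL a0 aa aa1 a1a.
by exists (s * r), (t * r); rewrite xE yE a1E !scalerA.
Qed.

Let perp0 x : b x a = 0 -> b x c = 0 -> b x x <= 0 -> x = 0.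
Proof.
move=> xa xc xx; apply/eqP; apply: contraT => x0.
by have := two_light_perp_pos oL a0 c0 aa cc ac xa xc x0; rewrite ltNge xx.
Qed.

Let perp_ge0 x : b x a = 0 -> b x c = 0 -> 0 <= b x x.
Proof. by move=> xa xc; have [] := light_perp oL a0 aa xa. Qed.

(** On the span of a and c semisimplicity is clear; on the orthogonal of this
    plane the form is definite, and a Jordan block would produce an isotropic
    eigenvector. *)
Lemma loxodromic_semisimple (r : R[i]) (y : 'cV[R[i]]_n) :
  (geom_repC w - r%:M) *m ((geom_repC w - r%:M) *m y) = 0 ->
  (geom_repC w - r%:M) *m y = 0.
Proof.
set z := (geom_repC w - r%:M) *m y => wz0; apply/eqP; apply: contraT => z0.
have wy : geom_repC w *m y = r *: y + z.
  by rewrite /z mulmxBl mul_scalar_mx addrC subrK.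
have wz : geom_repC w *m z = r *: z.
  by apply/eqP; rewrite -subr_eq0 -mul_scalar_mx -mulmxBl wz0.
have wz12 := complex_eigenpair wz; have z12 := neq0_parts z0.
set p := complex.Re r in wz12 *; set q := complex.Im r in wz12 *.
set z1 := Rev z in wz12 z12 *; set z2 := Imv z in wz12 z12 *.
have wy1 : act w (Rev y) = p *: Rev y - q *: Imv y + z1.
  by rewrite /act -Re_mxC_mul -/(geom_repC w) wy Re_addmx Re_scale.
have wy2 : act w (Imv y) = q *: Rev y + p *: Imv y + z2.
  rewrite /act -Im_mxC_mul -/(geom_repC w) wy.
  by rewrite [in LHS](_ : Imv (r *: y + z) = Imv (r *: y) + z2);
    [rewrite Im_scale [p *: _ + _]addrC|apply/matrixP => i j; rewrite !mxE Im_add].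
set y1 := Rev y in wy1 wy2 *; set y2 := Imv y in wy1 wy2 *.
have [wz1 wz2] := wz12.
have z120 : ~ (z1 = 0 /\ z2 = 0) by case=> z10 z20; case: z12; rewrite ?z10 ?z20 eqxx.
case: z120.
have [pq1|pq1] := eqVneq (p ^+ 2 + q ^+ 2) 1.
  have [|z1a z2a] := eigenpair_perp wz12 wa; first by rewrite pq1 mulr1.
  have [|z1c z2c] := eigenpair_perp wz12 wc; first by rewrite pq1 mulr1.
  have Z0 : b z1 z1 + b z2 z2 = 0.
    have := act_iso w y1 z1; have := act_iso w y2 z2.
    have := act_iso w y2 z1; have := act_iso w y1 z2.
    rewrite wy1 wy2 wz1 wz2 !bformE (bC z2 z1) => H12 H21 H22 H11.
    have pZ : p * (b z1 z1 + b z2 z2) = 0.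
      have E := f_equal2 +%R H11 H22.
      transitivity ((b y1 z1 + b y2 z2) - (p ^+ 2 + q ^+ 2) * (b y1 z1 + b y2 z2)).
        by rewrite -{1}E; ring.
      by rewrite pq1 mul1r subrr.
    have qZ : q * (b z1 z1 + b z2 z2) = 0.
      have E := f_equal2 (fun r s => r - s) H12 H21.
      transitivity ((b y1 z2 - b y2 z1) - (p ^+ 2 + q ^+ 2) * (b y1 z2 - b y2 z1)).
        by rewrite -{1}E; ring.
      by rewrite pq1 mul1r subrr.
    by rewrite -[LHS]mul1r -pq1 mulrDl !expr2 -!mulrA pZ qZ !mulr0 addr0.
  have := perp_ge0 z1a z1c; have := perp_ge0 z2a z2c => z2p z1p.
  by split; apply: perp0 => //; lra.
have [q0 cases] := loxodromic_eigenpair wz12 pq1 z12.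
have key u s t : act w u = p^-1 *: u -> p != 0 -> b z1 u = s * b a c ->
    b z2 u = t * b a c -> s = 0 /\ t = 0.
  move=> wu p0 z1u z2u.
  have := act_iso w y1 u; have := act_iso w y2 u.
  rewrite wy1 wy2 wu q0 !scale0r subr0 add0r !bformE z1u z2u => H2 H1.
  have S0 : s * b a c = 0.
    transitivity (p * (p * (p^-1 * b y1 u) + p^-1 * (s * b a c)) - p * b y1 u); first by field.
    by rewrite H1 subrr.
  have T0 : t * b a c = 0.
    transitivity (p * (p * (p^-1 * b y2 u) + p^-1 * (t * b a c)) - p * b y2 u); first by field.
    by rewrite H2 subrr.
  split; apply/eqP; first by move/eqP: S0; rewrite mulf_eq0 (negPf ac) orbF.
  by move/eqP: T0; rewrite mulf_eq0 (negPf ac) orbF.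
case: cases => -[pE [s [t [z1E z2E]]]].
  have [||||s0 t0] := key c s t; rewrite ?pE ?z1E ?z2E ?bform_scalel //.
  by rewrite s0 t0 !scale0r.
have [||||s0 t0] := key a s t; rewrite ?pE ?invrK ?invr_eq0 ?z1E ?z2E ?bform_scalel //;
  rewrite ?(bC c a) //.
by rewrite s0 t0 !scale0r.
Qed.

Lemma loxodromic_eigenvector (mu : R[i]) (z : 'cV[R[i]]_n) : z != 0 ->
  geom_repC w *m z = mu *: z -> `|mu| != 1 ->
  (mu = rc l /\ exists k, z = k *: mxC a) \/ (mu = rc l^-1 /\ exists k, z = k *: mxC c).
Proof.
move=> z0 /complex_eigenpair wz; rewrite complex_norm_eq1 => mu1.
have [q0 H] := loxodromic_eigenpair wz mu1 (neq0_parts z0).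
have muE : mu = rc (complex.Re mu) by rewrite [LHS]complexE q0 mulr0 addr0.
have zE (u : 'cV[R]_n) s t : Rev z = s *: u -> Imv z = t *: u ->
    z = Complex s t *: mxC u.
  move=> zs zt; apply: complex_mxE; first by rewrite zs Re_scale Re_mxC /=
    (_ : Imv (mxC u) = 0) ?scaler0 ?subr0 //; apply/matrixP => i j; rewrite !mxE.
  by rewrite zt Im_scale Re_mxC /=
    (_ : Imv (mxC u) = 0) ?scaler0 ?add0r //; apply/matrixP => i j; rewrite !mxE.
case: H => -[pE [s [t [zs zt]]]]; [left|right]; rewrite muE pE; split=> //.
  by exists (Complex s t); exact: zE.
by exists (Complex s t); exact: zE.
Qed.

Lemma loxodromic_eigenbasis : exists (Q : 'M[R[i]]_n) (d : 'I_n -> R[i]),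
  [/\ Q \in unitmx, forall i, geom_repC w *m col i Q = d i *: col i Q,
      char_poly (geom_repC w) = \prod_i ('X - (d i)%:P) &
      forall i, col i Q != 0].
Proof.
have [Q [d [Qu Qd cE]]] :=
  diagonalizable_eigenbasis (semisimple_diagonalizable loxodromic_semisimple).
exists Q, d; split=> // i; rewrite colE; apply/eqP => Q0.
have := congr1 (mulmx (invmx Q)) Q0; rewrite mulKmx // mulmx0 => /matrixP/(_ i 0).
by rewrite !mxE !eqxx => /eqP; rewrite oner_eq0.
Qed.

(** The eigenvalue m is simple since two vectors of an eigenbasis with this
    eigenvalue would be proportional. *)
Lemma loxodromic_mup (m : R) (u : 'cV[R]_n) : u != 0 -> act w u = m *: u ->
  (forall z : 'cV[R[i]]_n, z != 0 -> geom_repC w *m z = rc m *: z -> exists k, z = k *: mxC u) ->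
  mup (rc m) (char_poly (geom_repC w)) = 1%N.
Proof.
move=> u0 wu um; have [Q [d [Qu Qd cE Q0]]] := loxodromic_eigenbasis.
have : root (char_poly (geom_repC w)) (rc m).
  apply: (@eigenvector_root _ _ _ _ (mxC u)).
    by rewrite map_mx_eq0.
  by rewrite /geom_repC -map_mxM -/(act w u) wu mxC_scale.
have -> : char_poly (geom_repC w) = \prod_(r <- map d (enum 'I_n)) ('X - r%:P).
  by rewrite cE big_map big_enum.
rewrite root_prod_XsubC mu_prod_XsubC.
move=> /mapP[i0 _ i0E]; rewrite count_map.
rewrite (@eq_count _ _ (pred1 i0)) ?count_uniq_mem ?enum_uniq ?mem_enum // => i /=.
have [-> |ii0] := eqVneq i i0; first by rewrite i0E eqxx.
apply/negbTE; apply: contraNN ii0 => /eqP di.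
have [||k kE] := um (col i Q); rewrite ?Qd ?di //.
have [||k0 k0E] := um (col i0 Q); rewrite ?Qd -?i0E //.
have k00 : k0 != 0 by apply: contra_neq (Q0 i0) => k00; rewrite k0E k00 scale0r.
have : Q *m (k0 *: delta_mx i 0 - k *: delta_mx i0 0 : 'cV_n) = 0.
  by rewrite mulmxBr -!scalemxAr -!colE kE k0E !scalerA mulrC subrr.
move=> /(congr1 (mulmx (invmx Q))); rewrite mulKmx // mulmx0 => /matrixP/(_ i 0).
rewrite !mxE !eqxx /= mulr1 andbT; case: eqP => // _ /eqP.
by rewrite mulr0 subr0 (negPf k00).
Qed.

Lemma loxodromic_hyperbolic : hyperbolic w.
Proof.
have nrm (m : R) : m ^+ 2 != 1 -> `|rc m| != 1.
  by rewrite complex_norm_eq1 /= expr0n addr0.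
have ll : rc l != rc l^-1.
  rewrite (inj_eq (@complexI R)); apply: contra_neq l2 => lE.
  by rewrite expr2 {2}lE mulfV.
split; first exact: semisimple_diagonalizable loxodromic_semisimple.
exists l; split; first by case: L.
- apply: (@loxodromic_mup l a) => // z z0 wz.
  have [[_ //]|[E]] := loxodromic_eigenvector z0 wz (nrm _ l2).
  by move: ll; rewrite E eqxx.
- apply: (@loxodromic_mup l^-1 c) => // z z0 wz.
  have [[E]|[_ //]] := loxodromic_eigenvector z0 wz (nrm _ l2').
  by move: ll; rewrite E eqxx.
move=> mu; rewrite eigenvalue_root_char => /root_eigenvector[z z0 wz] mul mul'.
apply/eqP; apply: contraT => mu1.
by have [[E]|[E]] := loxodromic_eigenvector z0 wz mu1; rewrite ?E eqxx in mul mul'.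
Qed.

(** A real vector orthogonal to a and c has no component on the
    non-unimodular eigenvectors. *)
Lemma loxodromic_perp_unimodular x : b x a = 0 -> b x c = 0 ->
  unimodular_subspace w x.
Proof.
move=> xa xc; have [Q [d [Qu Qd _ Q0]]] := loxodromic_eigenbasis.
pose k i := (invmx Q *m mxC x) i 0.
pose f i := Rev (k i *: col i Q).
have xE : x = \sum_(i | `|d i| == 1) f i + \sum_(i | `|d i| != 1) f i.
  transitivity (\sum_i f i); last by rewrite (bigID (fun i => `|d i| == 1)).
  rewrite -[LHS]Re_mxC -[mxC x](mulKVmx Qu).
  apply/colP => i; rewrite mxE mxE Re_sum summxE; apply: eq_bigr => h _.
  by rewrite mulrC /f /k [RHS]mxE [X in _ = complex.Re X]mxE [col h Q i 0]mxE.
have good : unimodular_subspace w (\sum_(i | `|d i| == 1) f i).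
  apply: big_ind => [||i /eqP di]; [exact: real_span0|exact: real_span_add|].
  rewrite /f Re_scale -scaleNr; have ui : unimodular_eigenvector w (col i Q).
    by split=> //; exists (d i).
  by apply: real_span_add; apply: real_span_scale; apply: real_span_gen;
    exists (col i Q) => //; [left|right].
have [s [t bad]] : exists s t, \sum_(i | `|d i| != 1) f i = s *: a + t *: c.
  apply: (big_ind (fun v => exists s t, v = s *: a + t *: c)).
  - by exists 0, 0; rewrite !scale0r addr0.
  - by move=> u v [s [t ->]] [s' [t' ->]]; exists (s + s'), (t + t');
      rewrite !scalerDl addrACA.
  move=> i di; rewrite /f.
  have Reu (e : R[i]) (u : 'cV[R]_n) : Rev (e *: mxC u) = complex.Re e *: u.
    by apply/matrixP => h j; rewrite !mxE Re_mul /= mulr0 subr0.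
  have [[_ [e ->]]|[_ [e ->]]] := loxodromic_eigenvector (Q0 i) (Qd i) di.
    by exists (complex.Re (k i * e)), 0; rewrite scalerA Reu scale0r addr0.
  by exists 0, (complex.Re (k i * e)); rewrite scalerA Reu scale0r add0r.
have ga := unimodular_subspace_perp wa l2 good.
have gc := unimodular_subspace_perp wc l2' good.
move: xa xc; rewrite xE bad !bform_addl ga gc !bform_scalel aa cc (bC c a) !mulr0 !add0r addr0.
move=> /eqP; rewrite mulf_eq0 (negPf ac) orbF => /eqP t0.
move=> /eqP; rewrite mulf_eq0 (negPf ac) orbF => /eqP s0.
by rewrite s0 t0 !scale0r !addr0.
Qed.

End Loxodromic.
End HyperbolicElements.

(** * Limit vectors and pairs of fixed lines *)

Section LimitSet.
Context {R : realType} {n : nat} (X : geomCoxeterSystem R n) (o : 'cV[R]_n).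
Local Notation B := (gram_mx X).
Local Notation b := (bform B).
Hypothesis oL : lorentz_form B o.
Context {F : set_system nat} {FU : UltraFilter F}.
Local Notation N w := (b (act w o) o).

Let bC := lorentzC oL.

(** This is the union of the unimodular subspaces of the hyperbolic elements;
    K will be its closure. *)
Definition lox_perp : set 'cV[R]_n :=
  [set x | exists w a c l, loxodromic (X := X) w a c l /\ b x a = 0 /\ b x c = 0].

Local Notation K := (closure lox_perp).

Lemma K_lim (u : nat -> 'cV[R]_n) x :
  (\forall k \near F, K (u k)) -> u @ F --> x -> K x.
Proof.
move=> uK; exact: (@closed_cvg nat 'cV[R]_n F _ u K (@closed_closure _ _) uK x).
Qed.

Lemma lox_perp_K x : lox_perp x -> K x.
Proof. exact: subset_closure. Qed.

Lemma K_linear (M : 'M[R]_n) x : (forall y, lox_perp y -> lox_perp (M *m y)) ->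
  K x -> K (M *m x).
Proof.
move=> MS Kx U MU.
have cont : (fun y : 'cV[R]_n => M *m y) @ x --> M *m x.
  apply: (@cvg_mulmx R 'cV[R]_n (nbhs x) _ n n 1 (fun=> M) id).
    exact: cvg_cst.
  exact: cvg_id.
by have [y [Sy Uy]] := Kx _ (cont _ MU); exists (M *m y); split=> //; exact: MS.
Qed.

Lemma K_act (f : X) x : K x -> K (act f x).
Proof.
apply: K_linear => y [w [a [c [l [L [ya yc]]]]]].
exists (f * w * f^-1)%g, (act f a), (act f c), l.
by split; [exact: loxodromic_conj|rewrite -/(act f y) !act_iso].
Qed.

Lemma K_scale (t : R) x : K x -> K (t *: x).
Proof.
rewrite -mul_scalar_mx; apply: K_linear => y [w [a [c [l [L [ya yc]]]]]].
by exists w, a, c, l; rewrite mul_scalar_mx !bform_scalel ya yc mulr0.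
Qed.

(** Project x to the orthogonal of a_k and c_k: the corrections tend to 0 since
    b a_k c_k stays away from 0. *)
Lemma K_perp_limit (a_ c_ : nat -> 'cV[R]_n) a c x :
  a_ @ F --> a -> c_ @ F --> c -> b a c != 0 ->
  (\forall k \near F, [/\ b (a_ k) (a_ k) = 0, b (c_ k) (c_ k) = 0 &
     forall y, b y (a_ k) = 0 -> b y (c_ k) = 0 -> K y]) ->
  b x a = 0 -> b x c = 0 -> K x.
Proof.
move=> ca cc ac near_k xa xc.
have cac : (fun k => b (a_ k) (c_ k)) @ F --> b a c by exact: cvg_bform.
pose x_ k := x - ((b x (c_ k) / b (a_ k) (c_ k)) *: a_ k +
                  (b x (a_ k) / b (a_ k) (c_ k)) *: c_ k).
apply: (@K_lim x_); last first.
  have cxa : (fun k => b x (a_ k)) @ F --> b x a by exact: (cvg_bform (cvg_cst x) ca).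
  have cxc : (fun k => b x (c_ k)) @ F --> b x c by exact: (cvg_bform (cvg_cst x) cc).
  have H := cvgB (cvg_cst x) (cvgD (cvg_scalemx (cvgM cxc (cvgV ac cac)) ca)
    (cvg_scalemx (cvgM cxa (cvgV ac cac)) cc)).
  by rewrite xa xc !mul0r !scale0r addr0 subr0 in H; exact: H.
have ac_near : \forall k \near F, b (a_ k) (c_ k) != 0 by exact: (cvgr_neq0 _ cac ac).
apply: filterS2 near_k ac_near => k [ak ck Kk] ack.
apply: Kk; rewrite /x_ !bformE ?ak ?ck ?(bC (c_ k)); field; exact: ack.
Qed.

(** As the factors c_k tend to 0, the limit is light-like. *)
Definition limit_vector (v : 'cV[R]_n) : Prop :=
  v != 0 /\ exists (w : nat -> X) (c : nat -> R),
    c @ F --> 0 /\ (fun k => c k *: act (w k) o) @ F --> v.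

Lemma limit_vector_light v : limit_vector v -> b v v = 0.
Proof.
move=> [_ [w [c [c0 wv]]]].
apply: (real_lim_unique (cvg_bform wv wv)).
rewrite (_ : (fun k => _) = fun k => c k * c k * b o o); last first.
  by apply/funext => k; rewrite bform_scalel bform_scaler act_iso mulrA.
have H := cvgM (cvgM c0 c0) (cvg_cst (b o o)).
by rewrite !mul0r in H; exact: H.
Qed.

Lemma limit_vector_act (f : X) v : limit_vector v -> limit_vector (act f v).
Proof.
move=> [v0 [w [c [c0 wv]]]]; split; first exact: act_neq0.
exists (fun k => f * w k)%g, c; split=> //.
rewrite (_ : (fun k => _) = fun k => geom_rep f *m (c k *: act (w k) o)).
  exact: (cvg_mulmx (cvg_cst (geom_rep f)) wv).
by apply/funext => k; rewrite actM -act_scale.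
Qed.

Lemma infty_limit_vector (w : nat -> X) v : b v o = 1 ->
  (forall C, \forall k \near F, C < `|N (w k)|) ->
  (fun k => (N (w k))^-1 *: act (w k) o) @ F --> v -> limit_vector v.
Proof.
move=> vo Noo wv; split.
  by apply/eqP => v0; move: vo; rewrite v0 bform0l => /esym/eqP; rewrite oner_eq0.
by exists w, (fun k => (N (w k))^-1); split=> //; exact: infty_inv_cvg0.
Qed.

(** The numbers c_k N_k tend to b v o, which is not zero as v is light-like, so
    that c_k can be replaced by 1 / N_k. *)
Lemma limit_vector_normalized v : limit_vector v ->
  exists w : nat -> X, (forall C, \forall k \near F, C < `|N (w k)|) /\
    (fun k => (N (w k))^-1 *: act (w k) o) @ F --> (b v o)^-1 *: v.
Proof.
move=> lv; have [v0 [w [c [c0 wv]]]] := lv.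
have vo := light_o_neq0 oL v0 (limit_vector_light lv).
have cN : (fun k => c k * N (w k)) @ F --> b v o.
  have : (fun k => b (c k *: act (w k) o) o) @ F --> b v o.
    exact: (cvg_bform wv (cvg_cst o)).
  by under eq_cvg do rewrite bform_scalel.
have cN0 : \forall k \near F, c k * N (w k) != 0 by exact: (cvgr_neq0 _ cN vo).
have Noo C : \forall k \near F, C < `|N (w k)|.
  have Ninv : (fun k => (N (w k))^-1) @ F --> 0.
    have H : (fun k => c k * (c k * N (w k))^-1) @ F --> (0 : R).
      by have H := cvgM c0 (cvgV vo cN); rewrite mul0r in H; exact: H.
    apply: near_eq_lim H _; apply: filterS cN0 => k /=.
    by rewrite mulf_eq0 negb_or => /andP[ck Nk]; field; rewrite ck Nk.
  have C1 : 0 < (`|C| + 1)^-1 by rewrite invr_gt0 ltr_pwDr.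
  have small : \forall k \near F, `|(N (w k))^-1| < (`|C| + 1)^-1.
    exact: (cvgr0_norm_lt _ Ninv).
  apply: filterS2 small cN0 => k; rewrite mulf_eq0 negb_or => H /andP[ck Nk].
  move: H; rewrite normfV ltf_pV2 ?posrE ?normr_gt0 // ?ltr_pwDr //.
  by apply: le_lt_trans; rewrite (le_trans (ler_norm _)) // lerDl.
exists w; split=> //.
have H : (fun k => (c k * N (w k))^-1 *: (c k *: act (w k) o)) @ F --> (b v o)^-1 *: v.
  exact: (cvg_scalemx (cvgV vo cN) wv).
apply: near_eq_lim H _; apply: filterS cN0 => k.
rewrite mulf_eq0 negb_or => /andP[ck Nk]; rewrite scalerA; congr (_ *: _).
by field; rewrite ck Nk.
Qed.

Lemma limit_vector_attracting v : limit_vector v ->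
  exists (w : nat -> X) m, [/\ forall C, \forall k \near F, C < `|N (w k)|,
    (fun k => (N (w k))^-1 *: geom_rep (w k)) @ F --> rank_one X ((b v o)^-1 *: v) m,
    b m m = 0, b m o = 1 & limit_vector m].
Proof.
move=> /limit_vector_normalized[w [Noo wv]].
have [p [m [wp wm [pp mm] [po mo]]]] := rank_one_limit oL Noo.
exists w, m; split=> //.
  rewrite -(_ : p = (b v o)^-1 *: v) //; apply: mx_lim_unique wv.
  have : (fun k => (N (w k))^-1 *: geom_rep (w k) *m o) @ F --> rank_one X p m *m o.
    exact: (cvg_mulmx wp (cvg_cst o)).
  rewrite rank_oneE mo scale1r.
  by under eq_cvg do rewrite -scalemxAl.
apply: (@infty_limit_vector (fun k => (w k)^-1)%g) => //.
  by move=> C; apply: filterS (Noo C) => k; rewrite (norm_inv oL).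
by under eq_cvg do rewrite (norm_inv oL).
Qed.

(** Inverting the elements of a sequence exchanges the attracting and the
    repelling vector. *)
Lemma limit_vector_repelling v : limit_vector v ->
  exists (w : nat -> X) p, [/\ forall C, \forall k \near F, C < `|N (w k)|,
    (fun k => (N (w k))^-1 *: geom_rep (w k)) @ F --> rank_one X p ((b v o)^-1 *: v),
    b p p = 0 & b p o = 1].
Proof.
move=> /limit_vector_normalized[w [Noo wv]].
have [|p [m [wp wm [pp mm] [po mo]]]] := @rank_one_limit _ _ X o oL F _ (fun k => (w k)^-1)%g.
  by move=> C; apply: filterS (Noo C) => k; rewrite (norm_inv oL).
exists (fun k => (w k)^-1)%g, p; split=> //.
  by move=> C; apply: filterS (Noo C) => k; rewrite (norm_inv oL).
rewrite -(_ : m = (b v o)^-1 *: v) //; apply: mx_lim_unique wv.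
by under eq_cvg do rewrite -(norm_inv oL) -{2}[w _]invgK.
Qed.

(** No light-like line is invariant: a reflection that preserves it fixes it
    pointwise, and no vector is orthogonal to all simple roots. *)
Lemma no_invariant_line (u v : 'cV[R]_n) : u != 0 -> v != 0 -> b u u = 0 ->
  b v v = 0 -> exists f : X, b (act f u) v != 0.
Proof.
move=> u0 v0 uu vv; apply: contrapT => /forallNP H.
have fu (f : X) : b (act f u) v = 0 by apply/eqP; have /negP := H f; rewrite negbK.
have fuv (f : X) : exists t, act f u = t *: v.
  by apply: (light_perp_light oL v0 vv); rewrite ?act_iso.
have [t1] := fuv 1%g; rewrite act1 => uE.
have ua s : b u (simple_root s) = 0.
  have [t] := fuv (cox_gen X s); rewrite act_gen => E.
  have : b (u - (2 * b u (simple_root s)) *: simple_root s) u = 0.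
    by rewrite E uE !bformE vv !mulr0.
  rewrite !bformE uu (bC (simple_root s)) sub0r => /eqP.
  by rewrite oppr_eq0 -mulrA -expr2 mulf_eq0 pnatr_eq0 sqrf_eq0 => /eqP.
case/eqP: u0; apply: (lorentz_nondeg oL) => y.
by rewrite bform_coord big1 // => i _; rewrite ua mulr0.
Qed.

Lemma loxodromic_scale w a c l (s t : R) : s != 0 -> t != 0 ->
  loxodromic (X := X) w a c l -> loxodromic w (s *: a) (t *: c) l.
Proof.
move=> s0 t0 [l1 wa wc a0 c0]; split; rewrite ?scaler_eq0 ?negb_or ?s0 ?t0 //.
  by rewrite act_scale wa !scalerA mulrC.
by rewrite act_scale wc !scalerA mulrC.
Qed.

Lemma light_bounded (u : nat -> 'cV[R]_n) :
  (\forall k \near F, b (u k) (u k) = 0 /\ b (u k) o = 1) ->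
  exists l : 'cV[R]_n, u @ F --> l.
Proof.
move=> u1; have [C HC] := lorentz_coord oL.
apply: (@ultra_bounded_mx_cvg _ _ _ _ _ _ (C * 2 + 1)).
apply: filterS u1 => k [uu uo] i j; rewrite ord1; apply: sqr_le_norm_le.
by have := HC (u k) i; rewrite uu uo expr1n mulr1 add0r.
Qed.

(** Pairs of fixed lines of loxodromic elements are dense in the pairs of
    limit vectors: if g_k attracts to a and h_k repels from c, then
    g_k f h_k does both, unless f maps the attracting line of h_k to the
    repelling line of g_k; rescaled, it converges to a map of rank one with
    nonzero trace, so its trace tends to infinity. *)
Lemma limit_vectors_loxodromic a c : limit_vector a -> limit_vector c -> b a c != 0 ->
  exists a_ c_ : nat -> 'cV[R]_n, [/\ a_ @ F --> (b a o)^-1 *: a,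
    c_ @ F --> (b c o)^-1 *: c &
    \forall k \near F, exists w l, loxodromic (X := X) w (a_ k) (c_ k) l].
Proof.
move=> la lc ac.
have ao := light_o_neq0 oL (proj1 la) (limit_vector_light la).
have co := light_o_neq0 oL (proj1 lc) (limit_vector_light lc).
have [g [m [goo glim mm mo lm]]] := limit_vector_attracting la.
have [h [p [hoo hlim pp po]]] := limit_vector_repelling lc.
set a' := (b a o)^-1 *: a in glim *; set c' := (b c o)^-1 *: c in hlim *.
have a'o : b a' o = 1 by rewrite bform_scalel mulVf.
have c'o : b c' o = 1 by rewrite bform_scalel mulVf.
have ca' : b c' a' != 0.
  by rewrite bform_scalel bform_scaler (bC c a); do 2 (apply: mulf_neq0; first by rewrite invr_eq0).
have p0 : p != 0.
  by apply/eqP => p0; move: po; rewrite p0 bform0l => /esym/eqP; rewrite oner_eq0.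
have [f fpm] := no_invariant_line p0 (proj1 lm) pp mm.
pose w k := (g k * f * h k)%g.
pose e k := (N (g k))^-1 * (N (h k))^-1.
pose kap := b m (act f p).
have kap0 : kap != 0 by rewrite /kap bC.
pose T := kap *: rank_one X a' c'.
have Tlim : (fun k => e k *: geom_rep (w k)) @ F --> T.
  have -> : T = rank_one X a' m *m geom_rep f *m rank_one X p c'.
    by rewrite /T [X in _ = _ *m X]/rank_one mulmxA -(mulmxA _ _ p) -/(act f p) rank_oneE
      -scalemxAl.
  rewrite (_ : (fun k => _) = fun k => (N (g k))^-1 *: geom_rep (g k) *m geom_rep f *m
      ((N (h k))^-1 *: geom_rep (h k))).
    exact: (cvg_mulmx (cvg_mulmx glim (cvg_cst (geom_rep f))) hlim).
  apply/funext => k; rewrite /e /w !geom_repM -scalemxAr -!scalemxAl scalerA.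
  by congr (_ *: _); rewrite mulrC.
have trT : \tr T = kap * b c' a' by rewrite mxtraceZ rank_one_trace.
have trT0 : \tr T != 0 by rewrite trT mulf_neq0.
have e0 : e @ F --> 0.
  have H := cvgM (infty_inv_cvg0 goo) (infty_inv_cvg0 hoo).
  by rewrite mul0r in H; exact: H.
have trlim : (fun k => \tr (e k *: geom_rep (w k))) @ F --> \tr T by exact: cvg_mxtrace.
have e_neq0 : \forall k \near F, e k != 0.
  apply: filterS2 (goo 0) (hoo 0) => k; rewrite !normr_gt0 => gk hk.
  by rewrite mulf_neq0 ?invr_eq0.
(* the trace of w_k tends to infinity, so w_k is loxodromic *)
have big : \forall k \near F, n%:R < `|\tr (geom_rep (w k))|.
  have H1 : \forall k \near F, `|\tr T| / 2 < `|\tr (e k *: geom_rep (w k))|.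
    apply: (cvgr_gt _ (cvg_norm trlim)).
    by rewrite ltr_pdivrMr // ltr_pMr ?normr_gt0 // ltr1n.
  have H2 : \forall k \near F, `|e k| < `|\tr T| / 2 / (n%:R + 1).
    apply: (cvgr0_norm_lt _ e0).
    by rewrite !divr_gt0 ?normr_gt0 // ltr_wpDl.
  apply: filterS3 H1 H2 e_neq0 => k; rewrite mxtraceZ normrM => H1 H2 ek.
  have ek0 : 0 < `|e k| by rewrite normr_gt0.
  rewrite -(ltr_pM2l ek0); apply: le_lt_trans H1.
  move: H2; rewrite ltr_pdivlMr ?ltr_wpDl // => /ltW; apply: le_trans.
  by rewrite ler_pM2l // lerDl.
have /choice[u Hu] : forall k, exists u : 'cV[R]_n * 'cV[R]_n * R,
    n%:R < `|\tr (geom_rep (w k))| ->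
    [/\ loxodromic (w k) u.1.1 u.1.2 u.2, b u.1.1 o = 1, b u.1.2 o = 1 &
        `|\tr (geom_rep (w k))| <= n%:R * `|u.2|].
  move=> k; have [wk|wk] := pselect (n%:R < `|\tr (geom_rep (w k))|); last first.
    by exists (0, 0, 0) => /wk.
  have [x [y [l [L tl]]]] := large_trace_loxodromic oL wk.
  have [xx yy xy] := loxodromic_light oL L; have [_ _ _ x0 y0] := L.
  have xo := light_o_neq0 oL x0 xx; have yo := light_o_neq0 oL y0 yy.
  exists ((b x o)^-1 *: x, (b y o)^-1 *: y, l) => _ /=.
  by split; rewrite ?bform_scalel ?mulVf //; apply: loxodromic_scale; rewrite ?invr_eq0.
pose a_ k := (u k).1.1; pose c_ k := (u k).1.2; pose l_ k := (u k).2.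
have nearH : \forall k \near F, [/\ loxodromic (w k) (a_ k) (c_ k) (l_ k), b (a_ k) o = 1,
    b (c_ k) o = 1 & `|\tr (geom_rep (w k))| <= n%:R * `|l_ k|].
  by apply: filterS big => k; exact: Hu.
(* the fixed vectors of w_k are bounded; their limits are read off from T *)
have [a1 a1lim] : exists v : 'cV[R]_n, a_ @ F --> v.
  by apply: light_bounded; apply: filterS nearH => k [/(loxodromic_light oL)[]].
have [c1 c1lim] : exists v : 'cV[R]_n, c_ @ F --> v.
  by apply: light_bounded; apply: filterS nearH => k [/(loxodromic_light oL)[]].
have a1o : b a1 o = 1.
  apply: (real_lim_unique (cvg_bform a1lim (cvg_cst o))).
  have H : (fun _ : nat => 1 : R) @ F --> (1 : R) by exact: cvg_cst.
  by apply: near_eq_lim H _; apply: filterS nearH => k [].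
have c1o : b c1 o = 1.
  apply: (real_lim_unique (cvg_bform c1lim (cvg_cst o))).
  have H : (fun _ : nat => 1 : R) @ F --> (1 : R) by exact: cvg_cst.
  by apply: near_eq_lim H _; apply: filterS nearH => k [].
pose L := kap * b c' a1.
have Ta1 : (fun k => (e k *: geom_rep (w k)) *m a_ k) @ F --> T *m a1 by exact: cvg_mulmx.
have TE x : T *m x = (kap * b c' x) *: a'.
  by rewrite /T -scalemxAl rank_oneE scalerA.
have llim : (fun k => e k * l_ k) @ F --> L.
  have H : (fun k => b ((e k *: geom_rep (w k)) *m a_ k) o) @ F --> L.
    have -> : L = b (T *m a1) o by rewrite TE bform_scalel a'o mulr1.
    exact: (cvg_bform Ta1 (cvg_cst o)).
  apply: near_eq_lim H _; apply: filterS nearH => k [[_ wa _ _ _] ao1 _ _].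
  by rewrite -scalemxAl -/(act (w k) (a_ k)) wa !bform_scalel ao1 mulr1.
have L0 : L != 0.
  rewrite -normr_eq0 gt_eqF //.
  have : `|\tr T| <= n%:R * `|L|.
    have nl : (fun k => n%:R * `|e k * l_ k|) @ F --> n%:R * `|L|.
      exact: (cvgM (cvg_cst (n%:R : R)) (cvg_norm llim)).
    apply: (ler_cvg_to (cvg_norm trlim) nl).
    by apply: filterS nearH => k [_ _ _ tl]; rewrite mxtraceZ !normrM mulrCA ler_wpM2l.
  move: trT0; rewrite -normr_gt0 => t0 /(lt_le_trans t0).
  by apply: contraTT; rewrite -!leNgt normr_le0 => /eqP ->; rewrite normr0 mulr0.
have a1E : a1 = a'.
  apply: (scalerI L0); rewrite -[RHS]TE; apply: (mx_lim_unique (cvg_scalemx llim a1lim)).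
  apply: near_eq_lim Ta1 _; apply: filterS nearH => k [[_ wa _ _ _] _ _ _].
  by rewrite -scalemxAl -/(act (w k) (a_ k)) wa scalerA.
have c1E : c1 = c'.
  have H y : L * b c1 y = kap * b c' y * b c1 a'.
    rewrite -[RHS]bform_scaler -TE.
    apply: (real_lim_unique (cvgM llim (cvg_bform c1lim (cvg_cst y)))).
    have H : (fun k => b (c_ k) ((e k *: geom_rep (w k)) *m y)) @ F --> b c1 (T *m y).
      exact: (cvg_bform c1lim (cvg_mulmx Tlim (cvg_cst y))).
    apply: near_eq_lim H _; apply: filterS nearH => k [[l1 _ wc _ _] _ _ _].
    have lk0 : l_ k != 0 by apply: contraTneq l1 => ->; rewrite normr0 ltr10.
    rewrite -scalemxAl bform_scaler -[RHS]mulrA; congr (_ * _).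
    rewrite -/(act (w k) y) bC act_adj bC.
    have -> : act (w k)^-1 (c_ k) = l_ k *: c_ k.
      by rewrite -{2}[c_ k](actK (w k)) wc act_scale scalerA mulfV // scale1r.
    by rewrite bform_scalel.
  have := H o; rewrite c1o c'o !mulr1 => LE.
  apply: subr0_eq; apply: (lorentz_nondeg oL) => y.
  rewrite bform_addl bform_oppl; apply: (mulfI L0).
  by rewrite mulrBr H LE mulr0; ring.
exists a_, c_; split; [by rewrite -a1E|by rewrite -c1E|].
by apply: filterS nearH => k [Lk _ _ _]; exists (w k), (l_ k).
Qed.

Lemma limit_vectors_perp a c x : limit_vector a -> limit_vector c -> b a c != 0 ->
  b x a = 0 -> b x c = 0 -> K x.
Proof.
move=> la lc ac xa xc.
have ao := light_o_neq0 oL (proj1 la) (limit_vector_light la).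
have co := light_o_neq0 oL (proj1 lc) (limit_vector_light lc).
have [a_ [c_ [aa cc L]]] := limit_vectors_loxodromic la lc ac.
apply: (K_perp_limit aa cc); last 2 first.
- by rewrite bform_scaler xa mulr0.
- by rewrite bform_scaler xc mulr0.
- by rewrite !bformE !mulf_neq0 ?invr_eq0.
apply: filterS L => k [w [l L]]; have [? ? _] := loxodromic_light oL L.
split=> // y ya yc; apply: lox_perp_K; exists w, (a_ k), (c_ k), l.
by split.
Qed.

End LimitSet.

(** * Invariant planes and limits of orbits *)

Lemma sqr_cvg0 (R : realType) (F : set_system nat) (FF : ProperFilter F)
    (u v : nat -> R) (C : R) :
  (\forall k \near F, u k ^+ 2 <= C * v k) -> v @ F --> 0 -> u @ F --> 0.
Proof.
move=> uv v0; apply/cvgr0Pnorm_lt => e e0.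
have Cv : (fun k => C * v k) @ F --> (0 : R).
  by have H := cvgM (cvg_cst C) v0; rewrite mulr0 in H; exact: H.
have e2 : 0 < e ^+ 2 by rewrite exprn_gt0.
have small : \forall k \near F, `|C * v k| < e ^+ 2 by exact: (cvgr0_norm_lt _ Cv).
apply: filterS2 uv small => k uk vk.
rewrite -(ltr_pXn2r (n := 2)) ?nnegrE ?normr_ge0 ?(ltW e0) //.
rewrite real_normK ?num_real //; apply: le_lt_trans uk _.
by apply: le_lt_trans vk; exact: ler_norm.
Qed.

Section DihedralComponent.
Context {R : realType} {n : nat} (X : geomCoxeterSystem R n) (o : 'cV[R]_n).
Local Notation B := (gram_mx X).
Local Notation b := (bform B).
Local Notation al := (@simple_root R n).
Hypothesis oL : lorentz_form B o.

Let bC := lorentzC oL.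

Lemma simple_root_coord (s i : 'I_n) : al s i 0 = (i == s)%:R.
Proof. by rewrite mxE eqxx andbT. Qed.

Lemma gram_eq0 (s t : 'I_n) : s != t -> B s t = 0 -> cox_m X s t = Some 2%N.
Proof.
move=> st; have [[_ _ m2] _ _ _] := coxeter_systemP X.
rewrite mxE; case mst: (cox_m X s t) => [k|]; last first.
  by move=> /eqP; rewrite oppr_eq0 gt_eqF // (lt_le_trans ltr01) // cox_weight_ge1.
have k2 := m2 _ _ _ st mst.
case: (ltngtP k 2) k2 => // [k3 _ /eqP|-> //].
rewrite oppr_eq0 gt_eqF // cos_gt0_pihalf //.
have k0 : 0 < k%:R :> R by rewrite ltr0n (ltn_trans _ k3).
apply/andP; split.
  by rewrite (@lt_trans _ _ 0) ?oppr_lt0 ?divr_gt0 ?pi_gt0.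
by rewrite ltr_pM2l ?pi_gt0 // ltf_pV2 ?posrE // ltr_nat.
Qed.

(** Finite dihedral groups have definite planes. *)
Lemma gram_lt1 (s t : 'I_n) k : s != t -> cox_m X s t = Some k -> B s t ^+ 2 < 1.
Proof.
move=> st mst; have [[_ _ m2] _ _ _] := coxeter_systemP X.
have k2 := m2 _ _ _ st mst.
have k0 : 0 < k%:R :> R by rewrite ltr0n (ltn_trans _ k2).
rewrite mxE mst sqrrN; have := cos2Dsin2 (pi / k%:R : R).
have : 0 < sin (pi / k%:R : R).
  by rewrite sin_gt0_pi // divr_gt0 ?pi_gt0 //= ltr_pdivrMr // ltr_pMr ?pi_gt0 // ltr1n.
by nra.
Qed.

(** A Lorentzian plane invariant under the group: each simple root lies in the
    plane or is orthogonal to it; the simple roots being independent, exactly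
    two of them lie in the plane, and they generate an infinite dihedral
    component. *)
Lemma invariant_plane_dihedral (m m' : 'cV[R]_n) :
  m != 0 -> m' != 0 -> b m m = 0 -> b m' m' = 0 -> b m m' != 0 ->
  (forall s, exists p q, act (cox_gen X s) m = p *: m + q *: m') ->
  (forall s, exists p q, act (cox_gen X s) m' = p *: m + q *: m') ->
  has_infinite_dihedral_component X.
Proof.
move=> m0 m'0 mm m'm' mm' sm sm'.
pose S i := (b m (al i) != 0) || (b m' (al i) != 0).
have spanS i : S i -> exists p q, al i = p *: m + q *: m'.
  have aux (x : 'cV[R]_n) p q : b x (al i) != 0 -> act (cox_gen X i) x = p *: m + q *: m' ->
      al i = (2 * b x (al i))^-1 *: (x - (p *: m + q *: m')).
    move=> xi <-; rewrite act_gen opprB addrC subrK scalerA mulVf ?scale1r //.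
    by rewrite mulf_neq0 // pnatr_eq0.
  case/orP => xi.
    have [p [q E]] := sm i; rewrite (aux _ _ _ xi E).
    set k := _^-1; exists (k * (1 - p)), (- k * q).
    by apply/colP => j; rewrite !mxE; ring.
  have [p [q E]] := sm' i; rewrite (aux _ _ _ xi E).
  set k := _^-1; exists (- k * p), (k * (1 - q)).
  by apply/colP => j; rewrite !mxE; ring.
have perp0 x : b x m = 0 -> b x m' = 0 -> b x x = 0 -> x = 0.
  move=> xm xm' xx; apply/eqP; apply: contraT => x0.
  by have := two_light_perp_pos oL m0 m'0 mm m'm' mm' xm xm' x0; rewrite xx ltxx.
have supp i : ~~ S i -> m i 0 = 0.
  pose m1 := \sum_(j | S j) m j 0 *: al j; pose m2 := \sum_(j | ~~ S j) m j 0 *: al j.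
  have mE : m = m1 + m2.
    rewrite -(bigID S xpredT (fun j => m j 0 *: al j)) {1}[m]matrix_sum_delta.
    by apply: eq_bigr => j _; rewrite big_ord1.
  have m2m : b m2 m = 0.
    rewrite bform_suml big1 // => j; rewrite negb_or !negbK => /andP[/eqP jm _].
    by rewrite bform_scalel bC jm mulr0.
  have m2m' : b m2 m' = 0.
    rewrite bform_suml big1 // => j; rewrite negb_or !negbK => /andP[_ /eqP jm'].
    by rewrite bform_scalel bC jm' mulr0.
  have [p [q m1E]] : exists p q, m1 = p *: m + q *: m'.
    apply: (big_ind (fun v => exists p q, v = p *: m + q *: m')).
    - by exists 0, 0; rewrite !scale0r addr0.
    - by move=> u v [p [q ->]] [p' [q' ->]]; exists (p + p'), (q + q');
        rewrite !scalerDl addrACA.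
    move=> j /spanS[p [q ->]]; exists (m j 0 * p), (m j 0 * q).
    by rewrite scalerDr !scalerA.
  have m20 : m2 = 0.
    apply: perp0 => //; have {2}-> : m2 = m - m1 by rewrite [in RHS]mE addrC addKr.
    by rewrite m1E !bformE m2m m2m' !mulr0 addr0 subr0.
  move=> Si; have := congr1 (fun v : 'cV[R]_n => v i 0) m20.
  rewrite /m2 summxE mxE (bigD1 i) //= big1 => [|j /andP[_ ji]].
    by rewrite mxE simple_root_coord eqxx mulr1 addr0.
  by rewrite mxE simple_root_coord eq_sym (negPf ji) mulr0.
have [s ms] : exists s, m s 0 != 0.
  apply/existsP; apply: contraNT m0 => /existsPn H; apply/eqP/colP => i.
  by rewrite mxE; apply/eqP; have := H i; rewrite negbK.
have [t [ts mt]] : exists t, t != s /\ m t 0 != 0.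
  apply: contrapT => H; case/eqP: ms.
  have mE : m = m s 0 *: al s.
    apply/colP => i; rewrite mxE simple_root_coord.
    have [->|is'] := eqVneq i s; first by rewrite mulr1.
    by rewrite mulr0; apply/eqP; apply: contraT => mi; case: H; exists i.
  move: mm; rewrite {1 2}mE !bformE bform_simple gram_mx_diag mulr1 => /eqP.
  by rewrite -expr2 sqrf_eq0 => /eqP.
have Ss : S s by apply: contraT => /supp/eqP; rewrite (negPf ms).
have St : S t by apply: contraT => /supp/eqP; rewrite (negPf mt).
have [ps [qs sE]] := spanS s Ss; have [pt [qt tE]] := spanS t St.
have only_st u : u != s -> u != t -> ~~ S u.
  move=> us ut; apply/negP => /spanS[pu [qu uE]].
  have al_lin (x y z : R) : x *: al s + y *: al t + z *: al u = 0 ->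
      [/\ x = 0, y = 0 & z = 0].
    move=> H; have E i := congr1 (fun v : 'cV[R]_n => v i 0) H.
    move: (E s) (E t) (E u); rewrite !mxE !eqxx !andbT.
    rewrite (negPf us) (negPf ut) (negPf ts) (eq_sym s t) (eq_sym s u) (eq_sym t u).
    by rewrite (negPf us) (negPf ut) (negPf ts) !mulr0 !mulr1 !addr0 !add0r.
  have [_ _ D] : [/\ pt * qu - pu * qt = 0, pu * qs - ps * qu = 0 & ps * qt - pt * qs = 0].
    apply: al_lin; rewrite sE tE uE; apply/colP => i; rewrite !mxE; ring.
  have [qt0 /eqP] : qt = 0 /\ - qs = 0.
    have [] := @al_lin qt (- qs) 0; last by [].
    rewrite scale0r addr0 sE tE; apply/colP => i; rewrite !mxE.
    by rewrite -[RHS](mul0r (m i 0)) -D; ring.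
  rewrite oppr_eq0 => /eqP qs0.
  have [pt0] : [/\ pt = 0, - ps = 0 & 0 = 0 :> R].
    apply: al_lin; rewrite scale0r addr0 sE tE qt0 qs0; apply/colP => i; rewrite !mxE; ring.
  have := simple_root_coord t t; rewrite tE qt0 pt0 !scale0r addr0 mxE eqxx => /esym/eqP.
  by rewrite oner_eq0.
exists s, t; split; last first.
  move=> u us ut; have := only_st u us ut; rewrite negb_or !negbK => /andP[/eqP um /eqP um'].
  split; apply: gram_eq0 => //; rewrite -bform_simple.
    by rewrite sE !bformE (bC (al u) m) (bC (al u) m') um um' !mulr0 addr0.
  by rewrite tE !bformE (bC (al u) m) (bC (al u) m') um um' !mulr0 addr0.
case mst: (cox_m X s t) => [k|] //; exfalso.
have mE : m = m s 0 *: al s + m t 0 *: al t.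
  apply/colP => i; rewrite mxE [(_ *: al s) i 0]mxE [(_ *: al t) i 0]mxE !simple_root_coord.
  have [->|is'] := eqVneq i s; first by rewrite eq_sym (negPf ts) mulr0 mulr1 addr0.
  have [->|it] := eqVneq i t; first by rewrite mulr0 mulr1 add0r.
  by rewrite supp ?only_st // !mulr0 addr0.
have st : s != t by rewrite eq_sym.
have B1 := gram_lt1 st mst.
move: mm; rewrite mE !bformE !bform_simple !gram_mx_diag (gram_mx_sym X t s).
set x := m s 0 in ms *; set y := m t 0 in mt *; set g := B s t in B1 * => H.
have y2 : 0 < y ^+ 2 by rewrite exprn_even_gt0.
have : (x + g * y) ^+ 2 + (1 - g ^+ 2) * y ^+ 2 = 0 by rewrite -H; ring.
have : 0 < (1 - g ^+ 2) * y ^+ 2 by rewrite mulr_gt0 // subr_gt0.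
by have := sqr_ge0 (x + g * y); lra.
Qed.

End DihedralComponent.

Section LimitDirections.
Context {R : realType} {n : nat} (X : geomCoxeterSystem R n) (o : 'cV[R]_n).
Local Notation B := (gram_mx X).
Local Notation b := (bform B).
Hypothesis oL : lorentz_form B o.
Context {F : set_system nat} {FU : UltraFilter F}.
Local Notation N w := (b (act w o) o).
Local Notation K := (closure (lox_perp X)).
Local Notation limit_vector := (limit_vector X o (F := F)).

Let bC := lorentzC oL.

(** A limit vector v attracts: if q lies in a unimodular subspace and not in
    the orthogonal of the corresponding repelling vector m, then v is a limit of
    images of multiples of q. If all unimodular subspaces are orthogonal to m,
    then m is on one of the two fixed lines of every loxodromic element, and its
    orbit spans an invariant plane. *)
Lemma limit_vector_K v : ~ has_infinite_dihedral_component X ->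
  limit_vector v -> K v.
Proof.
move=> ndih lv; have [v0 _] := lv; have vv : b v v = 0 by exact: limit_vector_light lv.
have vo := light_o_neq0 oL v0 vv.
have [g [m [goo glim mm mo lm]]] := limit_vector_attracting oL lv.
have [m0 _] := lm.
have [[q [Kq mq]]|noq] := pselect (exists q, lox_perp X q /\ b m q != 0).
  have gq : (fun k => (N (g k))^-1 *: act (g k) q) @ F --> b m q *: ((b v o)^-1 *: v).
    rewrite -rank_oneE.
    have : (fun k => (N (g k))^-1 *: geom_rep (g k) *m q) @ F -->
        rank_one X ((b v o)^-1 *: v) m *m q by exact: (cvg_mulmx glim (cvg_cst q)).
    by under eq_cvg do rewrite -scalemxAl.
  have Kv : K (b m q *: ((b v o)^-1 *: v)).
    apply: (K_lim _ gq); apply: nearW => k.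
    by apply: K_scale; apply: K_act; exact: lox_perp_K.
  have := K_scale (t := b v o / b m q) Kv; rewrite !scalerA.
  by rewrite (_ : _ * _ * _ = 1) ?scale1r //; field; rewrite mq vo.
have perp q : lox_perp X q -> b m q = 0.
  by move=> Lq; apply/eqP; apply: contraT => mq; case: noq; exists q.
have [f0 f0m] := no_invariant_line oL m0 m0 mm mm.
have [a_ [c_ [_ _ /filter_ex[k [w [l L]]]]]] :=
  limit_vectors_loxodromic oL (limit_vector_act f0 lm) lm f0m.
have {f0m} m'm := f0m; set m' := act f0 m in m'm.
have [aa cc ac] := loxodromic_light oL L; have [_ _ _ a0 c0] := L.
set a := a_ k in L aa ac a0; set c := c_ k in L cc ac c0.
(* the orbit of m lies on the two fixed lines of w *)
have two (f : X) : exists t, act f m = t *: a \/ act f m = t *: c.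
  have Lf := loxodromic_conj f^-1%g L.
  set a' := act f^-1 a in Lf; set c' := act f^-1 c in Lf.
  have [aa' cc' ac'] := loxodromic_light oL Lf; have [_ _ _ a'0 c'0] := Lf.
  pose q := m - (b m c' / b a' c') *: a' - (b m a' / b a' c') *: c'.
  have qa : b q a' = 0 by rewrite /q !bformE aa' (bC c'); field.
  have qc : b q c' = 0 by rewrite /q !bformE cc'; field.
  have mq : b m q = 0.
    by apply: perp; exists (f^-1 * w * f^-1^-1)%g, a', c', l.
  have q0 : q = 0.
    apply/eqP; apply: contraT => q0.
    have := two_light_perp_pos oL a'0 c'0 aa' cc' ac' qa qc q0.
    rewrite {1}/q !bform_addl !bform_oppl !bform_scalel mq (bC a' q) qa.
    by rewrite (bC c' q) qc !mulr0 !subr0 ltxx.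
  have mE : m = (b m c' / b a' c') *: a' + (b m a' / b a' c') *: c'.
    by apply/eqP; rewrite -subr_eq0 opprD addrA -/q q0.
  move: mm; rewrite {1 2}mE !bformE aa' cc' (bC c' a') => H.
  have : (b m c' / b a' c') * (b m a' / b a' c') = 0.
    apply: (mulIf ac'); apply: (@mulfI _ 2); first by rewrite pnatr_eq0.
    by rewrite mul0r mulr0 -[RHS]H; ring.
  move=> /eqP; rewrite mulf_eq0 => /orP[] /eqP z0.
    exists (b m a' / b a' c'); right.
    by rewrite {1}mE z0 scale0r add0r act_scale /c' actVK.
  exists (b m c' / b a' c'); left.
  by rewrite {1}mE z0 scale0r addr0 act_scale /a' actVK.
have m'0 : m' != 0 by exact: act_neq0.
have m'm' : b m' m' = 0 by rewrite act_iso.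
have two' (f : X) : exists p q, act f m = p *: m + q *: m'.
  have [t fm] := two f; have [t1] := two 1%g; rewrite act1 => m1.
  have [t2 m2] := two f0; rewrite -/m' in m2.
  have inv (t' : R) (x y : 'cV[R]_n) : x != 0 -> x = t' *: y -> y = t'^-1 *: x.
    move=> x0 xE; rewrite xE scalerA mulVf ?scale1r //.
    by apply: contra_neq x0 => t0; rewrite xE t0 scale0r.
  have both (y : 'cV[R]_n) : b y y = 0 -> m = t1 *: y -> m' = t2 *: y -> False.
    by move=> yy mE m'E; move/eqP: m'm; apply; rewrite mE m'E !bformE yy !mulr0.
  case: m1 => m1; case: m2 => m2; try by [case: (both a)|case: (both c)].
    case: fm => ->.
      by exists (t * t1^-1), 0; rewrite {1}(inv _ _ _ m0 m1) scalerA scale0r addr0.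
    by exists 0, (t * t2^-1); rewrite {1}(inv _ _ _ m'0 m2) scalerA scale0r add0r.
  case: fm => ->; last by exists (t * t1^-1), 0; rewrite {1}(inv _ _ _ m0 m1) scalerA scale0r addr0.
  by exists 0, (t * t2^-1); rewrite {1}(inv _ _ _ m'0 m2) scalerA scale0r add0r.
case: ndih; apply: (@invariant_plane_dihedral _ _ _ _ oL m m') => //.
- by rewrite bC.
- by move=> s; rewrite /m' -actM.
Qed.

(** Here x is orthogonal to the repelling vector m, and p to the attracting
    vector a. Let v_k be the vector of the line of w_k m with b v_k o = 1, and v'
    its limit. As b (w_k x) (w_k m) = 0, p is orthogonal to v', and it is in K if
    v' and a are independent. If v' = a, choose a limit vector u not proportional
    to a. The vectors u_k on the lines of w_k^-1 u tend to the line of m, and they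
    do so tangentially to the orthogonal of x: the distance from x to the
    orthogonal of m and u_k, which is in K, tends to 0. So x is in K, and p is
    too. *)
Lemma spacelike_limit_K (w : nat -> X) (c : nat -> R) x p (a m : 'cV[R]_n) (gam : R) :
  (forall C, \forall k \near F, C < `|N (w k)|) ->
  (fun k => (N (w k))^-1 *: act (w k) o) @ F --> a ->
  limit_vector a -> limit_vector m -> b a o = 1 -> b m o = 1 ->
  b x m = 0 -> b p a = 0 -> c @ F --> gam -> gam != 0 ->
  (fun k => c k *: act (w k) x) @ F --> p -> K p.
Proof.
move=> Noo wa la lm ao mo xm pa cgam gam0 wp.
have [a0 _] := la; have [m0 _] := lm.
have aa : b a a = 0 by exact: limit_vector_light la.
have mm : b m m = 0 by exact: limit_vector_light lm.
pose M k := b (act (w k) m) o.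
have M0 k : M k != 0 by exact: (light_o_neq0 oL (act_neq0 _ m0) (etrans (act_iso _ _ _) mm)).
pose v k := (M k)^-1 *: act (w k) m.
have vv k : b (v k) (v k) = 0 by rewrite !bformE act_iso mm !mulr0.
have v_o k : b (v k) o = 1 by rewrite bform_scalel mulVf.
have [v' vlim] : exists v' : 'cV[R]_n, v @ F --> v'.
  by apply: (light_bounded oL); apply: nearW => k.
have v'v' : b v' v' = 0.
  apply: (real_lim_unique (cvg_bform vlim vlim)).
  by under eq_cvg do rewrite vv; exact: cvg_cst.
have v'o : b v' o = 1.
  apply: (real_lim_unique (cvg_bform vlim (cvg_cst o))).
  by under eq_cvg do rewrite v_o; exact: cvg_cst.
have pv' : b p v' = 0.
  apply: (real_lim_unique (cvg_bform wp vlim)).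
  under eq_cvg do rewrite bform_scalel bform_scaler act_iso xm !mulr0.
  exact: cvg_cst.
have MN : (fun k => (M k)^-1 * (N (w k))^-1) @ F --> b v' a.
  have : (fun k => b (v k) ((N (w k))^-1 *: act (w k) o)) @ F --> b v' a.
    exact: (cvg_bform vlim wa).
  by under eq_cvg do rewrite bform_scaler bform_scalel act_iso mo mulr1 mulrC.
have [v'a|v'a] := eqVneq (b v' a) 0; last first.
  (* w_k m tends to a line other than that of a: p is orthogonal to both *)
  apply: (@K_perp_limit _ _ X o oL F _ v (fun=> a) v' a) => //; first exact: cvg_cst.
  have va : (fun k => b (v k) a) @ F --> b v' a by exact: (cvg_bform vlim (cvg_cst a)).
  have va0 : \forall k \near F, b (v k) a != 0 by exact: (cvgr_neq0 _ va).
  apply: filterS va0 => k vka; split=> // y yv ya.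
  apply: (limit_vectors_perp oL (limit_vector_act (w k) lm) la) => //.
    by move: vka; rewrite bform_scalel mulf_eq0 negb_or => /andP[].
  by move/eqP: yv; rewrite bform_scaler mulf_eq0 invr_eq0 (negPf (M0 k)) => /eqP.
(* otherwise x is a limit of vectors orthogonal to m and w_k^-1 u *)
have v'E := light_normalized_eq oL v'v' aa v'a v'o ao.
suff Kx : K x.
  by apply: (K_lim _ wp); apply: nearW => k; apply: K_scale; exact: K_act.
have [f ua] := no_invariant_line oL a0 a0 aa aa.
set u := act f a in ua; have lu : limit_vector u by exact: limit_vector_act.
have uu : b u u = 0 by exact: limit_vector_light lu.
have [u0 _] := lu.
pose nu k := b u (act (w k) o); pose mu k := b u (act (w k) m).
have nulim : (fun k => (N (w k))^-1 * nu k) @ F --> b u a.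
  have : (fun k => b u ((N (w k))^-1 *: act (w k) o)) @ F --> b u a.
    exact: (cvg_bform (cvg_cst u) wa).
  by under eq_cvg do rewrite bform_scaler.
have mulim : (fun k => (M k)^-1 * mu k) @ F --> b u a.
  have : (fun k => b u (v k)) @ F --> b u a.
    by rewrite -v'E; exact: (cvg_bform (cvg_cst u) vlim).
  by under eq_cvg do rewrite bform_scaler.
have nu0 : \forall k \near F, (N (w k))^-1 * nu k != 0 by exact: (cvgr_neq0 _ nulim).
have mu0 : \forall k \near F, (M k)^-1 * mu k != 0 by exact: (cvgr_neq0 _ mulim).
pose u_ k := (nu k)^-1 *: act (w k)^-1 u.
pose del k := mu k / nu k.
have u_u k : b (u_ k) (u_ k) = 0 by rewrite !bformE act_iso uu !mulr0.
have u_o k : nu k != 0 -> b (u_ k) o = 1.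
  by move=> nk; rewrite bform_scalel act_adj invgK mulVf.
have u_m k : b (u_ k) m = del k by rewrite bform_scalel act_adj invgK mulrC.
have u_x z k : b z (u_ k) = (nu k)^-1 * b z (act (w k)^-1 u) by rewrite bform_scaler.
clearbody u_.
pose y k := (2 * del k)^-1 *: (m - u_ k) + 2^-1 *: o.
(* y k is orthogonal to m and pairs to 1 with u_k *)
pose x_ k := x - b x (u_ k) *: y k.
apply: (@K_lim _ _ X F _ x_).
  apply: filterS2 nu0 mu0 => k; rewrite !mulf_eq0 !negb_or => /andP[_ nk] /andP[_ mk].
  have dk : del k != 0 by rewrite mulf_neq0 ?invr_eq0.
  apply: (limit_vectors_perp oL lm (limit_vector_act (w k)^-1 lu)).
  - by rewrite bC act_adj invgK.
  - rewrite /x_ /y !bformE xm mm u_m (bC o m) mo; field; exact: dk.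
  suff : b (x_ k) (u_ k) = 0.
    by rewrite u_x => /eqP; rewrite mulf_eq0 invr_eq0 (negPf nk) => /eqP.
  rewrite /x_ /y !bform_addl bform_oppl !bform_scalel bform_addl bform_scalel
    bform_addl bform_oppl bform_scalel u_u (bC m) u_m (bC o) (u_o _ nk); field; exact: dk.
suff e0 : (fun k => b x (u_ k) *: y k) @ F --> (0 : 'cV[R]_n).
  by have H := cvgB (cvg_cst x) e0; rewrite subr0 in H; exact: H.
pose h k := b (act (w k) x) u.
have hlim : h @ F --> gam^-1 * b p u.
  have c0 : \forall k \near F, c k != 0 by exact: (cvgr_neq0 _ cgam).
  have H : (fun k => (c k)^-1 * b (c k *: act (w k) x) u) @ F --> gam^-1 * b p u.
    exact: (cvgM (cvgV gam0 cgam) (cvg_bform wp (cvg_cst u))).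
  apply: near_eq_lim H _; apply: filterS c0 => k ck.
  by rewrite bform_scalel mulKf.
have Ninv : (fun k => (N (w k))^-1) @ F --> 0 by exact: infty_inv_cvg0.
(* E k is the squared Euclidean norm of the correction b x (u_k) y_k, written
   with quantities whose limits are known *)
pose E k := h k ^+ 2 * (- (2^-1 * ((((N (w k))^-1 * nu k)^-1 * ((M k)^-1 * mu k)^-1) *
   ((M k)^-1 * (N (w k))^-1))) + 4^-1 * ((N (w k))^-1 * ((N (w k))^-1 * nu k)^-1) ^+ 2).
have E0 : E @ F --> (0 : R).
  have n1 : (fun k => ((N (w k))^-1 * nu k)^-1) @ F --> (b u a)^-1 by exact: cvgV.
  have m1 : (fun k => ((M k)^-1 * mu k)^-1) @ F --> (b u a)^-1 by exact: cvgV.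
  have sq (f1 : nat -> R) (l : R) : f1 @ F --> l -> (fun k => f1 k ^+ 2) @ F --> l ^+ 2.
    by move=> fl; exact: (cvgM fl fl).
  have H1 : (fun k => - (2^-1 * ((((N (w k))^-1 * nu k)^-1 * ((M k)^-1 * mu k)^-1) *
      ((M k)^-1 * (N (w k))^-1)))) @ F --> - (2^-1 * ((b u a)^-1 * (b u a)^-1 * b v' a)).
    exact: (cvgN (cvgM (cvg_cst (2^-1 : R)) (cvgM (cvgM n1 m1) MN))).
  have H2 : (fun k => 4^-1 * ((N (w k))^-1 * ((N (w k))^-1 * nu k)^-1) ^+ 2) @ F -->
      4^-1 * (0 * (b u a)^-1) ^+ 2.
    exact: (cvgM (cvg_cst (4^-1 : R)) (sq _ _ (cvgM Ninv n1))).
  have H := cvgM (sq _ _ hlim) (cvgD H1 H2).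
  by rewrite v'a mul0r expr0n !mulr0 oppr0 addr0 mulr0 in H; exact: H.
have [C HC] := lorentz_coord oL.
apply/mx_cvgP => i j; rewrite ord1 mxE.
apply: (@sqr_cvg0 _ _ _ _ E C) => //.
apply: filterS2 nu0 mu0 => k; rewrite !mulf_eq0 !negb_or => /andP[Nk nk] /andP[Mk mk].
rewrite invr_eq0 in Nk; rewrite invr_eq0 in Mk.
have dk : del k != 0 by rewrite mulf_neq0 ?invr_eq0.
apply: le_trans (HC _ _) _; rewrite le_eqVlt; apply/orP; left; apply/eqP; congr (_ * _).
have yo : b (y k) o = - 2^-1.
  rewrite /y bform_addl !bform_scalel bform_addl bform_oppl mo (u_o _ nk) (lorentz_oo oL).
  by rewrite subrr mulr0 add0r mulrN1.
have yy : b (y k) (y k) = - (2 * del k)^-1 - 4^-1.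
  have ym : b (y k) m = 0.
    rewrite /y bform_addl !bform_scalel bform_addl bform_oppl mm u_m (bC o m) mo.
    by field; exact: dk.
  have yu : b (y k) (u_ k) = 1.
    rewrite /y bform_addl !bform_scalel bform_addl bform_oppl u_u (bC m) u_m (bC o) (u_o _ nk).
    by field; exact: dk.
  rewrite {2}/y bform_addr !bform_scaler bform_addr bform_oppr ym yu yo.
  by field; exact: dk.
have xu : b x (u_ k) = h k / nu k.
  by rewrite u_x bC act_adj invgK mulrC bC.
rewrite bform_scalel bform_scaler bform_scalel yy yo xu /E /del; field.
by rewrite Nk nk Mk mk.
Qed.

(** If b x m is not zero, then w_k x / N_k tends to a nonzero multiple of a.
    Otherwise x is proportional to m or space-like; in the second case the c_k
    are bounded, and p is orthogonal to a, hence proportional to a or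
    space-like. *)
Lemma limit_direction_K (w : nat -> X) (c : nat -> R) (x p : 'cV[R]_n) :
  ~ has_infinite_dihedral_component X ->
  (forall C, \forall k \near F, C < `|N (w k)|) -> p != 0 ->
  (fun k => c k *: act (w k) x) @ F --> p -> K p.
Proof.
move=> ndih Noo p0 wp.
have [a [m [wlim wm [aa mm] [ao mo]]]] := rank_one_limit oL Noo.
have wx y : (fun k => (N (w k))^-1 *: act (w k) y) @ F --> b m y *: a.
  rewrite -rank_oneE.
  have : (fun k => (N (w k))^-1 *: geom_rep (w k) *m y) @ F --> rank_one X a m *m y.
    exact: (cvg_mulmx wlim (cvg_cst y)).
  by under eq_cvg do rewrite -scalemxAl.
have wa : (fun k => (N (w k))^-1 *: act (w k) o) @ F --> a.
  by have := wx o; rewrite mo scale1r.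
have la : limit_vector a by exact: (infty_limit_vector ao Noo wa).
have lm : limit_vector m.
  apply: (@infty_limit_vector _ _ X o F _ (fun k => (w k)^-1)%g) => //.
    by move=> C; apply: filterS (Noo C) => k; rewrite (norm_inv oL).
  by under eq_cvg do rewrite (norm_inv oL).
have Ka := limit_vector_K ndih la; have Km := limit_vector_K ndih lm.
have [a0 _] := la; have [m0 _] := lm.
have Nnz : \forall k \near F, N (w k) != 0.
  by apply: filterS (Noo 0) => k; rewrite normr_gt0.
have Kstep : K x -> K p.
  by move=> Kx; apply: (K_lim _ wp); apply: nearW => k; apply: K_scale; exact: K_act.
have [xm|mx] := eqVneq (b x m) 0; last first.
  (* x is attracted to the line of a *)
  rewrite bC in mx.
  have d1 : (fun k => b ((N (w k))^-1 *: act (w k) x) o) @ F --> b m x.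
    rewrite -[b m x]mulr1 -ao -bform_scalel; exact: (cvg_bform (wx x) (cvg_cst o)).
  have d2 : (fun k => b (c k *: act (w k) x) o) @ F --> b p o.
    exact: (cvg_bform wp (cvg_cst o)).
  have d10 : \forall k \near F, b ((N (w k))^-1 *: act (w k) x) o != 0 by exact: (cvgr_neq0 _ d1).
  have cN : (fun k => c k * N (w k)) @ F --> b p o / b m x.
    have H : (fun k => b (c k *: act (w k) x) o * (b ((N (w k))^-1 *: act (w k) x) o)^-1) @ F
        --> b p o / b m x by exact: (cvgM d2 (cvgV mx d1)).
    apply: near_eq_lim H _; apply: filterS2 d10 Nnz => k.
    rewrite !bform_scalel mulf_eq0 negb_or => /andP[_ xk] Nk.
    by field; rewrite xk Nk.
  have H : (fun k => (c k * N (w k)) *: ((N (w k))^-1 *: act (w k) x)) @ F -->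
      (b p o / b m x) *: (b m x *: a) by exact: (cvg_scalemx cN (wx x)).
  have H' : (fun k => c k *: act (w k) x) @ F --> (b p o / b m x) *: (b m x *: a).
    by apply: near_eq_lim H _; apply: filterS Nnz => k Nk; rewrite scalerA mulfK.
  by rewrite (mx_lim_unique wp H'); do 2 apply: K_scale.
have [xx0 xxE] := light_perp oL m0 mm xm.
have [xx|xx] := eqVneq (b x x) 0.
  by have [t xE] := xxE xx; apply: Kstep; rewrite xE; exact: K_scale.
have cc : (fun k => c k ^+ 2) @ F --> b p p / b x x.
  have H : (fun k => b (c k *: act (w k) x) (c k *: act (w k) x) * (b x x)^-1) @ F -->
      b p p / b x x by exact: (cvgM (cvg_bform wp wp) (cvg_cst (b x x)^-1)).
  apply: near_eq_lim H _; apply: nearW => k.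
  by rewrite bform_scalel bform_scaler act_iso mulrA mulfK.
have [gam cgam] : exists gam : R, c @ F --> gam.
  apply: (@ultra_bounded_cvg _ _ _ _ ((b p p / b x x + 1) + 1)).
  have : \forall k \near F, c k ^+ 2 < b p p / b x x + 1.
    by apply: (cvgr_lt _ cc); rewrite ltrDl.
  by apply: filterS => k /ltW; exact: sqr_le_norm_le.
have gam2 : gam ^+ 2 = b p p / b x x by exact: (real_lim_unique (cvgM cgam cgam) cc).
have pa : b p a = 0.
  apply: (real_lim_unique (cvg_bform wp wa)).
  rewrite (_ : (fun k => _) = fun k => c k * (N (w k))^-1 * b x o); last first.
    by apply/funext => k; rewrite bform_scalel bform_scaler act_iso mulrA.
  have Ninv : (fun k => (N (w k))^-1) @ F --> 0 by exact: infty_inv_cvg0.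
  have H := cvgM (cvgM cgam Ninv) (cvg_cst (b x o)).
  by rewrite mulr0 mul0r in H; exact: H.
have [pp|pp] := eqVneq (b p p) 0.
  by have [_ /(_ pp)[t ->]] := light_perp oL a0 aa pa; exact: K_scale.
apply: (spacelike_limit_K Noo wa la lm ao mo xm pa cgam _ wp).
by apply: contra_neq pp => g0; move: gam2; rewrite g0 expr0n => /esym/eqP;
  rewrite mulf_eq0 invr_eq0 (negPf xx) orbF => /eqP.
Qed.

End LimitDirections.

(** * Limit roots and limit directions *)

Lemma increasing_choice (P : nat -> nat -> Prop) :
  (forall i M, exists2 k, (M < k)%N & P i k) ->
  exists2 phi : nat -> nat, {homo phi : i j / (i < j)%N} & forall i, P i (phi i).
Proof.
move=> PM; pose f i M := sval (cid2 (PM i M)).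
have fM i M : (M < f i M)%N by rewrite /f; case: cid2.
have fP i M : P i (f i M) by rewrite /f; case: cid2.
pose phi := fix phi i := if i is j.+1 then f j.+1 (phi j) else f 0%N 0%N.
exists phi; last by case=> [|i]; exact: fP.
by apply: homo_ltn => [? ? ?|i]; [exact: ltn_trans|exact: fM].
Qed.

Lemma increasing_cvg (phi : nat -> nat) : {homo phi : i j / (i < j)%N} ->
  phi @ \oo --> \oo.
Proof.
move=> phi_lt A [N _ NA]; exists N => // k /= Nk; apply: NA => /=.
apply: leq_trans Nk _; elim: k => // k IH; exact: leq_ltn_trans IH (phi_lt _ _ (ltnSn k)).
Qed.

Section MainTheorem.
Context {R : realType} {n : nat} (X : geomCoxeterSystem R n) (o : 'cV[R]_n).
Local Notation B := (gram_mx X).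
Local Notation b := (bform B).
Hypothesis oL : lorentz_form B o.

Let bC := lorentzC oL.

(** By Sylvester's law any unit time-like vector can play the role of o. *)
Lemma timelike_lorentz_form (o' : 'cV[R]_n) : b o' o' = - 1 -> lorentz_form B o'.
Proof.
move=> o'o'; split=> // [|z zo' z0]; first exact: (lorentz_sym oL).
have o'o : b o' o != 0.
  by apply/eqP => /(lorentz_pos_le oL); rewrite o'o'; lra.
pose mu := b z o / b o' o.
have zo : b (z - mu *: o') o = 0 by rewrite !bformE /mu divfK ?subrr.
have zz : b (z - mu *: o') (z - mu *: o') = b z z - mu ^+ 2.
  by rewrite !bformE o'o' (bC o') zo'; ring.
have := lorentz_pos_le oL zo; rewrite zz subr_ge0 => zmu.
rewrite lt_neqAle (le_trans (sqr_ge0 mu) zmu) andbT; apply/eqP => zz0.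
have mu0 : mu = 0.
  by apply/eqP; rewrite -sqrf_eq0 eq_le sqr_ge0 andbT zz0.
by move: zo; rewrite mu0 scale0r subr0 => /(lorentz_pos oL)/(_ z0); rewrite -zz0 ltxx.
Qed.

(** Conjugating a generator by w gives the reflection in the image under w of its
    simple root. *)
Lemma root_reflection (g : 'cV[R]_n) : Defs.roots X g ->
  exists t : X, geom_rep t = 1%:M - 2 *: rank_one X g g.
Proof.
move=> [w [s ->]]; exists (w * cox_gen X s * w^-1)%g.
suff E (y : 'cV[R]_n) : act (w * cox_gen X s * w^-1)%g y =
    (1%:M - 2 *: rank_one X (act w (simple_root s)) (act w (simple_root s))) *m y.
  apply/matrixP => i j; have := congr1 (fun M : 'cV[R]_n => M i 0) (E (delta_mx j 0)).
  by rewrite /act -!colE !mxE.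
rewrite !actM act_gen act_sub act_scale actVK mulmxBl mul1mx -scalemxAl rank_oneE.
by rewrite scalerA [in RHS]act_adj bC.
Qed.

(** Roots have norm 1, so roots whose directions tend to the line of a vector x
    with b x x > 0 stay bounded; the reflections in them then converge along an
    ultrafilter, and by discreteness they are eventually equal. *)
Lemma limit_root_not_spacelike (g : nat -> nzvec R n) (x : nzvec R n) :
  injective g -> (forall i, Defs.roots X (\val (g i))) ->
  (fun i => proj_pt (g i)) @ \oo --> proj_pt x -> ~ 0 < b (\val x) (\val x).
Proof.
move=> g_inj groot gx xx.
have [F [FU ooF]] := free_ultrafilter.
have gxF : (fun i => proj_pt (g i)) @ F --> proj_pt x by move=> A /gx/ooF.
have [c cg] := proj_cvg_vector gxF.
have c2 : (fun k => c k ^+ 2) @ F --> b (\val x) (\val x).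
  have H : (fun k => b (c k *: \val (g k)) (c k *: \val (g k))) @ F --> b (\val x) (\val x).
    exact: (cvg_bform cg cg).
  apply: near_eq_lim H _; apply: nearW => k.
  by rewrite bform_scalel bform_scaler (root_norm (groot k)) mulr1.
have [gam cgam] : exists gam : R, c @ F --> gam.
  apply: (@ultra_bounded_cvg _ _ _ _ ((b (\val x) (\val x) + 1) + 1)).
  have : \forall k \near F, c k ^+ 2 < b (\val x) (\val x) + 1.
    by apply: (cvgr_lt _ c2); rewrite ltrDl.
  by apply: filterS => k /ltW; exact: sqr_le_norm_le.
have gam0 : gam != 0.
  have : gam ^+ 2 = b (\val x) (\val x) by exact: (real_lim_unique (cvgM cgam cgam) c2).
  by move=> E; rewrite -sqrf_eq0 E gt_eqF.
have glim : (fun k => \val (g k)) @ F --> gam^-1 *: \val x.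
  have c0 : \forall k \near F, c k != 0 by exact: (cvgr_neq0 _ cgam).
  have H : (fun k => (c k)^-1 *: (c k *: \val (g k))) @ F --> gam^-1 *: \val x.
    exact: (cvg_scalemx (cvgV gam0 cgam) cg).
  by apply: near_eq_lim H _; apply: filterS c0 => k ck; rewrite scalerA mulVf // scale1r.
have /choice[t tE] k := root_reflection (groot k).
pose A := 1%:M - 2 *: rank_one X (gam^-1 *: \val x) (gam^-1 *: \val x).
have tlim : (fun k => geom_rep (t k)) @ F --> A.
  rewrite (_ : (fun k => _) = fun k => 1%:M - 2 *: rank_one X (\val (g k)) (\val (g k))).
    apply: cvgB; first exact: cvg_cst.
    apply: cvg_scalemx; first exact: cvg_cst.
    exact: (cvg_mulmx glim (cvg_mulmx (cvg_trmx glim) (cvg_cst B))).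
  by apply/funext => k.
have [i ti] := converging_constant oL tlim.
have tact k y : act (t k) y = y - (2 * b (\val (g k)) y) *: \val (g k).
  by rewrite /act tE mulmxBl mul1mx -scalemxAl rank_oneE scalerA.
have pm : \forall j \near F, \val (g j) = \val (g i) \/ \val (g j) = - \val (g i).
  apply: filterS ti => j tij.
  have : act (t j) (\val (g i)) = act (t i) (\val (g i)) by rewrite tij.
  rewrite !tact (root_norm (groot i)) mulr1 scaler_nat mulr2n opprD addrA subrr sub0r.
  set s := b _ _ => E.
  have gi : \val (g i) = s *: \val (g j).
    apply: (@scalerI _ _ 2); first by rewrite pnatr_eq0.
    rewrite scalerA; apply/eqP; rewrite -subr_eq0 scaler_nat mulr2n addrAC E addrC.
    by rewrite subrr.
  have s2 : s ^+ 2 = 1.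
    have := root_norm (groot i); rewrite gi bform_scalel bform_scaler (root_norm (groot j)).
    by rewrite mulr1 -expr2.
  move/eqP: s2; rewrite sqrf_eq1 => /orP[] /eqP sE.
    by left; rewrite gi sE scale1r.
  by right; rewrite gi sE scaleN1r opprK.
have ne j : \forall k \near F, k != j by exact: free_ultra_neq.
have opp : \forall j \near F, \val (g j) = - \val (g i).
  apply: filterS2 pm (ne i) => j [/val_inj/g_inj -> |//]; by rewrite eqxx.
have [j jE] := filter_ex opp.
have [k [kE]] := filter_ex (filterI opp (ne j)).
by rewrite -jE in kE; move/val_inj/g_inj: kE => ->; rewrite eqxx.
Qed.

Lemma hyperbolic_unimodular_spacelike (p : projSpace R n) :
  hyperbolic_unimodular_set X p ->
  exists w a c l (x : nzvec R n), [/\ loxodromic (X := X) w a c l,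
    b (\val x) a = 0, b (\val x) c = 0, 0 < b (\val x) (\val x) & p = proj_pt x].
Proof.
move=> [w wh [x xU ->]]; have [a [c [l [L perp]]]] := hyperbolic_loxodromic oL wh.
have [xa xc] := perp _ xU; have [aa cc ac] := loxodromic_light oL L.
have [_ _ _ a0 c0] := L; exists w, a, c, l, x; split=> //.
exact: (two_light_perp_pos oL a0 c0 aa cc ac xa xc (nz_val_neq0 x)).
Qed.

Lemma hyperbolic_limit_root_disjoint :
  hyperbolic_unimodular_set X `&` limit_roots X = set0.
Proof.
apply/seteqP; split=> // p [/hyperbolic_unimodular_spacelike[w [a [c [l [x [_ _ _ xx pE]]]]]]].
by move=> [g [g_inj groot]]; rewrite pE => gx; case: (limit_root_not_spacelike g_inj groot gx).
Qed.

Lemma act_exp (w : X) (l : R) (y : 'cV[R]_n) k : act w y = l *: y ->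
  act (w ^+ k)%g y = l ^+ k *: y.
Proof.
move=> wy; elim: k => [|k IH]; first by rewrite expg0 act1 scale1r.
by rewrite expgS actM IH act_scale wy scalerA -exprSr.
Qed.

(** Poincare recurrence for the orthogonal of a and c, on which the form is a
    scalar product preserved by w. *)
Lemma loxodromic_recurrence (w : X) a c l (x : 'cV[R]_n) : loxodromic w a c l ->
  b x a = 0 -> b x c = 0 -> exists2 phi : nat -> nat,
    {homo phi : i j / (i < j)%N} & (fun i => act (w ^+ phi i)%g x) @ \oo --> x.
Proof.
move=> L xa xc; have [aa cc ac] := loxodromic_light oL L; have [l1 wa wc a0 c0] := L.
have [l0 _ _] := loxodromic_sq L.
(* a unit time-like vector orthogonal to the invariant space of x *)
pose o' := a - (2 * b a c)^-1 *: c.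
have o'L : lorentz_form B o'.
  apply: timelike_lorentz_form; rewrite /o' !bformE aa cc (bC c a); field; exact: ac.
have [C HC] := lorentz_coord o'L.
pose y k := act (w ^+ k)%g x.
have ya k : b (y k) a = 0.
  rewrite -[RHS](mulr0 (l ^+ k)^-1) -xa -(act_iso (w ^+ k)%g x) (act_exp _ wa).
  by rewrite bform_scaler mulKf ?expf_neq0.
have yc k : b (y k) c = 0.
  rewrite -[RHS](mulr0 (l^-1 ^+ k)^-1) -xc -(act_iso (w ^+ k)%g x) (act_exp _ wc).
  by rewrite bform_scaler mulKf ?expf_neq0 ?invr_eq0.
have yo' k : b (y k) o' = 0 by rewrite /o' bform_addr bform_oppr bform_scaler ya yc mulr0 subrr.
have [F [FU ooF]] := free_ultrafilter.
have [y' ylim] : exists y' : 'cV[R]_n, y @ F --> y'.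
  apply: (@ultra_bounded_mx_cvg _ _ _ _ _ _ (C * b x x + 1)).
  apply: nearW => k i j; rewrite ord1; apply: sqr_le_norm_le.
  by have := HC (y k) i; rewrite yo' act_iso expr0n mulr0 addr0.
pose z k := act (w ^+ k)%g x - x.
have rec (i M : nat) : exists2 k, (M < k)%N & b (z k) (z k) < i.+1%:R^-1.
  have e0 : 0 < i.+1%:R^-1 :> R by rewrite invr_gt0.
  have dlim h : (fun k => b (y h - y k) (y h - y k)) @ F --> b (y h - y') (y h - y').
    have d : (fun k => y h - y k) @ F --> y h - y' by exact: (cvgB (cvg_cst (y h)) ylim).
    exact: (cvg_bform d d).
  have dlim' : (fun h => b (y h - y') (y h - y')) @ F --> b (y' - y') (y' - y').
    have d : (fun k => y k - y') @ F --> y' - y' by exact: (cvgB ylim (cvg_cst y')).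
    exact: (cvg_bform d d).
  have : \forall h \near F, b (y h - y') (y h - y') < i.+1%:R^-1.
    by apply: (cvgr_lt _ dlim'); rewrite subrr bform0l.
  move=> /filter_ex[h hi].
  have near1 : \forall k \near F, b (y h - y k) (y h - y k) < i.+1%:R^-1.
    exact: (cvgr_lt _ (dlim h)).
  have near2 : \forall k \near F, (h + M < k)%N by apply: ooF; exists (h + M).+1.
  have [k [hk kM]] := filter_ex (filterI near1 near2).
  exists (k - h)%N; first by rewrite ltn_subRL.
  suff -> : b (z (k - h)%N) (z (k - h)%N) = b (y h - y k) (y h - y k) by [].
  rewrite -(act_iso (w ^+ h)%g) /z act_sub -actM -expgnDr subnKC.
    by rewrite -opprB bform_oppl bform_oppr opprK.
  by rewrite (leq_trans (leq_addr M h)) // ltnW.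
have [phi phi_lt phiP] := increasing_choice rec.
exists phi => //; apply/mx_cvgP => i j; rewrite ord1.
suff z0 : (fun k => z (phi k) i 0) @ \oo --> (0 : R).
  have H : (fun k => z (phi k) i 0 + x i 0) @ \oo --> 0 + x i 0.
    by apply: cvgD => //; exact: cvg_cst.
  rewrite add0r in H; apply: near_eq_lim H _; apply: nearW => k.
  by rewrite /z [X in X + _]mxE [X in _ + X + _]mxE subrK.
apply: (@sqr_cvg0 _ _ _ _ (fun k => k.+1%:R^-1) C); last exact: cvg_harmonic.
apply: nearW => k; apply: le_trans (HC _ _) _.
have C0 : 0 <= C.
  have := HC o' i; rewrite (lorentz_oo o'L); have := sqr_ge0 (o' i 0); lra.
have zo' : b (z (phi k)) o' = 0.
  rewrite /z bform_addl bform_oppl; have := yo' 0%N; have := yo' (phi k).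
  by rewrite /y expg0 act1 => -> ->; rewrite subrr.
rewrite ler_wpM2l // zo' expr0n mulr0 addr0.
exact/ltW/phiP.
Qed.

(** Let c span the repelling line of w. For large m, w^m c is small, so the images
    w^m (x + c) tend to x along the recurrence times of x. Their directions are
    pairwise distinct, as is seen by comparing the norms and the components
    along c. *)
Lemma hyperbolic_limit_direction :
  hyperbolic_unimodular_set X `<=` limit_directions X.
Proof.
move=> p /hyperbolic_unimodular_spacelike[w [a [c [l [x [L xa xc xx ->]]]]]].
have [aa cc ac] := loxodromic_light oL L; have [l1 wa wc a0 c0] := L.
have [l0 l2 _] := loxodromic_sq L.
have [phi phi_lt phi_lim] := loxodromic_recurrence L xa xc.
pose y := \val x + c.
have ya : b y a = b a c by rewrite bform_addl xa add0r bC.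
have y0 : y != 0 by apply: contra_neq ac => y0; rewrite -ya y0 bform0l.
have yy : b y y = b (\val x) (\val x) by rewrite /y !bformE cc (bC c) xc !addr0.
pose v i := nz_act (w ^+ phi i)%g (nz y0).
have vE i : proj_act (w ^+ phi i)%g (proj_pt (nz y0)) = proj_pt (v i) by exact: proj_act_pt.
have actc k : act (w ^+ k)%g c = l^-1 ^+ k *: c by exact: act_exp.
exists (nz y0), (fun i => w ^+ phi i)%g; split; last first.
  rewrite (_ : (fun i => _) = fun i => proj_pt (v i)); last by apply/funext => i; exact: vE.
  suff lim : (fun i => act (w ^+ phi i)%g y) @ \oo --> \val x by exact: proj_cvg.
  have lk : (fun i => l^-1 ^+ phi i *: c) @ \oo --> (0 : R) *: c.
    apply: cvg_scalemx; last exact: cvg_cst.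
    apply: (@cvg_comp _ _ _ phi (fun k => l^-1 ^+ k) _ _ _ (increasing_cvg phi_lt)).
    by apply: cvg_expr; rewrite normfV invf_lt1 // (lt_trans ltr01).
  have H : (fun i => act (w ^+ phi i)%g (\val x) + l^-1 ^+ phi i *: c) @ \oo --> \val x.
    by have H := cvgD phi_lim lk; rewrite scale0r addr0 in H; exact: H.
  by apply: near_eq_lim H _; apply: nearW => k; rewrite -actc -act_add.
move=> i j; rewrite !vE => /proj_pt_scale[t t0 /= tE].
have t2 : t ^+ 2 = 1.
  have := act_iso (w ^+ phi j)%g y y; rewrite tE bform_scalel bform_scaler act_iso mulrA.
  by rewrite -[RHS]mul1r => /(mulIf (x := b y y)); apply; rewrite yy gt_eqF.
have ak k : b (act (w ^+ k)%g y) a = l^-1 ^+ k * b a c.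
  have la : act (w ^+ k)^-1%g a = l^-1 ^+ k *: a.
    have lk0 : l ^+ k != 0 by rewrite expf_neq0.
    rewrite exprVn -{2}[a](actK (w ^+ k)%g) (act_exp _ wa) act_scale scalerA mulVf //.
    by rewrite scale1r.
  by rewrite act_adj la bform_scaler ya.
have := ak (phi j); rewrite tE bform_scalel ak mulrA => /(mulIf ac) tl.
have l2gt : 1 < l ^+ 2 by exact: norm_gt1_sq.
have : (l^-1 ^+ 2) ^+ phi i = (l^-1 ^+ 2) ^+ phi j.
  by rewrite -!exprM -!(mulnC _ 2%N) !exprM -tl exprMn t2 mul1r -!exprM mulnC.
have linv : 0 < l^-1 ^+ 2 by rewrite exprVn invr_gt0 (lt_trans ltr01).
have linv1 : l^-1 ^+ 2 != 1 by rewrite exprVn invr_eq1.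
move=> /(ieexprIn linv linv1) ij.
by case: (ltngtP i j) => // /phi_lt; rewrite ij ltnn.
Qed.

(** A limit root is the limit of roots w_i alpha_s for a single simple root;
    opposite roots are avoided by fixing the sign of some coordinate. *)
Lemma limit_root_limit_direction : limit_roots X `<=` limit_directions X.
Proof.
move=> p [g [g_inj groot gp]]; rewrite -[p]reprK in gp *.
set x : nzvec R n := repr p in gp *.
have [F [FU ooF]] := free_ultrafilter.
have gxF : (fun i => proj_pt (g i)) @ F --> proj_pt x by move=> A /gp/ooF.
have [c cg] := proj_cvg_vector gxF.
have [j xj] : exists j, \val x j 0 != 0.
  apply/existsP; apply: contraNT (nz_val_neq0 x) => /existsPn H; apply/eqP/colP => i.
  by rewrite mxE; apply/eqP; have := H i; rewrite negbK.
have gj : \forall i \near F, \val (g i) j 0 != 0.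
  have cgj : (fun i => (c i *: \val (g i)) j 0) @ F --> \val x j 0 by have /mx_cvgP := cg; exact.
  have : \forall i \near F, (c i *: \val (g i)) j 0 != 0 by exact: (cvgr_neq0 _ cgj).
  by apply: filterS => i; rewrite mxE mulf_eq0 negb_or => /andP[].
have /choice[u uE] i : exists u : X * 'I_n, \val (g i) = act u.1 (simple_root u.2).
  by have [w [s ->]] := groot i; exists (w, s).
have [s Fs] : exists s, \forall i \near F, (u i).2 = s.
  apply: contrapT => /forallNP Hs.
  have Fn : \forall i \near F, forall s, (u i).2 <> s.
    apply: filter_forall => s.
    by have [/Hs|] := in_ultra_setVsetC [set i | (u i).2 = s] FU.
  by have [i /(_ (u i).2)] := filter_ex Fn.
have [e [e0 Fe]] : exists e : R, e != 0 /\ \forall i \near F, 0 < e * \val (g i) j 0.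
  have [Fp|Fn] := in_ultra_setVsetC [set i | 0 < \val (g i) j 0] FU.
    by exists 1; rewrite oner_neq0; split=> //; apply: filterS Fp => i; rewrite mul1r.
  exists (- 1); rewrite oppr_eq0 oner_neq0; split=> //.
  apply: filterS2 Fn gj => i /= /negP; rewrite -leNgt mulN1r oppr_gt0 lt_neqAle => -> ->.
  by [].
have rec (i M : nat) : exists2 k, (M < k)%N & (u k).2 = s /\ 0 < e * \val (g k) j 0.
  have FM : \forall k \near F, (M < k)%N by apply: ooF; exists M.+1.
  by have [k [[ks ke] kM]] := filter_ex (filterI (filterI Fs Fe) FM); exists k.
have [phi phi_lt phiP] := increasing_choice rec.
have s0 : simple_root s != 0 :> 'cV[R]_n.
  apply/eqP => /matrixP/(_ s 0); rewrite !mxE !eqxx => /eqP; by rewrite oner_eq0.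
have actE i : proj_act (u (phi i)).1 (proj_pt (nz s0)) = proj_pt (g (phi i)).
  rewrite proj_act_pt; congr proj_pt; apply: val_inj => /=.
  by rewrite uE (proj1 (phiP i)).
exists (nz s0), (fun i => (u (phi i)).1); split; last first.
  rewrite (_ : (fun i => _) = fun i => proj_pt (g (phi i))); last by apply/funext => i; exact: actE.
  exact: (@cvg_comp _ _ _ phi (fun k => proj_pt (g k)) _ _ _ (increasing_cvg phi_lt) gp).
move=> i k; rewrite !actE => /proj_pt_scale[t t0 tE].
have t1 : t = 1.
  have : t ^+ 2 = 1.
    have := root_norm (groot (phi k)); rewrite tE bform_scalel bform_scaler.
    by rewrite (root_norm (groot _)) mulr1 -expr2.
  move=> /eqP; rewrite sqrf_eq1 => /orP[/eqP //|/eqP tN].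
  have [_ ei] := phiP i; have [_] := phiP k.
  by rewrite tE tN scaleN1r mxE mulrN oppr_gt0 ltNge ltW.
move: tE; rewrite t1 scale1r => /val_inj/g_inj ki.
by case: (ltngtP i k) => // /phi_lt; rewrite ki ltnn.
Qed.

(** Pass to vectors and apply limit_direction_K along an ultrafilter; the elements
    w_k are pairwise distinct, so their size tends to infinity. *)
Lemma limit_direction_closure : ~ has_infinite_dihedral_component X ->
  limit_directions X `<=` closure (hyperbolic_unimodular_set X).
Proof.
move=> ndih p [x0 [w [w_inj wp]]]; rewrite -[p]reprK in wp *.
set x : nzvec R n := repr p in wp *.
have [F [FU ooF]] := free_ultrafilter.
have wxF : (fun i => proj_pt (nz_act (w i) x0)) @ F --> proj_pt x.
  rewrite (_ : (fun i => _) = fun i => proj_act (w i) (proj_pt x0)).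
    by move=> A /wp/ooF.
  by apply/funext => i; rewrite proj_act_pt.
have [c cw] := proj_cvg_vector wxF.
have w_inj' : injective w.
  by move=> i j wij; apply: w_inj; rewrite wij.
have Noo (C : R) : \forall k \near F, C < `|b (act (w k) o) o|.
  exact: (norm_infty oL ooF w_inj').
have Kx : closure (lox_perp X) (\val x).
  exact: (limit_direction_K oL ndih Noo (nz_val_neq0 x) cw).
have := proj_closure Kx; apply: closure_subset => q [y [v [a [d [l [L [ya yd]]]]]] ->].
exists v; first exact: (loxodromic_hyperbolic oL L).
by exists y => //; exact: (loxodromic_perp_unimodular oL L ya yd).
Qed.

End MainTheorem.

Unset Implicit Arguments.

Theorem mainTheorem3 (R : realType) (n : nat) (X : geomCoxeterSystem R n)
    (hX : lorentzian X) :
  [/\ hyperbolic_unimodular_set X `&` limit_roots X = set0,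
      hyperbolic_unimodular_set X `|` limit_roots X `<=` limit_directions X &
      ~ has_infinite_dihedral_component X ->
        limit_directions X `<=` closure (hyperbolic_unimodular_set X)].
Proof.
have [v vL] := signature_lorentz_form (gram_sym X) hX.
split; first exact: (hyperbolic_limit_root_disjoint vL).
  move=> p [|]; first exact: (hyperbolic_limit_direction vL).
  exact: (limit_root_limit_direction (X := X)).
exact: (limit_direction_closure vL).
Qed.
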